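(* Let $f:\mathbb{H}\to\mathbb{H}$ be a left slice regular function with $f|_{\mathbb{R}}\in L^2(\mathbb{R})$, i.e. $\int_{-\infty}^{+\infty}|f(x)|^2\,dx<\infty$, and let $A>0$. Then the following two conditions are equivalent: (i) There exists a constant $C$ such that $|f(\mathbf{q})|\le Ce^{A|\mathbf{q}|}$ for all $\mathbf{q}\in\mathbb{H}$. (ii) $\operatorname{supp}\mathscr{F}_I(f|_{\mathbb{R}})\subset[-A,A]$ for all $I\in\mathbb{S}$. Moreover, if one of the conditions (i), (ii) holds, then for all $I\in\mathbb{S}$ and all $x,y\in\mathbb{R}$, $$f(x+Iy)=\frac{1}{\sqrt{2\pi}}\int_{-A}^{A}e^{I(x+Iy)t}\,\mathscr{F}_I(f|_{\mathbb{R}})(t)\,dt.$$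
   Context: $\mathbb{H}$ denotes the real quaternions with the usual norm $|\cdot|$, and $\mathbb{S}=\{I\in\mathbb{H}: I^2=-1\}$ is the unit sphere of purely imaginary quaternions. For $I\in\mathbb{S}$, $\mathbb{C}_I=\{x+Iy:x,y\in\mathbb{R}\}$, which is identified with the complex plane; $\mathbb{H}=\bigcup_{I\in\mathbb{S}}\mathbb{C}_I$. Left slice regular: for $\Omega\subset\mathbb{H}$ open, a real differentiable function $f:\Omega\to\mathbb{H}$ is left slice regular if for every $I\in\mathbb{S}$ the restriction $f_I$ of $f$ to $\Omega\cap\mathbb{C}_I$ satisfies $\frac12\left(\frac{\partial}{\partial x}+I\frac{\partial}{\partial y}\right)f_I(x+Iy)=0$ on $\Omega\cap\mathbb{C}_I$. One-dimensional left-sided quaternion Fourier transform: for $I\in\mathbb{S}$ and $F:\mathbb{R}\to\mathbb{H}$ in $L^1(\mathbb{R})$, $\mathscr{F}_I(F)(t)=\frac{1}{\sqrt{2\pi}}\int_{\mathbb{R}}e^{-Ixt}F(x)\,dx$ (the exponential multiplies from the left), where $e^{I\theta}=\cos\theta+I\sin\theta$. It is extended to $L^2(\mathbb{R})$ in the usual way (Plancherel). The support is understood in the almost-everywhere (distributional) sense. *)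

(* Defs.v *)
From HB Require Import structures.
From mathcomp Require Import all_boot all_order all_algebra.
From mathcomp Require Import all_classical all_reals all_analysis.
From mathcomp Require Import ring lra.

Set Warnings "-redundant-canonical-projection".
Set Implicit Arguments.
Unset Strict Implicit.
Unset Printing Implicit Defensive.

Import Order.TTheory GRing.Theory Num.Theory.
Import numFieldNormedType.Exports.

Local Open Scope classical_set_scope.
Local Open Scope ring_scope.

(* A quaternion is the row of its coordinates in the basis 1, i, j, k.  The    *)
(* normed module structure inherited from row vectors is that of the sup norm: *)
(* it is only used for the topology and for (real) differentiability, and the  *)
(* norm of quaternions is qnorm below.                                         *)
Definition quat (R : realType) : Type := 'rV[R]_4.

HB.instance Definition _ (R : realType) := NormedModule.on (quat R).
HB.instance Definition _ (R : realType) := Complete.on (quat R).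

Definition mkquat (R : realType) (a b c d : R) : quat R :=
  \row_(i < 4) [:: a; b; c; d]`_i.

Definition qcoord (R : realType) (i : nat) (q : quat R) : R :=
  q 0 (inord i : 'I_4).

Lemma qcoord_mkquat (R : realType) (a b c d : R) i : (i < 4)%N ->
  qcoord i (mkquat a b c d) = [:: a; b; c; d]`_i.
Proof. by move=> i4; rewrite /qcoord mxE inordK. Qed.

Lemma quatP (R : realType) (p q : quat R) :
  (forall i, (i < 4)%N -> qcoord i p = qcoord i q) -> p = q.
Proof.
move=> pq; apply/rowP => i.
by have := pq i (ltn_ord i); rewrite /qcoord inord_val.
Qed.

Lemma qcoordD (R : realType) i (p q : quat R) :
  qcoord i (p + q) = qcoord i p + qcoord i q.
Proof. by rewrite /qcoord mxE. Qed.

Lemma qcoordN (R : realType) i (p : quat R) : qcoord i (- p) = - qcoord i p.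
Proof. by rewrite /qcoord mxE. Qed.

Lemma qcoordZ (R : realType) i (a : R) (p : quat R) :
  qcoord i (a *: p) = a * qcoord i p.
Proof. by rewrite /qcoord mxE. Qed.

Lemma qcoord0 (R : realType) i : qcoord i (0 : quat R) = 0.
Proof. by rewrite /qcoord mxE. Qed.

Definition qone (R : realType) : quat R := mkquat 1 0 0 0.

Definition qmul (R : realType) (p q : quat R) : quat R :=
  let: (a, b, c, d) := (qcoord 0 p, qcoord 1 p, qcoord 2 p, qcoord 3 p) in
  let: (a', b', c', d') := (qcoord 0 q, qcoord 1 q, qcoord 2 q, qcoord 3 q) in
  mkquat (a * a' - b * b' - c * c' - d * d')
         (a * b' + b * a' + c * d' - d * c')
         (a * c' - b * d' + c * a' + d * b')
         (a * d' + b * c' - c * b' + d * a').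

Ltac qring := move=> *; apply: quatP => -[|[|[|[|i]]]] //= _;
  rewrite /qmul /qone
    ?(qcoord_mkquat, qcoordD, qcoordN, qcoordZ, qcoord0) //=
    ?(qcoord_mkquat, qcoordD, qcoordN, qcoordZ, qcoord0) //=; ring.

Lemma qmulA (R : realType) : associative (@qmul R).
Proof. qring. Qed.

Lemma qmul1q (R : realType) : left_id (@qone R) (@qmul R).
Proof. qring. Qed.

Lemma qmulq1 (R : realType) : right_id (@qone R) (@qmul R).
Proof. qring. Qed.

Lemma qmulDl (R : realType) : left_distributive (@qmul R) +%R.
Proof. qring. Qed.

Lemma qmulDr (R : realType) : right_distributive (@qmul R) +%R.
Proof. qring. Qed.

Lemma qone_neq0 (R : realType) : qone R != 0.
Proof.
apply/eqP => /(congr1 (@qcoord R 0)).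
by rewrite qcoord0 qcoord_mkquat //= => /eqP; rewrite oner_eq0.
Qed.

HB.instance Definition _ (R : realType) := GRing.Zmodule_isNzRing.Build (quat R)
  (@qmulA R) (@qmul1q R) (@qmulq1 R) (@qmulDl R) (@qmulDr R) (@qone_neq0 R).

Lemma qscalerAl (R : realType) (a : R) (p q : quat R) :
  a *: (p * q) = (a *: p) * q.
Proof. rewrite /GRing.mul /=; qring. Qed.

Lemma qscalerAr (R : realType) (a : R) (p q : quat R) :
  a *: (p * q) = p * (a *: q).
Proof. rewrite /GRing.mul /=; qring. Qed.

HB.instance Definition _ (R : realType) :=
  GRing.Lmodule_isLalgebra.Build R (quat R) (@qscalerAl R).
HB.instance Definition _ (R : realType) :=
  GRing.Lalgebra_isAlgebra.Build R (quat R) (@qscalerAr R).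

Definition qnorm (R : realType) (q : quat R) : R :=
  Num.sqrt (\sum_(i < 4) q 0 i ^+ 2).

Lemma qnormE (R : realType) (q : quat R) : qnorm q =
  Num.sqrt (qcoord 0 q ^+ 2 + qcoord 1 q ^+ 2 + qcoord 2 q ^+ 2 +
            qcoord 3 q ^+ 2).
Proof.
have E (i : 'I_4) : q 0 i = qcoord i q by rewrite /qcoord inord_val.
by rewrite /qnorm !big_ord_recr big_ord0 /= add0r !E.
Qed.

Definition qRe (R : realType) (q : quat R) : R := qcoord 0 q.
Definition qVec (R : realType) (q : quat R) : quat R := q - (qRe q)%:A.

Definition unit_sphere (R : realType) : set (quat R) :=
  [set I | I ^+ 2 = - 1].

Definition slice (R : realType) (I : quat R) (x y : R) : quat R :=
  x%:A + I * y%:A.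

(* The exponential of a quaternion, as e^a (cos r + (v / r) sin r) for a the   *)
(* real part, v the vector part and r = |v|; when v = 0 the term (v / r) sin r *)
(* is 0.  On each C_I, qexp is the complex exponential: see qexp_slice.        *)
Definition qexp (R : realType) (q : quat R) : quat R :=
  let r := qnorm (qVec q) in
  expR (qRe q) *: ((cos r)%:A + (sin r / r) *: qVec q).

Lemma unit_sphereP (R : realType) (I : quat R) : unit_sphere I ->
  qRe I = 0 /\ qnorm I = 1.
Proof.
rewrite /unit_sphere /= expr2 => I2.
have E i : (i < 4)%N -> qcoord i (qmul I I) = qcoord i (- qone R).
  by move=> _; congr qcoord; exact: I2.
have := E 0 isT; have := E 1 isT; have := E 2 isT; have := E 3 isT.
rewrite /qmul /qone !qcoordN !qcoord_mkquat //= ?qcoord_mkquat //=.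
rewrite qnormE /qRe.
set a := qcoord 0 I; set b := qcoord 1 I; set c := qcoord 2 I.
set d := qcoord 3 I => e3 e2 e1 e0.
have a0 : a = 0.
  have [//|an0] := eqVneq a 0.
  have z (x : R) : a * x = 0 -> x = 0.
    by move=> /eqP; rewrite mulf_eq0 (negbTE an0) /= => /eqP.
  have b0 : b = 0 by apply: z; lra.
  have c0 : c = 0 by apply: z; lra.
  have d0 : d = 0 by apply: z; lra.
  have a2 : a * a = -1 by rewrite -e0 b0 c0 d0 !mulr0 !subr0.
  have : 0 <= a * a by rewrite -expr2 sqr_ge0.
  by rewrite a2; lra.
have n1 : a ^+ 2 + b ^+ 2 + c ^+ 2 + d ^+ 2 = 1.
  by move: e0; rewrite a0 !expr2; lra.
by split => //; rewrite n1 sqrtr1.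
Qed.

Lemma qexp_slice (R : realType) (I : quat R) (a b : R) : unit_sphere I ->
  qexp (slice I a b) = expR a *: ((cos b)%:A + sin b *: I).
Proof.
move=> /unit_sphereP [I0 I1].
have re1 : qRe (1 : quat R) = 1 by rewrite /qRe qcoord_mkquat.
have sliceE : slice I a b = a%:A + b *: I.
  by rewrite /slice -scalerAr mulr1.
have reE : qRe (slice I a b) = a.
  move: I0 re1; rewrite sliceE /qRe qcoordD !qcoordZ => -> ->.
  by rewrite mulr0 addr0 mulr1.
have vecE : qVec (slice I a b) = b *: I.
  by rewrite /qVec reE sliceE addrC addKr.
have nE : qnorm (b *: I) = `|b|.
  rewrite /qnorm; under eq_bigr do rewrite mxE exprMn.
  by rewrite -mulr_sumr sqrtrM ?sqr_ge0 // sqrtr_sqr -/(qnorm I) I1 mulr1.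
rewrite /qexp reE vecE nE scalerA; congr (_ *: (_%:A + _ *: _)).
  by have [b0|b0] := ger0P b; rewrite ?cosN.
have [->|b0] := eqVneq b 0; first by rewrite mulr0 sin0.
by have [bp|bn] := ger0P b; rewrite ?sinN; field.
Qed.

Definition dbar (R : realType) (I : quat R) (f : quat R -> quat R) (x y : R)
    : quat R :=
  2^-1 *: (derive1 (fun s => f (slice I s y)) x +
           I * derive1 (fun s => f (slice I x s)) y).

Definition left_slice_regular (R : realType) (Omega : set (quat R))
    (f : quat R -> quat R) : Prop :=
  [/\ open Omega,
      forall q, Omega q -> differentiable f q &
      forall (I : quat R) (x y : R), unit_sphere I -> Omega (slice I x y) ->
        dbar I f x y = 0].

Section fourier.
Variable R : realType.
Local Notation mu := (@lebesgue_measure R).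

Definition qintegral (D : set R) (F : R -> quat R) : quat R :=
  \row_(i < 4) Rintegral mu D (fun x => F x 0 i).

Definition qLnorm (p : R) (F : R -> quat R) : \bar R :=
  Lnorm mu p%:E (fun x => (qnorm (F x))%:E).

Definition inLp (p : R) (F : R -> quat R) : Prop :=
  (forall i : 'I_4, measurable_fun setT (fun x => F x 0 i)) /\
  (qLnorm p F < +oo)%E.

Definition fourier1 (I : quat R) (F : R -> quat R) (t : R) : quat R :=
  (Num.sqrt (2 * pi))^-1 *:
    qintegral setT (fun x => qexp (- (I * (x * t)%:A)) * F x).

(* G represents the Plancherel extension of the transform at F: it is an L^2   *)
(* limit of the transforms of functions of L^1 and L^2 that tend to F in L^2.  *)
Definition is_fourier2 (I : quat R) (F G : R -> quat R) : Prop :=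
  inLp 2 G /\
  exists Fn : nat -> R -> quat R,
    [/\ forall n, inLp 1 (Fn n) /\ inLp 2 (Fn n),
        qLnorm 2 (Fn n \- F) @[n --> \oo] --> 0%E &
        qLnorm 2 (fourier1 I (Fn n) \- G) @[n --> \oo] --> 0%E].

(* For F in L^2 the set is nonempty by Plancherel, and the value is determined *)
(* up to a null set.                                                           *)
Definition fourier (I : quat R) (F : R -> quat R) : R -> quat R :=
  xget (cst 0) [set G | is_fourier2 I F G].

(* The complement of the largest open set on which G = 0 almost everywhere. *)
Definition ess_support (G : R -> quat R) : set R :=
  ~` \bigcup_(U in [set U | open U /\ {ae mu, forall t, U t -> G t = 0}]) U.

End fourier.

(* Main.v *)
Require Import Defs.
From mathcomp Require Import all_boot all_order all_algebra.
From mathcomp Require Import all_classical all_reals all_analysis.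
From mathcomp Require Import measurable_realfun.
From mathcomp Require Import ring lra.

Import Order.TTheory GRing.Theory Num.Theory.
Import numFieldNormedType.Exports.

(** On a slice, fix a square root I of - 1 and a coordinate k. The real functions
    u (x, y) = f (x + I y)_k and v (x, y) = - (I f (x + I y))_k satisfy the
    Cauchy-Riemann equations ([slice_regular_hol]), and the coordinates of the
    transform are combinations of cosine and sine transforms of real functions
    ([fourier1_coord]). The theorem thus becomes one of classical analysis about
    pairs of real functions; of the product of quaternions it uses the linearity
    of the multiplication by I, I I = - 1 and the multiplicativity of the norm.

    The link between f and G, the transform of its restriction to the real line,
    is the reconstruction formula: as soon as G vanishes almost everywhere off
    some bounded interval [- a, a], f (x + I y) is the integral of
    exp (I (x + I y) t) G t over this interval, up to the constant. On the real
    axis this is Fourier inversion ([inversion_formula]), obtained by Poisson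
    means; both sides are holomorphic on the slice, and a holomorphic pair is
    determined by its values on the real axis ([hol_identity], [slice_formula]).

    Growth implies band-limitedness in two steps. A contour shift of f
    exp (- z^2 / (2 n)) to the height - n or n shows that the transform of the
    damped function is O (exp (- n / 2)) beyond some bound larger than A, whence
    G vanishes there ([gauss_shift], [growth_far]). The reconstruction formula is
    then available on a band that is too wide. On the imaginary axis it
    exhibits f as a two-sided Laplace transform of G, and a bound of order
    exp (A |y|) on such a transform confines G to [- A, A] ([mikusinski],
    [growth_spectrum]).

    Conversely the reconstruction formula bounds f by exp (A |y|) times the
    integral of |G| over the band. This is bounded uniformly in I because the
    energy of G is controlled by that of f on the real line
    ([trig_transform_energy], [fourier2_energy], [growth_of_spectrum]). The same
    energy inequality makes the extension of the transform to square-integrable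
    functions exist and independent, up to null sets, of the approximating
    sequence ([fourier2_exists], [fourier2_approx]). *)

Set Implicit Arguments.
Unset Strict Implicit.
Unset Printing Implicit Defensive.

Local Open Scope classical_set_scope.
Local Open Scope ring_scope.

(** * Elementary estimates and integrals over segments *)

Section elementary.
Variable R : realType.
Local Notation mu := (@lebesgue_measure R).
Implicit Types (c p q s x eta : R).

Lemma eq_ler d (T : porderType d) (x y : T) : x = y -> (x <= y)%O.
Proof. by move=> ->. Qed.

Lemma norm_cos_le1 x : `|cos x| <= 1.
Proof. by rewrite ler_norml cos_geN1 cos_le1. Qed.

Lemma norm_sin_le1 x : `|sin x| <= 1.
Proof. by rewrite ler_norml sin_geN1 sin_le1. Qed.

Lemma norm_cos_sin_le p q s : `|p * cos s + q * sin s| <= `|p| + `|q|.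
Proof.
apply: le_trans (ler_normD _ _) _; rewrite !normrM.
by apply: lerD; apply: ler_piMr => //; [exact: norm_cos_le1|exact: norm_sin_le1].
Qed.

Lemma norm_le_1Dsqr x : `|x| <= 1 + x ^+ 2.
Proof.
rewrite -(real_normK (num_real x)).
by have := sqr_ge0 (`|x| - 2^-1); move: `|x| => r; nra.
Qed.

Lemma continuous_mulr c : continuous (fun x => c * x).
Proof. by move=> x; apply: cvgM; [exact: cvg_cst|exact: cvg_id]. Qed.

Lemma continuous_expR_mulr c : continuous (fun x => expR (c * x)).
Proof.
move=> x; apply: continuous_comp; last exact: continuous_expR.
exact: continuous_mulr.
Qed.

Lemma continuous_cos_mulr c : continuous (fun x => cos (c * x)).
Proof.
move=> x; apply: continuous_comp; last exact: continuous_cos.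
exact: continuous_mulr.
Qed.

Lemma continuous_sin_mulr c : continuous (fun x => sin (c * x)).
Proof.
move=> x; apply: continuous_comp; last exact: continuous_sin.
exact: continuous_mulr.
Qed.

Lemma continuous_exp_abs eta : continuous (fun x => expR (- (eta * `|x|))).
Proof.
move=> x; apply: continuous_comp; last exact: continuous_expR.
by apply: cvgN; apply: cvgM; [exact: cvg_cst|exact: norm_continuous].
Qed.

Lemma measurable_ltr_nat (D : set R) (f g : R -> R) :
  measurable (D : set (measurableTypeR R)) ->
  measurable_fun D f -> measurable_fun D g ->
  measurable_fun D (fun x => (f x < g x)%R%:R : R).
Proof.
move=> mD mf mg.
rewrite (_ : (fun x => _) = (fun b : bool => if b then 1 else 0) \o (fun x => f x < g x)).
  by apply: measurableT_comp => //; exact: measurable_fun_ltr.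
by apply/funext => x /=; case: (_ < _).
Qed.

End elementary.

Section segment_integrals.
Variable R : realType.
Local Notation mu := (@lebesgue_measure R).
Implicit Types (f g : R -> R) (a b c k e : R).

Lemma continuous_integrable_segment f a b :
  continuous f -> mu.-integrable `[a, b] (EFin \o f).
Proof.
move=> cf; apply: continuous_compact_integrable; first exact: segment_compact.
exact: continuous_subspaceT.
Qed.

Lemma Rintegral_segment_cat f a c b : continuous f -> a <= c -> c <= b ->
  \int[mu]_(x in `[a, b]) f x =
  \int[mu]_(x in `[a, c]) f x + \int[mu]_(x in `[c, b]) f x.
Proof.
move=> cf ac cb.
have := @Rintegral_itvB R f (BLeft a) (BRight b) c.
move=> /(_ (continuous_integrable_segment a b cf)).
rewrite !bnd_simp => /(_ ac cb) /eqP; rewrite subr_eq => /eqP ->.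
rewrite addrC Rintegral_itv_obnd_cbnd//.
apply: integrableS (continuous_integrable_segment a b cf) => //.
by apply: subset_itvr; rewrite bnd_simp.
Qed.

Lemma Rintegral_segment_cst a b k : a <= b ->
  \int[mu]_(x in `[a, b]) k = k * (b - a).
Proof.
move=> ab; rewrite Rintegral_cst//= lebesgue_measure_itv/= lte_fin.
by case: ltgtP ab => // -> _; rewrite subrr.
Qed.

Lemma Rintegral_segment_near_cst f a b k e : continuous f -> a <= b ->
  (forall x, a <= x <= b -> `|f x - k| <= e) ->
  `|\int[mu]_(x in `[a, b]) f x - k * (b - a)| <= e * (b - a).
Proof.
move=> cf ab fk.
have ik (h : R) : mu.-integrable `[a, b] (EFin \o cst h).
  by apply: continuous_integrable_segment; exact: cst_continuous.
rewrite -!Rintegral_segment_cst// -RintegralB//; [|exact: continuous_integrable_segment|exact: ik].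
have ifk : mu.-integrable `[a, b] (EFin \o (fun x => f x - k)).
  apply: continuous_integrable_segment => x.
  by apply: cvgB; [exact: cf|exact: cvg_cst].
apply: le_trans (le_normr_Rintegral _ ifk) _ => //.
apply: le_Rintegral => //; first exact: (integrable_norm ifk).
exact: ik.
Qed.

Lemma normr_Rintegral_segment_le f a b e : continuous f -> a <= b ->
  (forall x, a <= x <= b -> `|f x| <= e) ->
  `|\int[mu]_(x in `[a, b]) f x| <= e * (b - a).
Proof.
move=> cf ab fe; rewrite -[X in `|X|]subr0 -[X in _ - X](mul0r (b - a)).
by apply: Rintegral_segment_near_cst => // x xab; rewrite subr0 fe.
Qed.

End segment_integrals.

(** * Differentiability in the plane *)

Section plane_differentiability.
Variable R : realType.
Local Notation mu := (@lebesgue_measure R).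
Implicit Types (P Q u v : R -> R -> R) (x y p q : R).

(** Total differentiability at (x, y), with partial derivatives p and q, in
    epsilon-delta form: both Goursat's theorem and differentiation under the
    integral sign use the remainder estimate itself. *)
Definition diff2 P x y p q := forall e, 0 < e -> exists2 d, 0 < d &
  forall x' y', `|x' - x| < d -> `|y' - y| < d ->
    `|P x' y' - P x y - p * (x' - x) - q * (y' - y)|
      <= e * (`|x' - x| + `|y' - y|).

Lemma diff2_eq P x y p q p' q' :
  diff2 P x y p q -> p = p' -> q = q' -> diff2 P x y p' q'.
Proof. by move=> ? <- <-. Qed.

Lemma diff2_cst k x y : diff2 (fun _ _ => k) x y 0 0.
Proof.
move=> e e0; exists 1 => // x' y' _ _.
by rewrite subrr !mul0r !subr0 normr0 mulr_ge0 ?addr_ge0// ltW.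
Qed.

Lemma diff2_fst x y : diff2 (fun x _ => x) x y 1 0.
Proof.
move=> e e0; exists 1 => // x' y' _ _.
by rewrite mul1r mul0r subrr subr0 normr0 mulr_ge0 ?addr_ge0// ltW.
Qed.

Lemma diff2_snd x y : diff2 (fun _ y => y) x y 0 1.
Proof.
move=> e e0; exists 1 => // x' y' _ _.
by rewrite mul1r mul0r subr0 subrr normr0 mulr_ge0 ?addr_ge0// ltW.
Qed.

Lemma diff2D P Q x y p q p' q' : diff2 P x y p q -> diff2 Q x y p' q' ->
  diff2 (fun x y => P x y + Q x y) x y (p + p') (q + q').
Proof.
move=> dP dQ e e0; have e20 : 0 < e / 2 by rewrite divr_gt0.
have [d d0 Pd] := dP _ e20; have [d' d'0 Qd] := dQ _ e20.
exists (Num.min d d'); first by rewrite lt_min d0.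
move=> x' y'; rewrite !lt_min => /andP[x1 x2] /andP[y1 y2].
have := Pd _ _ x1 y1; have := Qd _ _ x2 y2.
set A := (X in `|X| <= _ -> _); set B := (X in _ -> `|X| <= _ -> _).
set S := `|_| + `|_| => hA hB.
rewrite (_ : _ - _ - _ - _ = A + B); last by rewrite /A /B; ring.
by apply: le_trans (ler_normD _ _) _; lra.
Qed.

Lemma diff2Z k P x y p q : diff2 P x y p q ->
  diff2 (fun x y => k * P x y) x y (k * p) (k * q).
Proof.
move=> dP e e0; have k0 : 0 < `|k| + 1 by rewrite ltr_wpDl.
have [d d0 Pd] := dP _ (divr_gt0 e0 k0).
exists d => // x' y' x1 y1; have := Pd _ _ x1 y1.
set A := (X in `|X| <= _ -> _); set S := `|_| + `|_| => hA.
rewrite (_ : _ - _ - _ - _ = k * A); last by rewrite /A; ring.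
have S0 : 0 <= S by rewrite addr_ge0.
rewrite normrM; apply: le_trans (ler_wpM2l _ hA) _ => //.
rewrite mulrA ler_wpM2r// mulrCA ger_pMr// ler_pdivrMr// mul1r.
by rewrite lerDl.
Qed.

Lemma diff2B P Q x y p q p' q' : diff2 P x y p q -> diff2 Q x y p' q' ->
  diff2 (fun x y => P x y - Q x y) x y (p - p') (q - q').
Proof.
move=> dP dQ; have := diff2D dP (diff2Z (-1) dQ).
rewrite !mulN1r.
by have -> : (fun x y => P x y + -1 * Q x y) = (fun x y => P x y - Q x y)
  by apply/funext => ?; apply/funext => ?; rewrite mulN1r.
Qed.

(** This replaces continuity at the point: it makes the cross terms of
    products and compositions of second order. *)
Lemma diff2_lipschitz P x y p q : diff2 P x y p q ->
  exists2 K, 0 < K & exists2 d, 0 < d & forall x' y',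
    `|x' - x| < d -> `|y' - y| < d ->
    `|P x' y' - P x y| <= K * (`|x' - x| + `|y' - y|).
Proof.
move=> /(_ 1 ltr01)[d d0 Pd]; exists (1 + `|p| + `|q|).
  by rewrite -addrA ltr_wpDr// addr_ge0.
exists d => // x' y' x1 y1; have := Pd _ _ x1 y1.
set A := (X in `|X| <= _ -> _) => hA.
rewrite (_ : _ - _ = A + p * (x' - x) + q * (y' - y)); last by rewrite /A; ring.
apply: le_trans (ler_normD _ _) _; rewrite normrM.
apply: le_trans (lerD (ler_normD _ _) (lexx _)) _; rewrite normrM.
move: hA; rewrite mul1r; move: `|A| `|p| `|q| `|x' - x| `|y' - y| (normr_ge0 p) (normr_ge0 q) (normr_ge0 (x' - x)) (normr_ge0 (y' - y)).
by move=> *; nra.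
Qed.

Lemma diff2M P Q x y p q p' q' : diff2 P x y p q -> diff2 Q x y p' q' ->
  diff2 (fun x y => P x y * Q x y) x y
    (p * Q x y + P x y * p') (q * Q x y + P x y * q').
Proof.
move=> dP dQ e e0.
have [K K0 [d1 d10 P1]] := diff2_lipschitz dP.
have [L L0 [d2 d20 Q1]] := diff2_lipschitz dQ.
pose M := 1 + `|P x y| + `|Q x y|.
have M0 : 0 < M by rewrite /M -addrA ltr_wpDr// addr_ge0.
pose e' := e / (3 * M); have e'0 : 0 < e' by rewrite divr_gt0// mulr_gt0.
have [d3 d30 P2] := dP _ e'0; have [d4 d40 Q2] := dQ _ e'0.
pose d5 := e / (6 * (K * L)).
have d50 : 0 < d5 by rewrite divr_gt0// !mulr_gt0.
exists (Num.min (Num.min d1 d2) (Num.min (Num.min d3 d4) d5)).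
  by rewrite !lt_min d10 d20 d30 d40 d50.
move=> x' y'; rewrite !lt_min.
move=> /andP[/andP[x1 x2] /andP[/andP[x3 x4] x5]].
move=> /andP[/andP[y1 y2] /andP[/andP[y3 y4] y5]].
have hP1 := P1 _ _ x1 y1; have hQ1 := Q1 _ _ x2 y2.
have := P2 _ _ x3 y3; have := Q2 _ _ x4 y4.
set A := (X in `|X| <= _ -> _); set B := (X in _ -> `|X| <= _ -> _) => hA hB.
set S := `|x' - x| + `|y' - y| in hP1 hQ1 hA hB *.
have S0 : 0 <= S by rewrite addr_ge0.
have Sd : S <= 2 * d5 by rewrite /S; lra.
rewrite (_ : _ - _ - _ - _ = B * Q x y + P x y * A +
  (P x' y' - P x y) * (Q x' y' - Q x y)); last by rewrite /A /B; ring.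
apply: le_trans (ler_normD _ _) _; rewrite normrM.
apply: le_trans (lerD (ler_normD _ _) (lexx _)) _; rewrite !normrM.
have e3 : e' * S * M = e / 3 * S by rewrite /e'; field; rewrite gt_eqF.
have h1 : `|B| * `|Q x y| <= e / 3 * S.
  rewrite -e3; apply: ler_pM => //; rewrite /M.
  by rewrite lerDr addr_ge0.
have h2 : `|P x y| * `|A| <= e / 3 * S.
  rewrite -e3 mulrC; apply: ler_pM => //; rewrite /M.
  by rewrite addrAC lerDr addr_ge0.
have h3 : `|P x' y' - P x y| * `|Q x' y' - Q x y| <= e / 3 * S.
  apply: le_trans (ler_pM _ _ hP1 hQ1) _ => //.
  rewrite (_ : K * S * (L * S) = K * L * S * S); last by ring.
  apply: ler_wpM2r => //.
  apply: le_trans (ler_wpM2l _ Sd) _; first by rewrite ltW// mulr_gt0.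
  rewrite /d5; apply: eq_ler; field.
  by rewrite !gt_eqF.
lra.
Qed.

Lemma is_derive_near (g : R -> R) (s g' e : R) : is_derive s 1 g g' -> 0 < e ->
  exists2 d, 0 < d & forall t, `|t - s| < d ->
    `|g t - g s - g' * (t - s)| <= e * `|t - s|.
Proof.
move=> dg e0.
have : h^-1 *: (g (h *: 1 + s) - g s) @[h --> 0^'] --> g'.
  by rewrite -[X in _ --> X](@derive_val _ _ _ _ _ _ _ dg); exact: ex_derive.
move/cvgrPdist_lt => /(_ _ e0)/nbhs_ballP[d /= d0 H].
exists d => // t ts; have [->|nts] := eqVneq t s.
  by rewrite !subrr mulr0 subr0 normr0 mulr0.
have ts0 : t - s != 0 by rewrite subr_eq0.
have := H (t - s); rewrite /ball/= sub0r normrN => /(_ ts ts0).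
rewrite /GRing.scale/= mulr1 subrK => /ltW hh.
have -> : g t - g s - g' * (t - s) = - ((t - s) * (g' - (t - s)^-1 * (g t - g s))).
  by field.
by rewrite normrN normrM mulrC ler_wpM2r.
Qed.

Lemma diff2_comp (g : R -> R) (g' : R) P x y p q : is_derive (P x y) 1 g g' ->
  diff2 P x y p q -> diff2 (fun x y => g (P x y)) x y (g' * p) (g' * q).
Proof.
move=> dg dP e e0.
have [K K0 [d1 d10 P1]] := diff2_lipschitz dP.
have e'0 : 0 < e / (2 * K) by rewrite divr_gt0// mulr_gt0.
have [d2 d20 g2] := is_derive_near dg e'0.
have g0 : 0 < `|g'| + 1 by rewrite ltr_wpDl.
have e''0 : 0 < e / (2 * (`|g'| + 1)) by rewrite divr_gt0// mulr_gt0.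
have [d3 d30 P3] := dP _ e''0.
have d40 : 0 < d2 / (2 * K) by rewrite divr_gt0// mulr_gt0.
exists (Num.min d1 (Num.min d3 (d2 / (2 * K)))).
  by rewrite !lt_min d10 d30 d40.
move=> x' y'; rewrite !lt_min => /and3P[x1 x3 x4] /and3P[y1 y3 y4].
have hP1 := P1 _ _ x1 y1; have := P3 _ _ x3 y3.
set A := (X in `|X| <= _ -> _) => hA.
set S := `|x' - x| + `|y' - y| in hP1 hA *.
have S0 : 0 <= S by rewrite addr_ge0.
have Pd : `|P x' y' - P x y| < d2.
  apply: le_lt_trans hP1 _; rewrite mulrC -ltr_pdivlMr//.
  have -> : d2 / K = d2 / (2 * K) + d2 / (2 * K) by field; rewrite gt_eqF.
  exact: ltrD.
have := g2 _ Pd; set B := (X in `|X| <= _ -> _) => hB.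
rewrite (_ : _ - _ - _ - _ = B + g' * A); last by rewrite /A /B; ring.
apply: le_trans (ler_normD _ _) _; rewrite normrM.
have h1 : `|B| <= e / 2 * S.
  apply: le_trans hB _; apply: le_trans (ler_wpM2l (ltW e'0) hP1) _.
  by apply: eq_ler; field; rewrite gt_eqF.
have h2 : `|g'| * `|A| <= e / 2 * S.
  apply: le_trans (ler_wpM2l _ hA) _ => //.
  rewrite mulrA ler_wpM2r//.
  have -> : e / 2 = (`|g'| + 1) * (e / (2 * (`|g'| + 1))).
    by field; rewrite gt_eqF.
  by rewrite ler_wpM2r ?lerDl// ltW.
lra.
Qed.


Lemma diff2_continuous P x y p q : diff2 P x y p q ->
  {for x, continuous (P ^~ y)} /\ {for y, continuous (P x)}.
Proof.
move=> /diff2_lipschitz[K K0 [d d0 PK]].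
have m0 (e : R) : 0 < e -> 0 < Num.min d (e / K).
  by move=> e0; rewrite lt_min d0 divr_gt0.
split; apply/cvgrPdist_le => e e0; apply/nbhs_ballP;
    exists (Num.min d (e / K)) => [|t] /=; rewrite ?m0//;
    rewrite /ball/= distrC lt_min => /andP[td tK]; rewrite distrC.
  apply: le_trans (PK _ _ td _) _; first by rewrite subrr normr0.
  by rewrite subrr normr0 addr0 mulrC -ler_pdivlMr// ltW.
apply: le_trans (PK _ _ _ td) _; first by rewrite subrr normr0.
by rewrite subrr normr0 add0r mulrC -ler_pdivlMr// ltW.
Qed.

End plane_differentiability.

(** * Goursat's theorem for closed forms *)

Section goursat.
Variable R : realType.
Local Notation mu := (@lebesgue_measure R).
Implicit Types (P Q u v : R -> R -> R) (x y p q a b c d l m : R).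

(** The form P dx + Q dy is closed pointwise: the number r is both the
    derivative of P in y and that of Q in x. These derivatives need not be
    continuous, so Green's formula is not at hand. *)
Definition closed_form P Q := forall x y, exists p r q,
  diff2 P x y p r /\ diff2 Q x y r q.

(** The integral of P dx + Q dy over the boundary of [a, b] x [c, d],
    counterclockwise, with opposite sides grouped. *)
Definition circulation P Q a b c d : R :=
  \int[mu]_(x in `[a, b]) (P x c - P x d) +
  \int[mu]_(y in `[c, d]) (Q b y - Q a y).

Section closed_form.
Variables P Q : R -> R -> R.
Hypothesis PQ : closed_form P Q.

Lemma closed_form_continuous : [/\ forall y, continuous (P ^~ y) &
  forall x, continuous (Q x)].
Proof.
split=> [y x|x y]; have [p [r [q [Pxy Qxy]]]] := PQ x y.
- exact: (diff2_continuous Pxy).1.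
- exact: (diff2_continuous Qxy).2.
Qed.

Let cP y : continuous (P ^~ y). Proof. by case: closed_form_continuous. Qed.
Let cQ x : continuous (Q x). Proof. by case: closed_form_continuous. Qed.

Let cPB c d : continuous (fun x => P x c - P x d).
Proof. by move=> x; apply: cvgB; exact: cP. Qed.
Let cQB a b : continuous (fun y => Q b y - Q a y).
Proof. by move=> x; apply: cvgB; exact: cQ. Qed.

Lemma circulation_hcat a e b c d : a <= e -> e <= b ->
  circulation P Q a b c d = circulation P Q a e c d + circulation P Q e b c d.
Proof.
move=> ae eb; rewrite /circulation (Rintegral_segment_cat (@cPB c d) ae eb).
have iQ x : mu.-integrable `[c, d] (EFin \o Q x).
  exact: continuous_integrable_segment.
have EQ x x' : \int[mu]_(y in `[c, d]) (Q x y - Q x' y) =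
    \int[mu]_(y in `[c, d]) Q x y - \int[mu]_(y in `[c, d]) Q x' y.
  by rewrite RintegralB.
by rewrite !EQ; ring.
Qed.

Lemma circulation_vcat a b c e d : c <= e -> e <= d ->
  circulation P Q a b c d = circulation P Q a b c e + circulation P Q a b e d.
Proof.
move=> ce ed; rewrite /circulation (Rintegral_segment_cat (@cQB a b) ce ed).
have iP y : mu.-integrable `[a, b] (EFin \o P ^~ y).
  exact: continuous_integrable_segment.
have EP y y' : \int[mu]_(x in `[a, b]) (P x y - P x y') =
    \int[mu]_(x in `[a, b]) P x y - \int[mu]_(x in `[a, b]) P x y'.
  by rewrite RintegralB.
by rewrite !EP; ring.
Qed.

(** The circulations of the four quarters of a rectangle add up to its
    circulation, so one of them carries at least a quarter of it. *)
Lemma circulation_quarter a l c m k : 0 <= l -> 0 <= m ->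
  k <= `|circulation P Q a (a + l) c (c + m)| ->
  exists a' c', [/\ a <= a', a' + l / 2 <= a + l, c <= c', c' + m / 2 <= c + m &
    k / 4 <= `|circulation P Q a' (a' + l / 2) c' (c' + m / 2)|].
Proof.
move=> l0 m0 kC.
have hl : a + l / 2 + l / 2 = a + l by field.
have hm : c + m / 2 + m / 2 = c + m by field.
have [C1|C1] := leP (k / 4) `|circulation P Q a (a + l / 2) c (c + m / 2)|.
  by exists a, c; split => //; lra.
have [C2|C2] := leP (k / 4)
    `|circulation P Q (a + l / 2) (a + l) c (c + m / 2)|.
  by exists (a + l / 2), c; rewrite hl; split => //; lra.
have [C3|C3] := leP (k / 4)
    `|circulation P Q a (a + l / 2) (c + m / 2) (c + m)|.
  by exists a, (c + m / 2); rewrite hm; split => //; lra.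
exists (a + l / 2), (c + m / 2); rewrite hl hm; split; try lra.
rewrite leNgt; apply/negP => C4.
have : circulation P Q a (a + l) c (c + m) =
    circulation P Q a (a + l / 2) c (c + m / 2) +
    circulation P Q (a + l / 2) (a + l) c (c + m / 2) +
    circulation P Q a (a + l / 2) (c + m / 2) (c + m) +
    circulation P Q (a + l / 2) (a + l) (c + m / 2) (c + m).
  rewrite (@circulation_hcat a (a + l / 2)); try lra.
  rewrite (@circulation_vcat a _ c (c + m / 2)); try lra.
  rewrite (@circulation_vcat (a + l / 2) _ c (c + m / 2)); try lra.
move=> E; move: kC; rewrite E.
set X1 := circulation _ _ _ _ _ _ in C1 *.
set X2 := circulation _ _ _ _ _ _ in C2 *.
set X3 := circulation _ _ _ _ _ _ in C3 *.
set X4 := circulation _ _ _ _ _ _ in C4 *.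
have := ler_normD (X1 + X2 + X3) X4; have := ler_normD (X1 + X2) X3.
have := ler_normD X1 X2; lra.
Qed.

(** The first order parts of P and Q at (x, y) form a closed affine form,
    whose circulation is 0; the remainders are at most e (l + m) on each side,
    hence contribute e (l + m)^2 at most. *)
Lemma circulation_small x y e : 0 < e -> exists2 r, 0 < r &
  forall a c l m, a <= x <= a + l -> c <= y <= c + m -> l < r -> m < r ->
  `|circulation P Q a (a + l) c (c + m)| <= e * (l + m) ^+ 2.
Proof.
move=> e0; have [p [s [q [dP dQ]]]] := PQ x y.
have e2 : 0 < e / 2 by rewrite divr_gt0.
have [d d0 Pd] := dP _ e2; have [d' d'0 Qd] := dQ _ e2.
exists (Num.min d d'); first by rewrite lt_min d0.
move=> a c l m xal ycm; rewrite !lt_min => /andP[ld ld'] /andP[md md'].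
have l0 : 0 <= l by lra.
have m0 : 0 <= m by lra.
have near_x t : a <= t <= a + l -> `|t - x| <= l by rewrite ler_norml; lra.
have near_y t : c <= t <= c + m -> `|t - y| <= m by rewrite ler_norml; lra.
have bP t z : a <= t <= a + l -> c <= z <= c + m ->
    `|P t z - P x y - p * (t - x) - s * (z - y)| <= e / 2 * (l + m).
  move=> /near_x tx /near_y zy.
  apply: le_trans (Pd _ _ (le_lt_trans tx ld) (le_lt_trans zy md)) _.
  by apply: ler_wpM2l; [exact: ltW|exact: lerD].
have bQ t z : a <= t <= a + l -> c <= z <= c + m ->
    `|Q t z - Q x y - s * (t - x) - q * (z - y)| <= e / 2 * (l + m).
  move=> /near_x tx /near_y zy.
  apply: le_trans (Qd _ _ (le_lt_trans tx ld') (le_lt_trans zy md')) _.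
  by apply: ler_wpM2l; [exact: ltW|exact: lerD].
have HP : `|\int[mu]_(t in `[a, a + l]) (P t c - P t (c + m)) -
    (- (s * m)) * (a + l - a)| <= e * (l + m) * (a + l - a).
  apply: Rintegral_segment_near_cst; [exact: cPB|lra|move=> t tal].
  have := bP t c tal; have := bP t (c + m) tal.
  rewrite (_ : c <= c <= c + m); last by lra.
  rewrite (_ : c <= c + m <= c + m); last by lra.
  move=> /(_ isT) h1 /(_ isT) h2.
  set A := (X in `|X| <= _) in h1; set B := (X in `|X| <= _) in h2.
  rewrite (_ : _ - _ - _ = B - A); last by rewrite /A /B; ring.
  by apply: le_trans (ler_normB _ _) _; lra.
have HQ : `|\int[mu]_(t in `[c, c + m]) (Q (a + l) t - Q a t) -
    (s * l) * (c + m - c)| <= e * (l + m) * (c + m - c).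
  apply: Rintegral_segment_near_cst; [exact: cQB|lra|move=> t tcm].
  have := bQ a t; have := bQ (a + l) t.
  rewrite (_ : a <= a <= a + l); last by lra.
  rewrite (_ : a <= a + l <= a + l); last by lra.
  move=> /(_ isT tcm) h1 /(_ isT tcm) h2.
  set A := (X in `|X| <= _) in h1; set B := (X in `|X| <= _) in h2.
  rewrite (_ : _ - _ - _ = A - B); last by rewrite /A /B; ring.
  by apply: le_trans (ler_normB _ _) _; lra.
rewrite /circulation; set X := Rintegral _ _ _ in HP *.
set Y := Rintegral _ _ _ in HQ *.
rewrite (_ : X + Y = (X - - (s * m) * (a + l - a)) +
  (Y - s * l * (c + m - c))); last by ring.
apply: le_trans (ler_normD _ _) _; apply: le_trans (lerD HP HQ) _.
by apply: eq_ler; ring.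
Qed.

(** The point is the supremum of the left ends. *)
Lemma nested_segments (a : nat -> R) l : 0 <= l ->
  (forall n, a n <= a n.+1 /\ a n.+1 + l / 2 ^+ n.+1 <= a n + l / 2 ^+ n) ->
  exists x, forall n, a n <= x <= a n + l / 2 ^+ n.
Proof.
move=> l0 ha.
have up i j : a i <= a (i + j)%N.
  elim: j => [|j IH]; first by rewrite addn0.
  by rewrite addnS; apply: le_trans IH _; case: (ha (i + j)%N).
have dn i j : a (i + j)%N + l / 2 ^+ (i + j) <= a i + l / 2 ^+ i.
  elim: j => [|j IH]; first by rewrite addn0.
  by rewrite addnS; apply: le_trans IH; case: (ha (i + j)%N).
have pos i : 0 <= l / 2 ^+ i by rewrite divr_ge0// exprn_ge0.
have ub i j : a i <= a j + l / 2 ^+ j.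
  have [ij|/ltnW ji] := leqP i j.
    by rewrite -(subnKC ij); apply: le_trans (up _ (j - i)%N) _; rewrite lerDl.
  by rewrite -{1}(subnKC ji); apply: le_trans (dn j (i - j)%N); rewrite lerDl.
have ub_ n : ubound (range a) (a n + l / 2 ^+ n) by move=> _ [i _ <-]; exact: ub.
exists (sup (range a)) => n; apply/andP; split.
  by apply: ub_le_sup; [exists (a 0%N + l / 2 ^+ 0); exact: ub_|exists n].
by apply: ge_sup; [exists (a 0%N); exists 0%N|exact: ub_].
Qed.

(** Repeated quartering keeps a circulation of at least K / 4^n on rectangles
    of sides l / 2^n and m / 2^n, whereas around their common point it is at
    most e (l + m)^2 / 4^n for any e. *)
Theorem goursat a b c d : a <= b -> c <= d -> circulation P Q a b c d = 0.
Proof.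
move=> ab cd; pose l := b - a; pose m := d - c.
have l0 : 0 <= l by rewrite subr_ge0.
have m0 : 0 <= m by rewrite subr_ge0.
have -> : b = a + l by rewrite addrC subrK.
have -> : d = c + m by rewrite addrC subrK.
apply/eqP/negPn/negP => K0.
pose K := `|circulation P Q a (a + l) c (c + m)|.
have Kp : 0 < K by rewrite normr_gt0.
pose big n (z : R * R) := K / 4 ^+ n <=
  `|circulation P Q z.1 (z.1 + l / 2 ^+ n) z.2 (z.2 + m / 2 ^+ n)|.
(* nxt selects the lower left corner of a quarter that keeps its share. *)
have /choice[nxt nxtP] : forall nz : nat * (R * R), exists z' : R * R,
    big nz.1 nz.2 -> [/\ nz.2.1 <= z'.1,
      z'.1 + l / 2 ^+ nz.1.+1 <= nz.2.1 + l / 2 ^+ nz.1, nz.2.2 <= z'.2,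
      z'.2 + m / 2 ^+ nz.1.+1 <= nz.2.2 + m / 2 ^+ nz.1 & big nz.1.+1 z'].
  move=> [n z] /=; have [bz|] := pselect (big n z); last by exists z.
  have [||a' [c' [h1 h2 h3 h4 h5]]] := circulation_quarter _ _ bz.
  - by rewrite divr_ge0// exprn_ge0.
  - by rewrite divr_ge0// exprn_ge0.
  have half (t : R) : t / 2 ^+ n.+1 = t / 2 ^+ n / 2.
    by rewrite exprS; field; rewrite expf_neq0.
  exists (a', c') => _ /=; rewrite /big/= !half; split => //.
  apply: le_trans h5; apply: eq_ler.
  by rewrite exprS; field; rewrite expf_neq0.
pose z := fix z n := if n is n'.+1 then nxt (n', z n') else (a, c).
have bigz n : big n (z n).
  elim: n => [|n IH]; first by rewrite /big/= !expr0 !divr1.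
  by have [] := nxtP (n, z n) IH.
have zS n := nxtP (n, z n) (bigz n).
have [x xP] : exists x, forall n, (z n).1 <= x <= (z n).1 + l / 2 ^+ n.
  by apply: (@nested_segments (fun n => (z n).1)) => // n; have [] := zS n.
have [y yP] : exists y, forall n, (z n).2 <= y <= (z n).2 + m / 2 ^+ n.
  by apply: (@nested_segments (fun n => (z n).2)) => // n; have [] := zS n.
have lm0 : 0 < (l + m) ^+ 2 + 1 by rewrite ltr_wpDl// sqr_ge0.
have e0 : 0 < K / (2 * ((l + m) ^+ 2 + 1)) by rewrite divr_gt0// mulr_gt0.
have [r r0 small] := circulation_small x y e0.
have [n nr] : exists n, (l + m) / 2 ^+ n < r.
  pose N := Num.bound ((l + m) / r); exists N.
  rewrite ltr_pdivrMr ?exprn_gt0// mulrC -ltr_pdivrMr//.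
  have hN : (l + m) / r < N%:R.
    apply: archi_boundP; apply: divr_ge0; [exact: addr_ge0|exact: ltW].
  apply: lt_trans hN _.
  by rewrite -natrX ltr_nat ltn_expl.
have h2 : 0 < (2 : R) ^+ n by rewrite exprn_gt0.
have := small (z n).1 (z n).2 (l / 2 ^+ n) (m / 2 ^+ n) (xP n) (yP n).
have -> : l / 2 ^+ n < r.
  by apply: le_lt_trans nr; rewrite ler_pM2r ?invr_gt0// lerDl.
have -> : m / 2 ^+ n < r.
  by apply: le_lt_trans nr; rewrite ler_pM2r ?invr_gt0// lerDr.
move=> /(_ isT isT) /(le_trans (bigz n)).
have -> : (4 : R) ^+ n = 2 ^+ n * 2 ^+ n by rewrite -exprMn; congr (_ ^+ n); ring.
rewrite (_ : (l / 2 ^+ n + m / 2 ^+ n) ^+ 2 = (l + m) ^+ 2 / (2 ^+ n * 2 ^+ n));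
  last by field; rewrite gt_eqF.
rewrite mulrA ler_pM2r ?invr_gt0 ?mulr_gt0//.
set S := (l + m) ^+ 2 in lm0 *; rewrite -mulrA ler_pMr//.
rewrite mulrC ler_pdivlMr ?mulr_gt0// mul1r.
have : 0 <= S by rewrite /S sqr_ge0.
lra.
Qed.

End closed_form.
End goursat.

(** * Holomorphic functions as pairs of real functions *)

Section holomorphic_pairs.
Variable R : realType.
Local Notation mu := (@lebesgue_measure R).
Implicit Types (u v : R -> R -> R) (x y p q a b c d : R).

(** Cauchy-Riemann: u + i v has the complex derivative p + i q. Complex
    analysis is carried out on such pairs, as the identification of a slice
    with the complex plane depends on the slice. *)
Definition hol u v := forall x y, exists p q,
  diff2 u x y p (- q) /\ diff2 v x y q p.

(** Multiplication by - i. *)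
Lemma hol_rot u v : hol u v -> hol v (fun x y => - u x y).
Proof.
move=> uv x y; have [p [q [du dv]]] := uv x y; exists q, (- p).
split; first by rewrite opprK.
have -> : (fun x y => - u x y) = (fun x y => -1 * u x y).
  by apply/funext => ?; apply/funext => ?; rewrite mulN1r.
by apply: diff2_eq (diff2Z (-1) du) _ _; ring.
Qed.

(** The real part of Cauchy's theorem on a rectangle: (u + i v)(dx + i dy) has
    the real part u dx - v dy, which is closed. *)
Lemma hol_rectangle u v a b c d : hol u v -> a <= b -> c <= d ->
  \int[mu]_(x in `[a, b]) (u x c - u x d) =
  \int[mu]_(y in `[c, d]) (v b y - v a y).
Proof.
move=> uv ab cd.
have := hol_rot (hol_rot (hol_rot uv)) => /= vu.
have cl : closed_form u (fun x y => - v x y).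
  move=> x y; have [p [q [du dv]]] := uv x y; exists p, (- q), (- p).
  split => //.
  have -> : (fun x y => - v x y) = (fun x y => -1 * v x y).
    by apply/funext => ?; apply/funext => ?; rewrite mulN1r.
  by apply: diff2_eq (diff2Z (-1) dv) _ _; ring.
have := goursat cl ab cd; rewrite /circulation => /eqP; rewrite addr_eq0.
have cv x : continuous (v x).
  move=> y; have [p [q [_ dv]]] := uv x y.
  exact: (diff2_continuous dv).2.
move=> /eqP ->; rewrite -mulN1r -RintegralZl//.
  by apply: eq_Rintegral => y _; ring.
apply: continuous_integrable_segment => y.
by apply: cvgB; apply: cvgN; exact: cv.
Qed.

Lemma hol_mul u v u' v' : hol u v -> hol u' v' ->
  hol (fun x y => u x y * u' x y - v x y * v' x y)
      (fun x y => u x y * v' x y + v x y * u' x y).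
Proof.
move=> uv uv' x y; have [p [q [du dv]]] := uv x y.
have [p' [q' [du' dv']]] := uv' x y.
exists (p * u' x y + u x y * p' - (q * v' x y + v x y * q')).
exists (p * v' x y + u x y * q' + (q * u' x y + v x y * p')).
split.
  by apply: diff2_eq (diff2B (diff2M du du') (diff2M dv dv')) _ _; ring.
by apply: diff2_eq (diff2D (diff2M du dv') (diff2M dv du')) _ _; ring.
Qed.

Lemma hol_exp u v : hol u v ->
  hol (fun x y => expR (u x y) * cos (v x y))
      (fun x y => expR (u x y) * sin (v x y)).
Proof.
move=> uv x y; have [p [q [du dv]]] := uv x y.
have dE := diff2_comp (is_derive_expR (u x y)) du.
have dC := diff2_comp (is_derive_cos (v x y)) dv.
have dS := diff2_comp (is_derive_sin (v x y)) dv.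
exists (expR (u x y) * (p * cos (v x y) - q * sin (v x y))).
exists (expR (u x y) * (p * sin (v x y) + q * cos (v x y))).
split; first by apply: diff2_eq (diff2M dE dC) _ _; ring.
by apply: diff2_eq (diff2M dE dS) _ _; ring.
Qed.

Lemma holB u v u' v' : hol u v -> hol u' v' ->
  hol (fun x y => u x y - u' x y) (fun x y => v x y - v' x y).
Proof.
move=> uv uv' x y; have [p [q [du dv]]] := uv x y.
have [p' [q' [du' dv']]] := uv' x y; exists (p - p'), (q - q'); split.
  by apply: diff2_eq (diff2B du du') _ _; ring.
by apply: diff2_eq (diff2B dv dv') _ _; ring.
Qed.

Lemma diff2_shift P t x y p q : diff2 P (t + x) y p q ->
  diff2 (fun x y => P (t + x) y : R) x y p q.
Proof.
move=> dP e e0; have [d d0 Pd] := dP _ e0; exists d => // x' y' x1 y1.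
by have := Pd (t + x') y'; rewrite opprD addrACA subrr add0r; apply.
Qed.

Lemma hol_shift u v t : hol u v ->
  hol (fun x y => u (t + x) y) (fun x y => v (t + x) y).
Proof.
move=> uv x y; have [p [q [du dv]]] := uv (t + x) y.
by exists p, q; split; exact: diff2_shift.
Qed.

Lemma diff2_conj P x y p q : diff2 P x (- y) p q ->
  diff2 (fun x y => P x (- y) : R) x y p (- q).
Proof.
move=> dP e e0; have [d d0 Pd] := dP _ e0; exists d => // x' y' x1 y1.
have := Pd x' (- y') x1; rewrite -opprD normrN => /(_ y1).
by rewrite mulrN mulNr.
Qed.

(** The pair of the function z |-> conj (h (conj z)). *)
Lemma hol_conj u v : hol u v ->
  hol (fun x y => u x (- y)) (fun x y => - v x (- y)).
Proof.
move=> uv x y; have [p [q [du dv]]] := uv x (- y); exists p, (- q).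
split; first exact: diff2_conj.
have -> : (fun x y => - v x (- y)) = (fun x y => -1 * v x (- y)).
  by apply/funext => ?; apply/funext => ?; rewrite mulN1r.
by apply: diff2_eq (diff2Z (-1) (diff2_conj dv)) _ _; ring.
Qed.

(** The function a z^2 + i b z. *)
Lemma hol_quadratic a b : hol (fun x y => a * (x * x - y * y) - b * y)
  (fun x y => a * (2 * (x * y)) + b * x).
Proof.
move=> x y; exists (2 * a * x), (2 * a * y + b); split.
  apply: diff2_eq (diff2B (diff2Z a (diff2B (diff2M (diff2_fst x y)
    (diff2_fst x y)) (diff2M (diff2_snd x y) (diff2_snd x y))))
    (diff2Z b (diff2_snd x y))) _ _; ring.
apply: diff2_eq (diff2D (diff2Z a (diff2Z 2 (diff2M (diff2_fst x y)
  (diff2_snd x y)))) (diff2Z b (diff2_fst x y))) _ _; ring.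
Qed.

Lemma norm_weight_re (p q E t : R) : 0 <= E ->
  `|p * (E * cos t) - q * (E * sin t)| <= (`|p| + `|q|) * E.
Proof.
move=> E0; apply: le_trans (ler_normB _ _) _; rewrite mulrDl !normrM.
rewrite (ger0_norm E0); apply: lerD; apply: ler_wpM2l => //.
  by rewrite ler_piMr// norm_cos_le1.
by rewrite ler_piMr// norm_sin_le1.
Qed.

Lemma norm_weight_im (p q E t : R) : 0 <= E ->
  `|p * (E * sin t) + q * (E * cos t)| <= (`|p| + `|q|) * E.
Proof.
move=> E0; apply: le_trans (ler_normD _ _) _; rewrite mulrDl !normrM.
rewrite (ger0_norm E0); apply: lerD; apply: ler_wpM2l => //.
  by rewrite ler_piMr// norm_sin_le1.
by rewrite ler_piMr// norm_cos_le1.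
Qed.

Lemma hol_continuous u v : hol u v ->
  [/\ forall x, continuous (u x), forall y, continuous (u ^~ y),
      forall x, continuous (v x) & forall y, continuous (v ^~ y)].
Proof.
by move=> uv; split=> [x y|y x|x y|y x];
  have [p [q [/diff2_continuous[? ?] /diff2_continuous[? ?]]]] := uv x y.
Qed.

End holomorphic_pairs.

(** * Mikusinski's lemma on exponential integrals *)

Section dominated_Rintegral.
Variable R : realType.
Local Notation mu := (@lebesgue_measure R).

Lemma aeS (P Q : R -> Prop) :
  (forall x, P x -> Q x) -> {ae mu, forall x, P x} -> {ae mu, forall x, Q x}.
Proof.
move=> PQ [N [mN N0 PN]]; exists N; split => // x nQ; apply: PN => Px.
exact/nQ/PQ.
Qed.

Lemma integrable_scale (D : set R) k (f : R -> R) : measurable D ->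
  mu.-integrable D (EFin \o f) ->
  mu.-integrable D (EFin \o (fun x => k * f x)).
Proof.
move=> mD if_.
have -> : EFin \o (fun x => k * f x) = (fun x => k%:E * (EFin \o f) x)%E.
  by apply/funext => x /=; rewrite EFinM.
exact: integrableZl.
Qed.

Lemma integrable_add (D : set R) (f g : R -> R) : measurable D ->
  mu.-integrable D (EFin \o f) -> mu.-integrable D (EFin \o g) ->
  mu.-integrable D (EFin \o (fun x => f x + g x)).
Proof.
move=> mD if_ ig.
have -> : EFin \o (fun x => f x + g x) = ((EFin \o f) \+ (EFin \o g))%E.
  by apply/funext => x /=; rewrite EFinD.
exact: integrableD.
Qed.

Lemma integrable_sub (D : set R) (f g : R -> R) : measurable D ->
  mu.-integrable D (EFin \o f) -> mu.-integrable D (EFin \o g) ->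
  mu.-integrable D (EFin \o (fun x => f x - g x)).
Proof.
move=> mD if_ ig.
have -> : EFin \o (fun x => f x - g x) = ((EFin \o f) \- (EFin \o g))%E.
  by apply/funext => x /=; rewrite EFinB.
exact: integrableB.
Qed.

Lemma integrable_dominated (D : set R) (f g : R -> R) : measurable D ->
  measurable_fun D f -> mu.-integrable D (EFin \o g) ->
  (forall x, D x -> `|f x| <= g x) -> mu.-integrable D (EFin \o f).
Proof.
move=> mD mf ig fg; apply: le_integrable ig => //.
  exact/measurable_EFinP.
move=> x Dx /=; rewrite lee_fin; apply: le_trans (fg x Dx) _.
exact: ler_norm.
Qed.

Lemma Rintegral_dominated_cvg (D : set R) (f_ : nat -> R -> R) (f g : R -> R) :
  measurable D -> (forall n, measurable_fun D (f_ n)) -> measurable_fun D f ->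
  {ae mu, forall x, D x -> f_ n x @[n --> \oo] --> f x} ->
  mu.-integrable D (EFin \o g) -> (forall n x, D x -> `|f_ n x| <= g x) ->
  \int[mu]_(x in D) f_ n x @[n --> \oo] --> \int[mu]_(x in D) f x.
Proof.
move=> mD mf_ mf ff ig fg.
have [|||||if_ _ cf] := @dominated_convergence _ _ _ mu D mD
    (fun n => EFin \o f_ n) (EFin \o f) (EFin \o g).
- by move=> n; apply/measurable_EFinP; exact: mf_.
- exact/measurable_EFinP.
- by apply: aeS ff => x fx Dx; apply: cvg_EFin; [exact: nearW|exact: fx].
- exact: ig.
- by apply: aeW => x n Dx; rewrite lee_fin fg.
rewrite /Rintegral; apply: fine_cvg.
rewrite fineK//; exact: (integrable_fin_num _ if_).
Qed.

End dominated_Rintegral.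

Section mikusinski.
Variable R : realType.
Local Notation mu := (@lebesgue_measure R).

Let expsum (w : R) N : R := \sum_(0 <= k < N) w ^+ k / k`!%:R.

Let expsum_cvg w : expsum w n @[n --> \oo] --> expR w.
Proof. exact: is_cvg_series_exp_coeff. Qed.

Let expsum_le w N : 0 <= w -> expsum w N <= expR w.
Proof.
move=> w0; rewrite /expR -[X in X <= _]/(series (exp_coeff w) N).
apply: nondecreasing_cvgn_le; last exact: is_cvg_series_exp_coeff.
by apply: nondecreasing_series => n _ _; exact: exp_coeff_ge0.
Qed.

Let expsum_norm w N : `|expsum w N| <= expR `|w|.
Proof.
apply: le_trans (expsum_le N (normr_ge0 w)); rewrite /expsum.
apply: le_trans (ler_norm_sum _ _ _) _; apply: ler_sum => k _.
by rewrite normrM normfV normrX (ger0_norm (ler0n _ _)).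
Qed.

Let cvg_expRn (a : R) : a < 0 -> expR (n%:R * a) @[n --> \oo] --> (0 : R).
Proof.
move=> a0; under eq_fun do rewrite expRM_natl.
by apply: cvg_expr; rewrite ger0_norm ?expR_ge0// expR_lt1.
Qed.

Variables (D : set R) (g s : R -> R) (S C beta : R).
Hypotheses (mD : measurable D) (ig : mu.-integrable D (EFin \o g))
  (cs : continuous s) (sS : forall x, D x -> `|s x| <= S)
  (bound : forall n, `|\int[mu]_(x in D) (g x * expR (n%:R * s x))|
     <= C * expR (n%:R * beta)).

Let mg : measurable_fun D g.
Proof. by case/integrableP : ig => /measurable_EFinP. Qed.

Let igM (h : R -> R) (M : R) : measurable_fun D h -> (forall x, D x -> `|h x| <= M) ->
  mu.-integrable D (EFin \o (fun x => g x * h x)).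
Proof.
move=> mh hM.
apply: (@integrable_dominated _ _ _ (fun x => M * `|g x|)) => //.
- exact: measurable_funM.
- by apply: integrable_scale => //; exact: (integrable_norm ig).
- by move=> x Dx; rewrite normrM mulrC ler_wpM2r// hM.
Qed.

Let ms : measurable_fun D s.
Proof. by apply: measurable_funTS; exact: continuous_measurable_fun. Qed.

Let expn n (tau x : R) := expR (n%:R * (s x - tau)).

Let mexpn n tau : measurable_fun D (expn n tau).
Proof.
apply: measurable_funTS; apply: continuous_measurable_fun => x.
apply: continuous_comp; last exact: continuous_expR.
apply: cvgM; first exact: cvg_cst.
by apply: cvgB; [exact: cs|exact: cvg_cst].
Qed.

Let expn_le n tau x : D x -> expn n tau x <= expR (n%:R * (S + `|tau|)).
Proof.
move=> Dx; rewrite ler_expR ler_wpM2l//.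
apply: lerD; first by apply: le_trans (ler_norm _) _; exact: sS.
by rewrite -normrN ler_norm.
Qed.

Let C0 : 0 <= C.
Proof.
by have := le_trans (normr_ge0 _) (bound 0); rewrite mul0r expR0 mulr1.
Qed.

(** Expanding 1 - exp (- exp (n (s - tau))) in powers of exp (n (s - tau))
    turns the integral into a series of integrals of g exp (k n s), each of
    which the hypothesis bounds; the bounds add up to an exponential series
    again. *)
Lemma mikusinski_bound tau n :
  `|\int[mu]_(x in D) (g x * (1 - expR (- expn n tau x)))| <=
  C * (expR (expR (n%:R * (beta - tau))) - 1).
Proof.
set W := expR (n%:R * (beta - tau)); have W0 : 0 <= W by exact: expR_ge0.
have cvN : \int[mu]_(x in D) (g x * (1 - expsum (- expn n tau x) N.+1))
    @[N --> \oo] --> \int[mu]_(x in D) (g x * (1 - expR (- expn n tau x))).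
  pose M := 1 + expR (expR (n%:R * (S + `|tau|))).
  apply: (@Rintegral_dominated_cvg _ _ _ _ (fun x => M * `|g x|)) => //.
  - move=> N; apply: measurable_funM => //; apply: measurable_funB => //.
    apply: measurable_sum => k; apply: measurable_funM => //.
    by apply: measurable_funX; exact: measurableT_comp.
  - apply: measurable_funM => //; apply: measurable_funB => //.
    apply: measurableT_comp => //; apply: measurableT_comp => //.
  - apply: aeW => x Dx; apply: cvgM; first exact: cvg_cst.
    apply: cvgB; first exact: cvg_cst.
    by have := @expsum_cvg (- expn n tau x); rewrite -cvg_shiftS.
  - by apply: integrable_scale => //; exact: (integrable_norm ig).
  - move=> N x Dx; rewrite normrM mulrC ler_wpM2r//.
    apply: le_trans (ler_normB _ _) _; rewrite normr1 lerD2l.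
    apply: le_trans (expsum_norm _ _) _; rewrite ler_expR normrN.
    by rewrite ger0_norm ?expR_ge0// expn_le.
have int_expsum N : mu.-integrable D
    (EFin \o (fun x => g x * (1 - expsum (- expn n tau x) N))).
  apply: (@igM _ (1 + expR (expR (n%:R * (S + `|tau|))))).
    apply: measurable_funB => //; apply: measurable_sum => k.
    apply: measurable_funM => //.
    by apply: measurable_funX; exact: measurableT_comp.
  move=> x Dx; apply: le_trans (ler_normB _ _) _; rewrite normr1 lerD2l.
  apply: le_trans (expsum_norm _ _) _; rewrite ler_expR normrN.
  by rewrite ger0_norm ?expR_ge0// expn_le.
apply: (cvgr_to_le (cvg_norm cvN)); apply: nearW => N /=.
have int_k k : mu.-integrable D (EFin \o (fun x => g x * expR (k%:R * s x))).
  apply: (@igM _ (expR (k%:R * S))).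
    apply: measurable_funTS; apply: continuous_measurable_fun => x.
    apply: continuous_comp; last exact: continuous_expR.
    by apply: cvgM; [exact: cvg_cst|exact: cs].
  move=> x Dx; rewrite ger0_norm ?expR_ge0// ler_expR ler_wpM2l//.
  by rewrite (le_trans (ler_norm _) (sS Dx)).
(* The powers of exp (n s) are exponentials of integer multiples of s, to
   which the hypothesis applies. *)
pose c k : R := - ((- expR (n%:R * - tau)) ^+ k.+1 / k.+1`!%:R).
have -> : \int[mu]_(x in D) (g x * (1 - expsum (- expn n tau x) N.+1)) =
    \sum_(0 <= k < N)
      c k * \int[mu]_(x in D) (g x * expR ((n * k.+1)%:R * s x)).
  elim: N => [|N IH].
    rewrite big_geq// -[RHS](mul0r (fine (mu D))) -(Rintegral_cst mu mD).
    apply: eq_Rintegral => x _.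
    by rewrite /expsum big_nat1 expr0 fact0 divr1 subrr mulr0.
  rewrite big_nat_recr//= -IH -RintegralZl//; try exact: int_k.
  rewrite -RintegralD//; last first.
    by apply: integrable_scale => //; exact: int_k.
  apply: eq_Rintegral => x _; rewrite [expsum _ N.+2]big_nat_recr//=.
  have E : expn n tau x = expR (n%:R * s x) * expR (n%:R * - tau).
    by rewrite /expn -expRD -mulrDr.
  have E2 : expR ((n * N.+1)%:R * s x) = expR (n%:R * s x) ^+ N.+1.
    by rewrite natrM mulrAC expRM_natr.
  rewrite E2 /c -/(expsum (- expn n tau x) N.+1).
  set e := expsum _ _; rewrite E -mulrN exprMn; ring.
apply: le_trans (ler_norm_sum _ _ _) _.
have -> : C * (expR W - 1) = C * (expR W - expsum W 1).
  by rewrite /expsum big_nat1 expr0 fact0 divr1.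
apply: le_trans (_ : \sum_(0 <= k < N) C * (W ^+ k.+1 / k.+1`!%:R) <= _).
  apply: ler_sum => k _; rewrite normrM /c normrN normrM normfV normrX normrN.
  rewrite !(ger0_norm (expR_ge0 _)) (ger0_norm (ler0n _ _)).
  apply: le_trans (ler_wpM2l _ (bound _)) _.
    by rewrite divr_ge0// exprn_ge0// expR_ge0.
  apply: eq_ler.
  have -> : W = expR (n%:R * beta) * expR (n%:R * - tau).
    by rewrite /W -expRD -mulrDr.
  have -> : expR ((n * k.+1)%:R * beta) = expR (n%:R * beta) ^+ k.+1.
    by rewrite natrM mulrAC expRM_natr.
  rewrite exprMn; ring.
rewrite -mulr_sumr ler_wpM2l//.
rewrite lerBrDr; apply: le_trans (expsum_le N.+1 W0).
by rewrite {1}/expsum big_nat1 [X in _ <= X]big_nat_recl// addrC.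
Qed.

(** As n grows, 1 - exp (- exp (n (s - tau))) tends to the indicator of s >
    tau, while the bound of the preceding lemma tends to 0 because beta < tau.
    *)
Lemma mikusinski tau : beta < tau -> {ae mu, forall x, D x -> s x != tau} ->
  \int[mu]_(x in D) (g x * (tau < s x)%R%:R) = 0.
Proof.
move=> bt st.
have c1 : \int[mu]_(x in D) (g x * (1 - expR (- expn n tau x)))
    @[n --> \oo] --> \int[mu]_(x in D) (g x * (tau < s x)%R%:R).
  apply: (@Rintegral_dominated_cvg _ _ _ _ (fun x => `|g x|)) => //.
  - move=> n; apply: measurable_funM => //; apply: measurable_funB => //.
    apply: measurableT_comp => //; apply: measurableT_comp => //.
  - apply: measurable_funM => //.
    exact: measurable_ltr_nat.
  - apply: aeS st => x sx Dx; apply: cvgM; first exact: cvg_cst.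
    move: (sx Dx); rewrite neq_lt => /orP[sx1|sx1].
      rewrite ltNge (ltW sx1)/= -[X in _ --> X](subrr 1).
      apply: cvgB; first exact: cvg_cst.
      rewrite -[X in _ --> X]expR0 -[X in expR X]oppr0.
      apply: continuous_cvg; first exact: continuous_expR.
      by apply: cvgN; apply: cvg_expRn; rewrite subr_lt0.
    rewrite sx1 /= -[X in _ --> X]subr0.
    apply: cvgB; first exact: cvg_cst.
    apply: (@squeeze_cvgr _ _ _ _ (cst 0) (fun n => expR (n%:R * (tau - s x)))).
    + apply: nearW => n /=; rewrite expR_ge0/= ler_expR -(opprB (s x)) mulrN.
      rewrite lerN2; apply: le_trans (expR_ge1Dx _).
      by rewrite lerDr.
    + exact: cvg_cst.
    + by apply: cvg_expRn; rewrite subr_lt0.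
  - exact: (integrable_norm ig).
  - move=> n x Dx; rewrite normrM ler_piMr//.
    rewrite ler_norml; apply/andP; split; last by rewrite lerBlDr lerDl expR_ge0.
    have : expR (- expn n tau x) <= 1.
      by rewrite -expR0 ler_expR oppr_le0 expR_ge0.
    by move=> h; lra.
have c2 : C * (expR (expR (n%:R * (beta - tau))) - 1) @[n --> \oo] --> (0 : R).
  rewrite -[X in _ --> X](mulr0 C); apply: cvgM.
    exact: cvg_cst.
  rewrite -[X in _ --> X](subrr 1); apply: cvgB; last exact: cvg_cst.
  rewrite -[X in _ --> X]expR0; apply: continuous_cvg.
    exact: continuous_expR.
  by apply: cvg_expRn; rewrite subr_lt0.
apply/eqP; rewrite -normr_le0.
apply: (ler_cvg_to (cvg_norm c1) c2).
by apply: nearW => n; exact: mikusinski_bound.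
Qed.

End mikusinski.

(** * Uniqueness from the values on the real axis *)

Section hol_identity.
Variable R : realType.
Local Notation mu := (@lebesgue_measure R).
Implicit Types (u v : R -> R -> R) (f : R -> R) (a b x y : R).

Lemma continuous_bounded_segment f a b : continuous f ->
  exists2 M, 0 <= M & forall x, a <= x <= b -> `|f x| <= M.
Proof.
move=> cf; have [ba|ab] := ltP b a.
  by exists 0 => // x; lra.
have cn : {within `[a, b], continuous (fun x => `|f x|)}.
  by apply: continuous_subspaceT => x; apply: cvg_norm; exact: cf.
have [c cab Mc] := EVT_max ab cn.
by exists `|f c| => // x xab; apply: Mc; rewrite in_itv.
Qed.

(** Averages of f over short intervals to the right of y are differences of
    the primitive. *)
Lemma continuous_primitive_eq0 f b : continuous f ->
  (forall y, 0 < y < b -> \int[mu]_(x in `[0, y]) f x = 0) ->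
  forall y, 0 < y < b -> f y = 0.
Proof.
move=> cf f0 y /andP[y0 yb]; apply/eqP/negPn/negP => fy.
have e0 : 0 < `|f y| / 2 by rewrite divr_gt0// normr_gt0.
have /cvgrPdist_le /(_ _ e0) /nbhs_ballP[d /= d0 fd] := cf y.
pose h := Num.min (d / 2) ((b - y) / 2).
have h0 : 0 < h by rewrite lt_min !divr_gt0// subr_gt0.
have hd : h < d.
  by apply: le_lt_trans (_ : d / 2 < d); [rewrite ge_min lexx|lra].
have hb : y + h < b.
  have : h <= (b - y) / 2 by rewrite ge_min lexx orbT.
  by lra.
have := @Rintegral_segment_near_cst R f y (y + h) (f y) (`|f y| / 2) cf.
have -> : y <= y + h by lra.
have -> : \int[mu]_(x in `[y, (y + h)%R]) f x = 0.
  have := @Rintegral_segment_cat R f 0 y (y + h) cf.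
  rewrite !f0; [|lra|lra].
  have -> : 0 <= y by lra.
  have -> : y <= y + h by lra.
  by move=> /(_ isT isT); rewrite add0r.
have -> : y + h - y = h by ring.
move=> /(_ isT); rewrite sub0r normrN normrM (gtr0_norm h0).
rewrite ler_pM2r// => H.
suff : `|f y| <= `|f y| / 2 by have := fy; rewrite -normr_gt0; lra.
apply: H => x /andP[yx xh]; rewrite distrC; apply: fd.
by rewrite /ball/= ler0_norm ?subr_le0//; lra.
Qed.

(** Cauchy's theorem on the square [- b, 0] x [0, b] for (u + i v) exp (n (i z
    - z^2 / (2 b))). The side on the real axis contributes 0, the side on the
    imaginary axis is the integral in question, and on the two other sides the
    weight has modulus at most exp (- n b / 2). *)
Lemma hol_axis_bound u v b : hol u v -> 0 < b ->
  (forall x, u x 0 = 0) -> (forall x, v x 0 = 0) ->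
  exists C, forall n, `|\int[mu]_(y in `[0, b])
     (v 0 y * expR (n%:R * (y ^+ 2 / (2 * b) - y)))|
   <= C * expR (n%:R * (- (b / 2))).
Proof.
move=> uv b0 u0 v0; have [cu cu' cv cv'] := hol_continuous uv.
have [M1 M10 uM1] := continuous_bounded_segment 0 b (cu (- b)).
have [M2 M20 vM2] := continuous_bounded_segment 0 b (cv (- b)).
have [M3 M30 uM3] := continuous_bounded_segment (- b) 0 (cu' b).
have [M4 M40 vM4] := continuous_bounded_segment (- b) 0 (cv' b).
exists ((M1 + M2 + M3 + M4) * b) => n.
set W := expR (n%:R * (- (b / 2))).
have W0 : 0 <= W by exact: expR_ge0.
(* xi + i eta is the exponent n (i z - z^2 / (2 b)). *)
pose xi x y := - (n%:R / (2 * b)) * (x * x - y * y) - n%:R * y.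
pose eta x y := - (n%:R / (2 * b)) * (2 * (x * y)) + n%:R * x.
pose U x y := u x y * (expR (xi x y) * cos (eta x y)) -
              v x y * (expR (xi x y) * sin (eta x y)).
pose V x y := u x y * (expR (xi x y) * sin (eta x y)) +
              v x y * (expR (xi x y) * cos (eta x y)).
have hUV : hol U V.
  exact: hol_mul uv (hol_exp (hol_quadratic (- (n%:R / (2 * b))) n%:R)).
have [cU cU' cV cV'] := hol_continuous hUV.
have Nb0 : - b <= 0 by rewrite oppr_le0 ltW.
have := hol_rectangle hUV Nb0 (ltW b0).
have U0 x : U x 0 = 0 by rewrite /U u0 v0 !mul0r subrr.
have iV x : mu.-integrable `[0, b] (EFin \o V x).
  exact: continuous_integrable_segment.
have V0 y : V 0 y = v 0 y * expR (n%:R * (y ^+ 2 / (2 * b) - y)).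
  rewrite /V /eta !(mul0r, mulr0) addr0 sin0 cos0 mulr0 mulr1 mulr0 add0r.
  by congr (_ * expR _); rewrite /xi; field; rewrite gt_eqF.
have -> : \int[mu]_(y in `[0, b]) (V 0 y - V (- b) y) =
    \int[mu]_(y in `[0, b]) V 0 y - \int[mu]_(y in `[0, b]) V (- b) y.
  by rewrite RintegralB.
under [X in X - _]eq_Rintegral do rewrite V0.
move=> /esym/eqP; rewrite subr_eq => /eqP ->.
have top : `|\int[mu]_(x in `[(- b)%R, 0]) (U x 0 - U x b)|
    <= (M3 + M4) * W * (0 - - b).
  apply: normr_Rintegral_segment_le => // [x|x xb].
    by apply: cvgB; exact: cU'.
  rewrite U0 sub0r normrN; apply: le_trans (norm_weight_re _ _ _ (expR_ge0 _)) _.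
  apply: ler_pM; [by rewrite addr_ge0|exact: expR_ge0| |].
    by apply: lerD; [exact: uM3|exact: vM4].
  rewrite ler_expR /xi.
  have -> : - (n%:R / (2 * b)) * (x * x - b * b) - n%:R * b =
     n%:R * (- (b / 2)) - n%:R * (x ^+ 2 / (2 * b)).
    by field; rewrite gt_eqF.
  rewrite gerBl; apply: mulr_ge0 => //.
  by apply: divr_ge0; [exact: sqr_ge0|lra].
have side : `|\int[mu]_(y in `[0, b]) V (- b) y| <= (M1 + M2) * W * (b - 0).
  apply: normr_Rintegral_segment_le => // [|y yb]; first exact: ltW.
  apply: le_trans (norm_weight_im _ _ _ (expR_ge0 _)) _.
  apply: ler_pM; [by rewrite addr_ge0|exact: expR_ge0| |].
    by apply: lerD; [exact: uM1|exact: vM2].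
  rewrite ler_expR /xi.
  have -> : - (n%:R / (2 * b)) * (- b * - b - y * y) - n%:R * y =
     n%:R * (- (b / 2)) - n%:R * (y * (2 * b - y) / (2 * b)).
    by field; rewrite gt_eqF.
  rewrite gerBl; apply: mulr_ge0 => //.
  by apply: divr_ge0; [apply: mulr_ge0|]; lra.
apply: le_trans (ler_normD _ _) _; apply: le_trans (lerD top side) _.
by apply: eq_ler; ring.
Qed.

(** The exponent s y = y^2 / (2 b) - y decreases from 0 to - b / 2 on [0, b],
    so that the sets s > tau with tau > - b / 2 are the intervals [0, z[: by
    Mikusinski's lemma v 0 has integral 0 over each of them. *)
Lemma hol_axis_eq0 u v y : hol u v ->
  (forall x, u x 0 = 0) -> (forall x, v x 0 = 0) -> 0 < y -> v 0 y = 0.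
Proof.
move=> uv u0 v0 y0; pose b := 2 * y.
have b0 : 0 < b by rewrite mulr_gt0.
have [C HC] := hol_axis_bound uv b0 u0 v0.
have [_ _ cv _] := hol_continuous uv.
pose s z : R := z ^+ 2 / (2 * b) - z.
have cs : continuous s.
  move=> z; apply: cvgB; last exact: cvg_id.
  by apply: cvgM; [exact: exprn_continuous|exact: cvg_cst].
have [S _ sS] := continuous_bounded_segment 0 b cs.
have cat z : 0 < z < b -> \int[mu]_(x in `[0, z]) v 0 x = 0.
  move=> /andP[z0 zb].
  have bs : - (b / 2) < s z.
    rewrite -subr_gt0 /s (_ : _ - _ = (b - z) ^+ 2 / (2 * b)).
      by rewrite divr_gt0 ?exprn_gt0 ?subr_gt0// mulr_gt0.
    by field; rewrite gt_eqF.
  have sE x : s x - s z = (z - x) * (2 * b - (x + z)) / (2 * b).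
    by rewrite /s; field; rewrite gt_eqF.
  have ae : {ae mu, forall x, `[0, b]%classic x -> s x != s z}.
    exists [set z]; split; [by []|exact: lebesgue_measure_set1|].
    move=> x /= /not_implyP[]; rewrite in_itv/= => /andP[x0 xb] /negP.
    rewrite negbK -subr_eq0 sE !mulf_eq0 invr_eq0 subr_eq0.
    by move=> /orP[/orP[/eqP->//|]|]; lra.
  have := @mikusinski R `[0, b] (v 0) s S C (- (b / 2)) _ _ cs _ HC _ bs ae.
  have -> : \int[mu]_(x in `[0, b]) (v 0 x * (s z < s x)%R%:R) =
      \int[mu]_(x in `[0, z]) v 0 x.
    rewrite -[RHS]Rintegral_itv_bndo_bndc; last first.
      apply: integrableS (continuous_integrable_segment 0 z (cv 0)) => //.
      exact: subset_itv_co_cc.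
    have -> : `[0, z[%classic = `[0, b]%classic `&` `[0, z[%classic.
      rewrite setIidr// => x /=; rewrite !in_itv/=; lra.
    rewrite Rintegral_mkcondr; apply: eq_Rintegral => x.
    rewrite inE/= in_itv/= => /andP[x0 xb]; rewrite patchE.
    have -> : (s z < s x) = (x < z).
      have b20 : 0 < (2 * b)^-1 by rewrite invr_gt0 mulr_gt0.
      have q0 : 0 < 2 * b - (x + z) by lra.
      by rewrite -subr_gt0 sE (pmulr_lgt0 _ b20) (pmulr_lgt0 _ q0) subr_gt0.
    case: ltP => xz; first by rewrite mem_set ?mulr1//= in_itv/= x0.
    by rewrite memNset ?mulr0//= in_itv/= x0/= ltNge xz.
  apply; first by [].
  - exact: continuous_integrable_segment.
  - by move=> x; rewrite /= in_itv/=; exact: sS.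
apply: (continuous_primitive_eq0 (cv 0) cat).
by rewrite y0 /b; lra.
Qed.

(** Horizontal translations and the reflection z |-> conj z bring any point to
    the positive imaginary axis, and multiplication by - i exchanges the roles
    of u and v. *)
Theorem hol_identity u v : hol u v ->
  (forall x, u x 0 = 0) -> (forall x, v x 0 = 0) ->
  forall x y, u x y = 0 /\ v x y = 0.
Proof.
have im0 w w' : hol w w' -> (forall x, w x 0 = 0) -> (forall x, w' x 0 = 0) ->
    forall x y, w' x y = 0.
  move=> ww w0 w'0 x y.
  have axis p q : hol p q -> (forall x, p x 0 = 0) -> (forall x, q x 0 = 0) ->
      0 < y -> q x y = 0.
    move=> pq p0 q0 y0.
    have := hol_axis_eq0 (hol_shift x pq) _ _ y0.
    by rewrite addr0; apply.
  have axis' p q : hol p q -> (forall x, p x 0 = 0) -> (forall x, q x 0 = 0) ->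
      y < 0 -> q x y = 0.
    move=> pq p0 q0 y0; have Ny0 : 0 < - y by rewrite oppr_gt0.
    have := hol_axis_eq0 (hol_shift x (hol_conj pq)) _ _ Ny0.
    rewrite addr0 opprK oppr0 => H; apply: oppr_inj; rewrite oppr0; apply: H.
      by move=> z; rewrite p0.
    by move=> z; rewrite q0 oppr0.
  have [y0|y0|->] := ltgtP y 0; [exact: axis' ww w0 w'0 y0|
    exact: axis ww w0 w'0 y0|exact: w'0].
move=> uv u0 v0 x y; split; last exact: im0 uv u0 v0 x y.
apply: oppr_inj; rewrite oppr0.
apply: (im0 _ _ (hol_rot uv) v0) => z; by rewrite u0 oppr0.
Qed.

End hol_identity.

(** * A contour shift under a Gaussian weight *)

Section contour_shift.
Variable R : realType.
Local Notation mu := (@lebesgue_measure R).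
Implicit Types (u v : R -> R -> R) (f : R -> R) (a b x y t : R).

Lemma normr_Rintegral_le_segment f g a b K :
  continuous f -> mu.-integrable setT (EFin \o g) -> (forall x, 0 <= g x) ->
  (forall x, `|f x| <= K * g x) -> 0 <= K ->
  `|\int[mu]_(x in `[a, b]) f x| <= K * \int[mu]_x g x.
Proof.
move=> cf ig g0 fg K0.
have ig' : mu.-integrable `[a, b] (EFin \o g) by exact: integrableS ig.
have if_ := continuous_integrable_segment a b cf.
apply: le_trans (le_normr_Rintegral _ if_) _ => //.
apply: le_trans (_ : \int[mu]_(x in `[a, b]) (K * g x) <= _).
  apply: le_Rintegral => //; first exact: (integrable_norm if_).
  exact: integrable_scale.
rewrite RintegralZl// ler_wpM2l// /Rintegral fine_le//.
- exact: (integrable_fin_num _ ig').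
- exact: (integrable_fin_num _ ig).
apply: ge0_subset_integral => //.
  by case/integrableP : ig.
by move=> x _; rewrite /= lee_fin.
Qed.

Lemma Rintegral_segment_cvg f : mu.-integrable setT (EFin \o f) ->
  \int[mu]_(x in `[(- n%:R)%R, n%:R]) f x @[n --> \oo] --> \int[mu]_x f x.
Proof.
move=> if_.
have mf : measurable_fun setT f by case/integrableP : if_ => /measurable_EFinP.
under eq_fun do rewrite Rintegral_mkcond.
apply: (@Rintegral_dominated_cvg _ _ _ _ (fun x => `|f x|)) => //.
- by move=> n; apply/(measurable_restrictT _ _).1 => //; exact: measurable_funTS.
- apply: aeW => x _; apply: cvg_near_cst.
  near=> n; rewrite patchE mem_set//= in_itv/= -ler_norml.
  near: n; exact: nbhs_infty_ger.
- exact: (integrable_norm if_).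
- by move=> n x _; rewrite patchE; case: ifPn => // _; rewrite normr0.
Unshelve. all: by end_near. Qed.

(** The integrand is the real part of (u + i v) exp (- z^2 / (2 n) - i t z) on
    the real axis. At the height - n the Gaussian has grown by exp (n / 2) and
    u + i v by exp (A n) at most, the oscillating factor has become exp (- n
    t), and the growth in x is absorbed by A |x| - x^2 / (2 n) <= n (A + 1)^2
    / 2 - |x|: the lower bound on t is what makes the product at most exp (- n
    / 2 - |x|). *)
Lemma gauss_shift u v A C t n : hol u v -> 0 <= A -> 0 <= C -> (0 < n)%N ->
  (forall x y, `|u x y| <= C * expR (A * (`|x| + `|y|))) ->
  (forall x y, `|v x y| <= C * expR (A * (`|x| + `|y|))) ->
  A + 1 + (A + 1) ^+ 2 / 2 <= t ->
  mu.-integrable setT (EFin \o (fun x : R => expR (- `|x|))) ->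
  `|\int[mu]_x (expR (- x ^+ 2 / (2 * n%:R)) *
      (u x 0 * cos (x * t) + v x 0 * sin (x * t)))| <=
  2 * C * expR (- n%:R / 2) * \int[mu]_x expR (- `|x|).
Proof.
move=> uv A0 C0 n0 uC vC tA iE.
have n0R : 0 < n%:R :> R by rewrite ltr0n.
have n2 : 0 < 2 * n%:R :> R by rewrite mulr_gt0.
(* xi + i eta is the exponent - z^2 / (2 n) - i t z. *)
pose a : R := - (1 / (2 * n%:R)).
pose xi x y := a * (x * x - y * y) - - t * y.
pose eta x y := a * (2 * (x * y)) + - t * x.
pose U x y := u x y * (expR (xi x y) * cos (eta x y)) -
              v x y * (expR (xi x y) * sin (eta x y)).
pose V x y := u x y * (expR (xi x y) * sin (eta x y)) +
              v x y * (expR (xi x y) * cos (eta x y)).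
have hUV : hol U V := hol_mul uv (hol_exp (hol_quadratic a (- t))).
have [cU cU' cV cV'] := hol_continuous hUV.
have t0 : 0 <= t by apply: le_trans tA; rewrite !addr_ge0// divr_ge0// sqr_ge0.
have U0 x : U x 0 = expR (- x ^+ 2 / (2 * n%:R)) *
      (u x 0 * cos (x * t) + v x 0 * sin (x * t)).
  rewrite /U /xi /eta.
  have -> : a * (x * x - 0 * 0) - - t * 0 = - x ^+ 2 / (2 * n%:R).
    by rewrite /a; field; rewrite gt_eqF.
  have -> : a * (2 * (x * 0)) + - t * x = - (x * t) by ring.
  by rewrite cosN sinN; ring.
under eq_Rintegral do rewrite -U0.
have sq x : A * `|x| - x ^+ 2 / (2 * n%:R) <=
    n%:R * ((A + 1) ^+ 2 / 2) - `|x|.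
  rewrite -subr_ge0 (_ : _ - _ = (`|x| - n%:R * (A + 1)) ^+ 2 / (2 * n%:R)).
    by rewrite divr_ge0 ?sqr_ge0// ltW.
  by rewrite -(real_normK (num_real x)); field; rewrite gt_eqF.
have boundU x y : -n%:R <= y <= 0 -> (`|u x y| + `|v x y|) * expR (xi x y) <=
    2 * C * expR (A * (`|x| - y) - (x ^+ 2 - y ^+ 2) / (2 * n%:R) + t * y).
  move=> /andP[ny y0].
  have -> : A * (`|x| - y) - (x ^+ 2 - y ^+ 2) / (2 * n%:R) + t * y =
      A * (`|x| + `|y|) + xi x y.
    by rewrite /xi /a (ler0_norm y0); field; rewrite gt_eqF.
  rewrite (expRD (A * (`|x| + `|y|))) mulrA ler_wpM2r ?expR_ge0//.
  by have := uC x y; have := vC x y; lra.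
have bottom x : `|U x (- n%:R)| <= 2 * C * expR (- n%:R / 2) * expR (- `|x|).
  apply: le_trans (norm_weight_re _ _ _ (expR_ge0 _)) _.
  apply: le_trans (boundU x (- n%:R) _) _; first by rewrite lexx oppr_le0/= ltW.
  rewrite -[leRHS]mulrA -expRD ler_wpM2l ?mulr_ge0// ler_expR.
  have h1 := sq x.
  have h2 : 0 <= n%:R * (t - (A + 1 + (A + 1) ^+ 2 / 2)).
    by rewrite mulr_ge0 ?subr_ge0// ltW.
  have -> : A * (`|x| - - n%:R) - (x ^+ 2 - (- n%:R) ^+ 2) / (2 * n%:R) +
     t * - n%:R = (A * `|x| - x ^+ 2 / (2 * n%:R)) + n%:R * (A + 1 / 2 - t).
    by field; rewrite gt_eqF.
  lra.
(* A bound on the vertical sides for a fixed n; these sides recede to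
   infinity. *)
pose D := 2 * C * expR (n%:R * (A + 1 / 2 + (A + 1) ^+ 2 / 2)).
have D0 : 0 <= D by rewrite /D !mulr_ge0// expR_ge0.
have side x y : -n%:R <= y <= 0 -> `|V x y| <= D * expR (- `|x|).
  move=> yn; apply: le_trans (norm_weight_im _ _ _ (expR_ge0 _)) _.
  apply: le_trans (boundU x y yn) _.
  move: yn => /andP[ny y0].
  rewrite /D -[leRHS]mulrA -expRD ler_wpM2l ?mulr_ge0// ler_expR.
  have h1 := sq x.
  have h2 : 0 <= A * (n%:R + y) by rewrite mulr_ge0//; lra.
  have h3 : t * y <= 0 by rewrite mulr_ge0_le0.
  have h4 : y ^+ 2 / (2 * n%:R) <= n%:R / 2.
    rewrite ler_pdivrMr// (_ : n%:R / 2 * (2 * n%:R) = n%:R ^+ 2); last first.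
      by field.
    by rewrite -[leLHS]sqrrN ler_sqr// ?nnegrE; lra.
  have -> : A * (`|x| - y) - (x ^+ 2 - y ^+ 2) / (2 * n%:R) + t * y =
     (A * `|x| - x ^+ 2 / (2 * n%:R)) + (y ^+ 2 / (2 * n%:R)) + t * y - A * y.
    by ring.
  lra.
have iU0 : mu.-integrable setT (EFin \o U ^~ 0).
  have g0 x : expR (- x ^+ 2 / (2 * n%:R)) * (2 * C * expR (A * `|x|)) <=
      2 * C * expR (n%:R * ((A + 1) ^+ 2 / 2)) * expR (- `|x|).
    rewrite mulrCA -!mulrA -!expRD !ler_wpM2l// ler_expR.
    by have := sq x; rewrite mulNr; lra.
  apply: (@integrable_dominated _ _ _ (fun x => 2 * C *
    expR (n%:R * ((A + 1) ^+ 2 / 2)) * expR (- `|x|))) => //.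
  - by apply: continuous_measurable_fun => x; exact: cU'.
  - exact: integrable_scale.
  move=> x _; apply: le_trans (norm_weight_re _ _ _ (expR_ge0 _)) _.
  apply: le_trans (g0 x).
  rewrite mulrC (_ : xi x 0 = - x ^+ 2 / (2 * n%:R)); last first.
    by rewrite /xi /a; field; rewrite gt_eqF.
  rewrite ler_wpM2l ?expR_ge0//.
  have := uC x 0; have := vC x 0; rewrite normr0 addr0.
  lra.
have N0 : - n%:R <= 0 :> R by rewrite oppr_le0 ltW.
set K := \int[mu]_x expR (- `|x|).
have fin m : `|\int[mu]_(x in `[(- m%:R)%R, m%:R]) U x 0| <=
    2 * C * expR (- n%:R / 2) * K + 2 * D * n%:R * expR (- m%:R).
  have Nm : - m%:R <= m%:R :> R by apply: le_trans (_ : 0 <= _);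
    rewrite ?oppr_le0.
  have := hol_rectangle hUV Nm N0.
  have -> : \int[mu]_(x in `[(- m%:R)%R, m%:R]) (U x (- n%:R) - U x 0) =
     \int[mu]_(x in `[(- m%:R)%R, m%:R]) U x (- n%:R) -
     \int[mu]_(x in `[(- m%:R)%R, m%:R]) U x 0.
    by rewrite RintegralB//; apply: continuous_integrable_segment; exact: cU'.
  move=> /eqP; rewrite subr_eq addrC -subr_eq => /eqP <-.
  apply: le_trans (ler_normB _ _) _; apply: lerD.
    apply: (@normr_Rintegral_le_segment (U ^~ (- n%:R)) (fun x => expR (- `|x|))).
    - exact: cU'.
    - exact: iE.
    - by move=> x; exact: expR_ge0.
    - exact: bottom.
    - by rewrite !mulr_ge0// expR_ge0.
  rewrite (_ : 2 * D * n%:R * expR (- m%:R) =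
    (2 * D * expR (- m%:R)) * (0 - - n%:R)); last by ring.
  apply: normr_Rintegral_segment_le => // [y|y yn].
    by apply: cvgB; exact: cV.
  have h1 := side m%:R _ yn; have h2 := side (- m%:R) _ yn.
  rewrite normrN in h2; rewrite (ger0_norm (ler0n _ _)) in h1 h2.
  by apply: le_trans (ler_normB _ _) _; lra.
have cm : 2 * C * expR (- n%:R / 2) * K + 2 * D * n%:R * expR (- m%:R)
    @[m --> \oo] --> 2 * C * expR (- n%:R / 2) * K.
  rewrite -[X in _ --> X]addr0; apply: cvgD; first exact: cvg_cst.
  rewrite -[X in _ --> X](mulr0 (2 * D * n%:R)).
  by apply: cvgM; [exact: cvg_cst|exact: cvgn_expR].
apply: (ler_cvg_to (cvg_norm (Rintegral_segment_cvg iU0)) cm).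
by apply: nearW => m; exact: fin.
Qed.

End contour_shift.

(** * The Poisson kernel *)

Section poisson.
Variable R : realType.
Local Notation mu := (@lebesgue_measure R).
Implicit Types (f F : R -> R) (a b x y s t eta : R).

Lemma Rintegral_FTC f F a b : a <= b -> continuous f ->
  (forall x, is_derive x 1 F (f x)) ->
  \int[mu]_(x in `[a, b]) f x = F b - F a.
Proof.
rewrite le_eqVlt => /predU1P[->|ab] cf dF.
  by rewrite set_itv1 Rintegral_set1 subrr.
have cF : continuous F.
  move=> x; apply: differentiable_continuous; apply/derivable1_diffP.
  exact: ex_derive.
rewrite /Rintegral (@continuous_FTC2 _ f F)//.
- exact: continuous_subspaceT.
- split => [x _||]; first exact: ex_derive.
    by apply: cvg_at_right_filter; exact: cF.
  by apply: cvg_at_left_filter; exact: cF.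
- by move=> x _; rewrite derive1E derive_val.
Qed.

Lemma integrable_exp_abs eta : 0 < eta ->
  mu.-integrable setT (EFin \o (fun t => expR (- (eta * `|t|)))).
Proof.
move=> eta0.
have cw := @continuous_exp_abs R eta.
apply/integrableP; split.
  by apply/measurable_EFinP; exact: continuous_measurable_fun.
under eq_integral do rewrite /= ger0_norm ?expR_ge0//.
rewrite ge0_symfun_integralT//; last by move=> t /=; rewrite normrN.
rewrite -set_itvcy.
pose F t := - (expR (- (eta * t)) / eta).
have dF t : is_derive t 1 F (expR (- (eta * t))).
  apply: is_derive_eq; rewrite /GRing.scale/= mulr1 mulrC.
  by field; rewrite gt_eqF.
have cF : continuous F.
  move=> x; apply: differentiable_continuous; apply/derivable1_diffP.
  exact: ex_derive.
have -> : (\int[mu]_(t in `[0%R, +oo[) (expR (- (eta * `|t|)))%:E =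
    \int[mu]_(t in `[0%R, +oo[) (expR (- (eta * t)))%:E)%E.
  apply: eq_integral => t; rewrite inE/= in_itv/= andbT => t0.
  by rewrite ger0_norm.
rewrite (@ge0_continuous_FTC2y _ _ F 0 0).
- by rewrite -EFinB -EFinM ltry.
- by move=> x _; exact: expR_ge0.
- apply: continuous_subspaceT => t; apply: continuous_comp;
    last exact: continuous_expR.
  by apply: cvgN; apply: cvgM; [exact: cvg_cst|exact: cvg_id].
- rewrite -[X in _ --> X]oppr0; apply: cvgN.
  rewrite -[X in _ --> X](mul0r eta^-1); apply: cvgM; last exact: cvg_cst.
  have : (fun t => eta * t) t @[t --> +oo] --> +oo by exact: gt0_cvgMry.
  by move/(cvg_comp _ _) => /(_ _ _ _ (@cvgr_expR R)).
- by move=> x _; exact: ex_derive.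
- by apply: cvg_at_right_filter; exact: cF.
- by move=> x _; rewrite derive1E derive_val.
Qed.


(** The Poisson kernel of the upper half-plane at height eta, multiplied by 2
    pi so as to be the Fourier transform of exp (- eta |t|). *)
Definition poisson eta s : R := 2 * eta / (eta ^+ 2 + s ^+ 2).

Lemma poisson_denom_gt0 eta s : 0 < eta -> 0 < eta ^+ 2 + s ^+ 2.
Proof. by move=> eta0; rewrite ltr_wpDr ?sqr_ge0// exprn_gt0. Qed.

Lemma poisson_ge0 eta s : 0 < eta -> 0 <= poisson eta s.
Proof.
move=> eta0; rewrite divr_ge0 ?(ltW (poisson_denom_gt0 _ eta0))//.
by rewrite mulr_ge0// ltW.
Qed.

Lemma continuous_poisson eta x : 0 < eta -> continuous (fun y => poisson eta (x - y)).
Proof.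
move=> eta0 y; apply: cvgM; first exact: cvg_cst.
apply: cvgV; first by rewrite gt_eqF// poisson_denom_gt0.
apply: cvgD; first exact: cvg_cst.
apply: cvgM; (apply: cvgB; [exact: cvg_cst|exact: cvg_id]).
Qed.

Lemma poisson_fourier_segment eta s n : 0 < eta ->
  \int[mu]_(t in `[(- n%:R)%R, n%:R]) (expR (- (eta * `|t|)) * cos (s * t)) =
  poisson eta s + 2 * expR (- (eta * n%:R)) *
    (s * sin (s * n%:R) - eta * cos (s * n%:R)) / (eta ^+ 2 + s ^+ 2).
Proof.
move=> eta0; have d0 := poisson_denom_gt0 s eta0.
have cw : continuous (fun t : R => expR (- (eta * `|t|)) * cos (s * t)).
  by move=> t; apply: cvgM; [exact: continuous_exp_abs|exact: continuous_cos_mulr].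
have n0 : - n%:R <= 0 :> R by rewrite oppr_le0.
rewrite (Rintegral_segment_cat cw n0 (ler0n _ _)).
have main (e a b : R) : a <= b -> e ^+ 2 = eta ^+ 2 ->
    \int[mu]_(t in `[a, b]) (expR (e * t) * cos (s * t)) =
    expR (e * b) * (e * cos (s * b) + s * sin (s * b)) / (eta ^+ 2 + s ^+ 2) -
    expR (e * a) * (e * cos (s * a) + s * sin (s * a)) / (eta ^+ 2 + s ^+ 2).
  move=> ab e2; pose F t := expR (e * t) *
    (e * cos (s * t) + s * sin (s * t)) / (eta ^+ 2 + s ^+ 2).
  rewrite -/(F a) -/(F b); apply: Rintegral_FTC => //.
    by move=> t; apply: cvgM; [exact: continuous_expR_mulr|exact: continuous_cos_mulr].
  move=> t; apply: is_derive_eq; rewrite /GRing.scale/= -e2.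
  by field; rewrite e2 gt_eqF.
have -> : \int[mu]_(t in `[(- n%:R)%R, 0]) (expR (- (eta * `|t|)) * cos (s * t))
    = \int[mu]_(t in `[(- n%:R)%R, 0]) (expR (eta * t) * cos (s * t)).
  apply: eq_Rintegral => t; rewrite inE/= in_itv/= => /andP[_ t0].
  by rewrite ler0_norm// mulrN opprK.
have -> : \int[mu]_(t in `[0, n%:R]) (expR (- (eta * `|t|)) * cos (s * t))
    = \int[mu]_(t in `[0, n%:R]) (expR (- eta * t) * cos (s * t)).
  apply: eq_Rintegral => t; rewrite inE/= in_itv/= => /andP[t0 _].
  by rewrite ger0_norm// mulNr.
rewrite !main ?sqrrN// /poisson !mulr0 !expR0 cos0 sin0 !(mulrN, mulNr) cosN sinN.
by field; rewrite gt_eqF.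
Qed.

Lemma integrable_exp_abs_cos eta s : 0 < eta ->
  mu.-integrable setT (EFin \o (fun t => expR (- (eta * `|t|)) * cos (s * t))).
Proof.
move=> eta0.
apply: (@integrable_dominated _ _ _ (fun t => expR (- (eta * `|t|)))) => //.
- apply: continuous_measurable_fun => t; apply: cvgM.
    exact: continuous_exp_abs.
  exact: continuous_cos_mulr.
- exact: integrable_exp_abs.
- move=> t _; rewrite normrM (ger0_norm (expR_ge0 _)) ler_piMr ?expR_ge0//.
  exact: norm_cos_le1.
Qed.

Lemma poisson_fourier eta s : 0 < eta ->
  \int[mu]_t (expR (- (eta * `|t|)) * cos (s * t)) = poisson eta s.
Proof.
move=> eta0; have d0 := poisson_denom_gt0 s eta0.
have c1 := Rintegral_segment_cvg (integrable_exp_abs_cos s eta0).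
rewrite -(cvg_lim _ c1)//; apply/cvg_lim => //.
rewrite (_ : (fun n : nat => _) = fun n => poisson eta s +
  2 * expR (- (eta * n%:R)) * (s * sin (s * n%:R) - eta * cos (s * n%:R)) /
  (eta ^+ 2 + s ^+ 2)); last by apply/funext => n; exact: poisson_fourier_segment.
rewrite -[X in _ --> X]addr0; apply: cvgD; first exact: cvg_cst.
pose M := 2 * (`|s| + eta) / (eta ^+ 2 + s ^+ 2).
apply/norm_cvg0P.
apply: (@squeeze_cvgr _ _ _ _ (cst 0) (fun n => M * expR (- (eta * n%:R)))).
- apply: nearW => n /=; rewrite normr_ge0/= normrM normfV (gtr0_norm d0).
  rewrite /M [leRHS]mulrAC ler_pM2r ?invr_gt0//.
  rewrite normrM (ger0_norm (mulr_ge0 _ (expR_ge0 _)))//.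
  rewrite -[leRHS]mulrA [leRHS]mulrCA mulrA mulrC -[leRHS]mulrA.
  apply: ler_wpM2r; first by rewrite mulr_ge0// expR_ge0.
  apply: le_trans (ler_normB _ _) _; rewrite !normrM (gtr0_norm eta0).
  apply: lerD; apply: ler_piMr; rewrite ?(ltW eta0)//.
    exact: norm_sin_le1.
  exact: norm_cos_le1.
- exact: cvg_cst.
rewrite -[X in _ --> X](mulr0 M); apply: cvgM; first exact: cvg_cst.
under eq_fun do rewrite mulrC -mulrN expRM_natl.
by apply: cvg_expr; rewrite ger0_norm ?expR_ge0// expR_lt1 oppr_lt0.
Qed.

Lemma poisson_integral eta x : 0 < eta ->
  (\int[mu]_y (poisson eta (x - y))%:E = (2 * pi)%:E)%E.
Proof.
move=> eta0.
pose F y := (y - x) / eta.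
have dF y : is_derive y 1 F eta^-1.
  by apply: is_derive_eq; rewrite /GRing.scale/=; ring.
have F' : derive1 F = cst eta^-1.
  by apply/funext => y; rewrite derive1E derive_val.
have oneD : (\int[mu]_y ((oneDsqr y)^-1)%:E = pi%:E)%E.
  rewrite ge0_symfun_integralT//.
  - rewrite -set_itvcy integral0y_oneDsqr -EFinM; congr EFin; by field.
  - exact: continuous_oneDsqrV.
  - by move=> y /=; rewrite /oneDsqr sqrrN.
have := @increasing_ge0_integration_by_substitutionT R F
  (fun y => 2 * (oneDsqr y)^-1).
have -> : (\int[mu]_y (2 * (oneDsqr y)^-1)%:E = (2 * pi)%:E)%E.
  under eq_integral do rewrite EFinM.
  rewrite ge0_integralZl//= ?oneD//.
  by apply/measurable_EFinP; apply: continuous_measurable_fun; exact: continuous_oneDsqrV.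
move=> ->.
- apply: eq_integral => y _; congr EFin; rewrite /= F' /poisson /F /oneDsqr.
  rewrite fctE/= -(opprB y x) sqrrN; field.
  by rewrite !gt_eqF// poisson_denom_gt0.
- by move=> a b ab; rewrite ltr_pM2r ?invr_gt0// ltrD2r.
- by rewrite F' => y; exact: cvg_cst.
- by rewrite F'; exact: is_cvg_cst.
- by rewrite F'; exact: is_cvg_cst.
- by move=> y; exact: ex_derive.
- apply: gt0_cvgMlNy; first by rewrite invr_gt0.
  exact: cvg_addrr_Ny.
- apply: gt0_cvgMly; first by rewrite invr_gt0.
  exact: cvg_addrr.
- move=> y; apply: cvgM; first exact: cvg_cst.
  exact: continuous_oneDsqrV.
- by move=> y; rewrite mulr_ge0// invr_ge0.
Qed.

End poisson.

(** * The energy of cosine and sine transforms *)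

Section plancherel.
Variable R : realType.
Local Notation mu := (@lebesgue_measure R).
Implicit Types (a f g : R -> R) (x y s t eta : R).

(** The common features of the cosine (e = 1) and the sine (e = - 1): the
    product formula expresses c (x t) c (y t) by cosines, whose transforms
    under the weight exp (- eta |t|) are Poisson kernels. *)
Definition trig_kernel (c : R -> R) (e : R) :=
  [/\ continuous c, forall x, `|c x| <= 1, `|e| = 1 &
  forall x y, c x * c y = 2^-1 * (cos (x - y) + e * cos (x + y))].

Lemma trig_cos : trig_kernel cos 1.
Proof.
split; [exact: continuous_cos| |by rewrite normr1|].
  exact: norm_cos_le1.
by move=> x y; rewrite cosB cosD; field.
Qed.

Lemma trig_sin : trig_kernel sin (-1).
Proof.
split; [exact: continuous_sin| |by rewrite normrN1|].
  exact: norm_sin_le1.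
by move=> x y; rewrite cosB cosD; field.
Qed.

Definition trig_transform (c a : R -> R) t : R := \int[mu]_x (a x * c (x * t)).

(** Fubini in the one form that the transforms require. *)
Lemma Rintegral_swap (A B : R -> R) (Phi : R * R -> R) :
  mu.-integrable setT (EFin \o A) -> mu.-integrable setT (EFin \o B) ->
  measurable_fun setT Phi -> (forall z, `|Phi z| <= 1) ->
  \int[mu]_x (A x * \int[mu]_y (B y * Phi (x, y))) =
  \int[mu]_y (B y * \int[mu]_x (A x * Phi (x, y))).
Proof.
move=> iA iB mPhi Phi1.
have mA : measurable_fun setT A by case/integrableP : iA => /measurable_EFinP.
have mB : measurable_fun setT B by case/integrableP : iB => /measurable_EFinP.
pose F z := (A z.1 * B z.2 * Phi z)%:E.
have mAB : measurable_fun setT (fun z : R * R => A z.1 * B z.2 * Phi z).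
  apply: measurable_funM => //.
  by apply: measurable_funM; exact: measurableT_comp.
have mF : measurable_fun setT F by exact/measurable_EFinP.
have iBx x : mu.-integrable setT (EFin \o (fun y => B y * Phi (x, y))).
  apply: (@integrable_dominated _ _ _ (fun y => `|B y|)) => //.
  - apply: measurable_funM => //.
    by apply: measurableT_comp => //; exact: pair1_measurable.
  - exact: (integrable_norm iB).
  - by move=> y _; rewrite normrM ler_piMr.
have iAy y : mu.-integrable setT (EFin \o (fun x => A x * Phi (x, y))).
  apply: (@integrable_dominated _ _ _ (fun x => `|A x|)) => //.
  - apply: measurable_funM => //.
    by apply: measurableT_comp => //; exact: pair2_measurable.
  - exact: (integrable_norm iA).
  - by move=> x _; rewrite normrM ler_piMr.
have iF : (mu \x mu)%E.-integrable setT F.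
  apply/integrable12ltyP; first exact: mF.
  pose nB := \int[mu]_y `|B y|.
  have inB : (\int[mu]_y (`|B y|)%:E = nB%:E)%E.
    by rewrite /nB /Rintegral fineK//; exact: (integrable_fin_num _ (integrable_norm iB)).
  have inA := integrable_scale nB measurableT (integrable_norm iA).
  case/integrableP : inA => minA; apply: le_lt_trans.
  apply: ge0_le_integral => //.
  - by move=> x _; exact: integral_ge0.
  - apply: (@measurable_fun_fubini_tonelli_F _ _ _ _ _ mu (abse \o F)).
      exact: measurableT_comp.
    by move=> z; exact: abse_ge0.
  - exact: measurableT_comp.
  - move=> x _.
    have -> : (`|(EFin \o (fun x0 : R => (nB * `|A x0|)%R)) x| =
        \int[mu]_y (`|A x| * `|B y|)%:E)%E.
      under eq_integral do rewrite EFinM.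
      rewrite ge0_integralZl//; last first.
        by apply/measurable_EFinP; exact: measurableT_comp.
      rewrite inB /= ger0_norm; first by rewrite -EFinM mulrC.
      by rewrite mulr_ge0// Rintegral_ge0.
    apply: ge0_le_integral => //.
    - by do 2 apply: measurableT_comp => //.
    - apply/measurable_EFinP; apply: measurable_funM => //.
      exact: measurableT_comp.
    - by move=> y _; rewrite /F/= lee_fin !normrM ler_piMr// mulr_ge0.
rewrite /Rintegral; congr fine.
transitivity (\int[mu]_x \int[mu]_y F (x, y))%E.
  apply: eq_integral => x _; rewrite EFinM fineK; last first.
    exact: (integrable_fin_num _ (iBx x)).
  rewrite -integralZl//; last exact: (iBx x).
  by apply: eq_integral => y _; rewrite -EFinM mulrA.
rewrite (Fubini iF).
apply: eq_integral => y _; rewrite EFinM fineK; last first.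
  exact: (integrable_fin_num _ (iAy y)).
rewrite -integralZl//; last exact: (iAy y).
by apply: eq_integral => x _; rewrite -EFinM mulrA (mulrC (B y)).
Qed.

Section transform.
Variables (c : R -> R) (e : R).
Hypothesis ce : trig_kernel c e.

Let cc : continuous c. Proof. by case: ce. Qed.
Let c1 x : `|c x| <= 1. Proof. by case: ce. Qed.
Let mc : measurable_fun setT c.
Proof. exact: continuous_measurable_fun. Qed.

Let mc2 : measurable_fun setT (fun z : R * R => c (z.1 * z.2)).
Proof. by apply: measurableT_comp => //; exact: measurable_funM. Qed.

Lemma integrable_trig a t : mu.-integrable setT (EFin \o a) ->
  mu.-integrable setT (EFin \o (fun x => a x * c (x * t))).
Proof.
move=> ia; apply: (@integrable_dominated _ _ _ (fun x => `|a x|)) => //.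
- apply: measurable_funM; first by case/integrableP : ia => /measurable_EFinP.
  by apply: measurableT_comp => //; exact: measurable_funM.
- exact: (integrable_norm ia).
- by move=> x _; rewrite normrM ler_piMr.
Qed.

Lemma trig_transform_bound a t : mu.-integrable setT (EFin \o a) ->
  `|trig_transform c a t| <= \int[mu]_x `|a x|.
Proof.
move=> ia; apply: le_trans (le_normr_Rintegral _ (integrable_trig t ia)) _ => //.
apply: le_Rintegral => //.
- exact: (integrable_norm (integrable_trig t ia)).
- exact: (integrable_norm ia).
- by move=> x _; rewrite normrM ler_piMr.
Qed.

Lemma trig_transform_continuous a : mu.-integrable setT (EFin \o a) ->
  continuous (trig_transform c a).
Proof.
move=> ia t.
apply: (@continuity_under_integral R _ _ mu (fun t x => a x * c (x * t)) setT
  measurableT (t - 1) (t + 1) _ _ (fun x => `|a x|)).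
- by move=> x _; exact: integrable_trig.
- apply: aeW => x _ y _; apply: cvgM; first exact: cvg_cst.
  apply: continuous_comp; last exact: cc.
  by apply: cvgM; [exact: cvg_cst|exact: cvg_id].
- exact: (integrable_norm ia).
- by move=> x _; apply: aeW => y _; rewrite normrM ler_piMr.
- by rewrite inE/= in_itv/=; lra.
Qed.

Let w eta t := expR (- (eta * `|t|)).

Let w_ge0 eta t : 0 <= w eta t. Proof. exact: expR_ge0. Qed.

Let mw eta : measurable_fun setT (w eta).
Proof.
by apply: continuous_measurable_fun; exact: continuous_exp_abs.
Qed.

Let K eta x y := 2^-1 * (poisson eta (x - y) + e * poisson eta (x + y)).

Lemma kernel_transform eta x y : 0 < eta ->
  \int[mu]_t (w eta t * c (x * t) * c (y * t)) = K eta x y.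
Proof.
move=> eta0.
have E t : w eta t * c (x * t) * c (y * t) = 2^-1 *
    (w eta t * cos ((x - y) * t) + e * (w eta t * cos ((x + y) * t))).
  have [_ _ _ H] := ce.
  by rewrite -mulrA H -mulrDl -mulrBl; ring.
under eq_Rintegral do rewrite E.
have i1 := integrable_exp_abs_cos (x - y) eta0.
have i2 := integrable_scale e measurableT (integrable_exp_abs_cos (x + y) eta0).
rewrite RintegralZl//; last exact: integrable_add.
rewrite RintegralD// RintegralZl//; last exact: integrable_exp_abs_cos.
by rewrite !poisson_fourier.
Qed.

Section inequality.
Variable a : R -> R.
Hypothesis ia : mu.-integrable setT (EFin \o a).
Local Notation T := (trig_transform c a).

Let ma : measurable_fun setT a.
Proof. by case/integrableP : ia => /measurable_EFinP. Qed.

Let iw eta (h : R -> R) M : 0 < eta -> measurable_fun setT h ->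
  (forall t, `|h t| <= M) -> mu.-integrable setT (EFin \o (fun t => w eta t * h t)).
Proof.
move=> eta0 mh hM.
apply: (@integrable_dominated _ _ _ (fun t => M * w eta t)) => //.
- exact: measurable_funM.
- by apply: integrable_scale => //; exact: integrable_exp_abs.
- by move=> t _; rewrite normrM mulrC (ger0_norm (w_ge0 _ _)) ler_wpM2r.
Qed.

Let mT : measurable_fun setT T.
Proof.
by apply: continuous_measurable_fun; exact: trig_transform_continuous.
Qed.

Let iwT eta : 0 < eta -> mu.-integrable setT (EFin \o (fun t => w eta t * T t)).
Proof.
by move=> eta0; apply: iw eta0 mT _ => t; exact: trig_transform_bound.
Qed.

Let transform_transform eta x : 0 < eta ->
  trig_transform c (fun t => w eta t * T t) x = \int[mu]_y (a y * K eta x y).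
Proof.
move=> eta0.
transitivity (\int[mu]_t ((w eta t * c (x * t)) * \int[mu]_y (a y * c (y * t)))).
  by apply: eq_Rintegral => t _; rewrite mulrAC (mulrC t x).
rewrite (@Rintegral_swap _ a (fun z => c (z.2 * z.1)))//; last 2 first.
- apply: (iw (M := 1)) eta0 _ _ => //.
  by apply: measurableT_comp => //; exact: measurable_funM.
- by under eq_fun do rewrite mulrC.
by apply: eq_Rintegral => y _; rewrite -kernel_transform.
Qed.

(** Fubini, twice. *)
Lemma weighted_energy eta : 0 < eta ->
  \int[mu]_t (w eta t * T t ^+ 2) =
  \int[mu]_x (a x * \int[mu]_y (a y * K eta x y)).
Proof.
move=> eta0.
transitivity (\int[mu]_t ((w eta t * T t) * \int[mu]_x (a x * c (x * t)))).
  by apply: eq_Rintegral => t _; rewrite -mulrA expr2.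
rewrite (@Rintegral_swap _ a (fun z => c (z.2 * z.1)))//; last 2 first.
- exact: iwT.
- by under eq_fun do rewrite mulrC.
apply: eq_Rintegral => x _; congr (_ * _); rewrite -transform_transform//.
by apply: eq_Rintegral => t _ /=; rewrite (mulrC x).
Qed.

Let EFin_Rintegral_le (h : R -> R) : measurable_fun setT h ->
  ((`|\int[mu]_x h x|)%:E <= \int[mu]_x (`|h x|)%:E)%E.
Proof.
move=> mh; have /measurable_EFinP mh' := mh.
apply: le_trans (le_abse_integral mu measurableT mh').
rewrite /Rintegral; case: (integral _ _ _) => [r| |] //=.
- by rewrite normr0 leey.
- by rewrite normr0 leey.
Qed.

Let E (h : R -> R) : \bar R := (\int[mu]_x (h x ^+ 2)%:E)%E.

Let Q eta x y := 2^-1 * (poisson eta (x - y) + poisson eta (x + y)).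

Let K_le eta x y : 0 < eta -> `|K eta x y| <= Q eta x y.
Proof.
move=> eta0; have [_ _ e1 _] := ce.
rewrite /K /Q normrM ger0_norm// ler_wpM2l//.
apply: le_trans (ler_normD _ _) _; rewrite (normrM e) e1 mul1r.
by rewrite !ger0_norm ?poisson_ge0.
Qed.

Let Q0 eta x y : 0 < eta -> 0 <= Q eta x y.
Proof. by move=> eta0; apply: le_trans (K_le x y eta0). Qed.

Let Qsym eta x y : Q eta x y = Q eta y x.
Proof. by rewrite /Q /poisson -(opprB y x) sqrrN (addrC x y). Qed.

Let mpoisson eta : 0 < eta -> measurable_fun setT (poisson eta).
Proof.
move=> eta0; apply: continuous_measurable_fun => s.
apply: cvgM; first exact: cvg_cst.
apply: cvgV; first by rewrite gt_eqF// poisson_denom_gt0.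
by apply: cvgD; [exact: cvg_cst|apply: cvgM; exact: cvg_id].
Qed.

Let mQ eta : 0 < eta -> measurable_fun setT (fun z : R * R => Q eta z.1 z.2).
Proof.
move=> eta0; apply: measurable_funM => //; apply: measurable_funD.
  apply: measurableT_comp; first exact: mpoisson.
  exact: measurable_funB.
apply: measurableT_comp; first exact: mpoisson.
exact: measurable_funD.
Qed.

Let Q_int eta x : 0 < eta -> (\int[mu]_y (Q eta x y)%:E = (2 * pi)%:E)%E.
Proof.
move=> eta0; rewrite /Q; under eq_integral do rewrite EFinM EFinD.
have m1 : measurable_fun setT (fun y => poisson eta (x - y)).
  by apply: continuous_measurable_fun; exact: continuous_poisson.
have E2 y : poisson eta (x + y) = poisson eta (- x - y).
  by rewrite -opprD /poisson sqrrN.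
have m2 : measurable_fun setT (fun y => poisson eta (x + y)).
  under eq_fun do rewrite E2.
  by apply: continuous_measurable_fun; exact: continuous_poisson.
rewrite ge0_integralZl//; last 2 first.
- by apply: emeasurable_funD; exact/measurable_EFinP.
- by move=> y _; rewrite adde_ge0// lee_fin poisson_ge0.
rewrite ge0_integralD//; last 4 first.
- by move=> y _; rewrite lee_fin poisson_ge0.
- exact/measurable_EFinP.
- by move=> y _; rewrite lee_fin poisson_ge0.
- exact/measurable_EFinP.
rewrite poisson_integral//; under eq_integral do rewrite E2.
by rewrite poisson_integral// -EFinD -EFinM; congr EFin; field.
Qed.

(** Schur's test: the kernel K is dominated by the symmetric kernel Q, of
    integral 2 pi in each variable, and a x * a y <= (a x ^+ 2 + a y ^+ 2) /
    2. *)
Lemma weighted_energy_le eta : 0 < eta ->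
  (\int[mu]_t (w eta t * T t ^+ 2)%:E <= (2 * pi)%:E * E a)%E.
Proof.
move=> eta0.
have iwT2 : mu.-integrable setT (EFin \o (fun t => w eta t * T t ^+ 2)).
  apply: (iw (M := (\int[mu]_x `|a x|) ^+ 2)) eta0 _ _.
    exact: measurable_funX.
  by move=> t; rewrite normrX lerXn2r ?nnegrE ?Rintegral_ge0//;
    exact: trig_transform_bound.
have <- : ((\int[mu]_t (w eta t * T t ^+ 2))%:E =
    \int[mu]_t (w eta t * T t ^+ 2)%:E)%E.
  by rewrite /Rintegral fineK//; exact: (integrable_fin_num _ iwT2).
rewrite weighted_energy//.
pose G (z : R * R) := (2^-1 * (a z.1 ^+ 2 + a z.2 ^+ 2) * Q eta z.1 z.2)%:E.
have mG : measurable_fun setT G.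
  apply/measurable_EFinP; apply: measurable_funM; last exact: mQ.
  apply: measurable_funM => //; apply: measurable_funD;
    by apply: measurable_funX; exact: measurableT_comp.
have G0 z : (0 <= G z)%E.
  by rewrite lee_fin mulr_ge0// ?Q0// mulr_ge0// addr_ge0// sqr_ge0.
apply: (@le_trans _ _ (\int[mu]_x \int[mu]_y G (x, y))%E).
  have mb : measurable_fun setT (fun x => \int[mu]_y (a y * K eta x y)).
    under eq_fun do rewrite -transform_transform//.
    apply: continuous_measurable_fun; apply: trig_transform_continuous.
    exact: iwT.
  apply: le_trans (_ : (`|\int[mu]_x (a x * \int[mu]_y (a y * K eta x y))|)%:E
    <= _)%E; first by rewrite lee_fin ler_norm.
  apply: le_trans (EFin_Rintegral_le _) _; first exact: measurable_funM.
  apply: ge0_le_integral => //.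
  - apply/measurable_EFinP; apply: measurableT_comp => //.
    exact: measurable_funM.
  - exact: (@measurable_fun_fubini_tonelli_F _ _ _ _ _ mu G).
  move=> x _; rewrite normrM EFinM.
  have mK : measurable_fun setT (K eta x).
    apply: measurable_funM => //; apply: measurable_funD.
      by apply: continuous_measurable_fun; exact: continuous_poisson.
    apply: measurable_funM => //; apply: measurableT_comp => //.
      exact: mpoisson.
    exact: measurable_funD.
  apply: le_trans (lee_wpmul2l _ (EFin_Rintegral_le _)) _ => //.
    exact: measurable_funM.
  rewrite -ge0_integralZl//; last first.
    apply/measurable_EFinP; apply: measurableT_comp => //.
    exact: measurable_funM.
  apply: ge0_le_integral => //.
  - apply/measurable_EFinP; apply: measurable_funM => //.
    apply: measurableT_comp => //; exact: measurable_funM.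
  - by apply: measurableT_comp => //; exact: pair1_measurable.
  move=> y _; rewrite -EFinM lee_fin /G/= normrM mulrA.
  apply: ler_pM => //; last exact: K_le.
  rewrite -(real_normK (num_real (a x))) -(real_normK (num_real (a y))).
  rewrite -subr_ge0 (_ : _ - _ = 2^-1 * (`|a x| - `|a y|) ^+ 2); last by field.
  by rewrite mulr_ge0// sqr_ge0.
pose G1 (z : R * R) := (2^-1 * a z.1 ^+ 2 * Q eta z.1 z.2)%:E.
pose G2 (z : R * R) := (2^-1 * a z.2 ^+ 2 * Q eta z.1 z.2)%:E.
have mG1 : measurable_fun setT G1.
  apply/measurable_EFinP; apply: measurable_funM; last exact: mQ.
  by apply: measurable_funM => //; apply: measurable_funX; exact: measurableT_comp.
have mG2 : measurable_fun setT G2.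
  apply/measurable_EFinP; apply: measurable_funM; last exact: mQ.
  by apply: measurable_funM => //; apply: measurable_funX; exact: measurableT_comp.
have G10 z : (0 <= G1 z)%E.
  by rewrite lee_fin mulr_ge0// ?Q0// mulr_ge0// sqr_ge0.
have G20 z : (0 <= G2 z)%E.
  by rewrite lee_fin mulr_ge0// ?Q0// mulr_ge0// sqr_ge0.
have int1 x : (\int[mu]_y G1 (x, y) = (pi * a x ^+ 2)%:E)%E.
  rewrite /G1/=; under eq_integral do rewrite EFinM.
  rewrite ge0_integralZl//; last 3 first.
  - apply/measurable_EFinP; apply: measurable_funM => //.
    apply: measurable_funD; apply: measurableT_comp; do ?exact: mpoisson.
      exact: measurable_funB.
    exact: measurable_funD.
  - by move=> y _; rewrite lee_fin Q0.
  - by rewrite lee_fin mulr_ge0// sqr_ge0.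
  by rewrite Q_int// -EFinM; congr EFin; field.
have int2 y : (\int[mu]_x G2 (x, y) = (pi * a y ^+ 2)%:E)%E.
  rewrite -int1 /G1 /G2/=; apply: eq_integral => x _.
  by rewrite Qsym.
have GE z : (G z = G1 z + G2 z)%E.
  by rewrite /G /G1 /G2 -EFinD; congr EFin; ring.
under eq_integral do under eq_integral do rewrite GE.
have -> : (\int[mu]_x \int[mu]_y (G1 (x, y) + G2 (x, y)) =
    \int[mu]_x (\int[mu]_y G1 (x, y) + \int[mu]_y G2 (x, y)))%E.
  apply: eq_integral => x _; rewrite ge0_integralD//.
  - by apply: measurableT_comp => //; exact: pair1_measurable.
  - by apply: measurableT_comp => //; exact: pair1_measurable.
rewrite ge0_integralD//; last 4 first.
- by move=> x _; exact: integral_ge0.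
- exact: (@measurable_fun_fubini_tonelli_F _ _ _ _ _ mu G1).
- by move=> x _; exact: integral_ge0.
- exact: (@measurable_fun_fubini_tonelli_F _ _ _ _ _ mu G2).
have -> : (\int[mu]_x \int[mu]_y G2 (x, y) = \int[mu]_y \int[mu]_x G2 (x, y))%E.
  exact: fubini_tonelli.
under eq_integral do rewrite int1.
under [X in (_ + X)%E]eq_integral do rewrite int2.
have -> : (\int[mu]_x (pi * a x ^+ 2)%:E = pi%:E * E a)%E.
  rewrite /E; under eq_integral do rewrite EFinM.
  rewrite ge0_integralZl//.
  - by apply/measurable_EFinP; exact: measurable_funX.
  - by move=> x _; rewrite lee_fin sqr_ge0.
  - by rewrite lee_fin pi_ge0.
rewrite -ge0_muleDl ?lee_fin ?pi_ge0// -EFinD.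
by apply: eq_ler; congr (_%:E * _)%E; ring.
Qed.

(** The weights exp (- eta |t|) increase to 1 as eta decreases to 0, and the
    bound for each of them does not depend on eta. *)
Theorem trig_transform_energy : (E T <= (2 * pi)%:E * E a)%E.
Proof.
pose g n t := (w n.+1%:R^-1 t * T t ^+ 2)%:E.
have lim_g t : (limn (g ^~ t) = (T t ^+ 2)%:E)%E.
  apply/cvg_lim => //; apply: cvg_EFin; first exact: nearW.
  rewrite -[X in _ --> X]mul1r; apply: cvgM; last exact: cvg_cst.
  rewrite /w -[X in _ --> X]expR0; apply: continuous_cvg.
    exact: continuous_expR.
  rewrite -[X in _ --> X]oppr0; apply: cvgN.
  rewrite -[X in _ --> X](mul0r `|t|); apply: cvgM; last exact: cvg_cst.
  exact: cvg_harmonic.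
rewrite /E; under eq_integral do rewrite -lim_g.
have mg n : measurable_fun setT (g n).
  apply/measurable_EFinP; apply: measurable_funM; first exact: mw.
  exact: measurable_funX.
have g0 n t : (0 <= g n t)%E by rewrite lee_fin mulr_ge0 ?sqr_ge0.
have ndg t : {homo g ^~ t : n m / (n <= m)%N >-> (n <= m)%E}.
  move=> n m nm; rewrite lee_fin ler_wpM2r ?sqr_ge0// ler_expR lerN2.
  by rewrite ler_wpM2r// lef_pV2 ?posrE// ler_nat.
rewrite monotone_convergence//.
apply: lime_le.
  apply: ereal_nondecreasing_is_cvgn => n m nm.
  apply: ge0_le_integral => //; do ?exact: mg.
  by move=> t ?; exact: ndg.
by apply: nearW => n; apply: weighted_energy_le; rewrite invr_gt0.
Qed.

End inequality.
End transform.
End plancherel.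

(** * Square-integrable quaternion-valued functions *)

Section energy.
Variable R : realType.
Local Notation mu := (@lebesgue_measure R).
Implicit Types (F G H : R -> quat R) (p q : quat R) (x t : R) (k : 'I_4).

Lemma ge0_integral_scale (c : R) (h : R -> R) : 0 <= c ->
  measurable_fun setT h -> (forall x, 0 <= h x) ->
  (\int[mu]_x (c * h x)%:E = c%:E * \int[mu]_x (h x)%:E)%E.
Proof.
move=> c0 mh h0; under eq_integral do rewrite EFinM.
rewrite ge0_integralZl//; first exact/measurable_EFinP.
by move=> x _; rewrite lee_fin.
Qed.

Lemma ge0_integral_add (h g : R -> R) :
  measurable_fun setT h -> measurable_fun setT g ->
  (forall x, 0 <= h x) -> (forall x, 0 <= g x) ->
  (\int[mu]_x (h x + g x)%:E =
   \int[mu]_x (h x)%:E + \int[mu]_x (g x)%:E)%E.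
Proof.
move=> mh mg h0 g0; under eq_integral do rewrite EFinD.
rewrite ge0_integralD//; do ?exact/measurable_EFinP.
- by move=> x _; rewrite lee_fin.
- by move=> x _; rewrite lee_fin.
Qed.

Lemma ge0_integral_le (h g : R -> R) :
  measurable_fun setT h -> measurable_fun setT g ->
  (forall x, 0 <= h x) -> (forall x, h x <= g x) ->
  (\int[mu]_x (h x)%:E <= \int[mu]_x (g x)%:E)%E.
Proof.
move=> mh mg h0 hg; apply: ge0_le_integral => //; do ?exact/measurable_EFinP.
- by move=> x _; rewrite lee_fin.
- by move=> x _; rewrite lee_fin.
Qed.

Lemma quat_ext p q : (forall k, p 0 k = q 0 k) -> p = q.
Proof. by move=> pq; apply/rowP. Qed.

Lemma coordE q k : q 0 k = qcoord k q.
Proof. by rewrite /qcoord inord_val. Qed.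

Lemma coordD p q k : (p + q) 0 k = p 0 k + q 0 k.
Proof. by rewrite mxE. Qed.

Lemma coordN q k : (- q) 0 k = - q 0 k.
Proof. by rewrite mxE. Qed.

Lemma coordB p q k : (p - q) 0 k = p 0 k - q 0 k.
Proof. by rewrite !mxE. Qed.

Lemma coordZ (a : R) q k : (a *: q) 0 k = a * q 0 k.
Proof. by rewrite mxE. Qed.

(** The square of qnorm: multiplicative, and a polynomial in the coordinates.
    *)
Definition sqn q : R := \sum_(k < 4) q 0 k ^+ 2.

Lemma sqn_ge0 q : 0 <= sqn q.
Proof. by apply: sumr_ge0 => k _; rewrite sqr_ge0. Qed.

Lemma sqn4 q : sqn q = qcoord 0 q ^+ 2 + qcoord 1 q ^+ 2 + qcoord 2 q ^+ 2 +
  qcoord 3 q ^+ 2.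
Proof. by rewrite /sqn !big_ord_recr big_ord0 /= add0r !coordE. Qed.

Lemma sqr_qnorm q : qnorm q ^+ 2 = sqn q.
Proof. by rewrite /qnorm sqr_sqrtr// sqn_ge0. Qed.

Lemma qnorm_ge0 q : 0 <= qnorm q. Proof. exact: sqrtr_ge0. Qed.

Lemma coord_le_qnorm q k : `|q 0 k| <= qnorm q.
Proof.
rewrite -ler_sqr ?nnegrE ?qnorm_ge0// (real_normK (num_real _)) sqr_qnorm.
rewrite /sqn (bigD1 k)//= lerDl; apply: sumr_ge0 => i _.
exact: sqr_ge0.
Qed.

Lemma qnorm_le_sum q : qnorm q <= \sum_(k < 4) `|q 0 k|.
Proof.
have s0 : 0 <= \sum_(k < 4) `|q 0 k| by apply: sumr_ge0.
rewrite -ler_sqr ?nnegrE ?qnorm_ge0// sqr_qnorm /sqn.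
rewrite !big_ord_recr !big_ord0 /= !add0r.
set a := q 0 _; set b := q 0 _; set c := q 0 _; set d := q 0 _.
rewrite -(real_normK (num_real a)) -(real_normK (num_real b)).
rewrite -(real_normK (num_real c)) -(real_normK (num_real d)).
move: `|a| `|b| `|c| `|d| (normr_ge0 a) (normr_ge0 b) (normr_ge0 c) (normr_ge0 d).
by move=> *; nra.
Qed.

Lemma sqn_mul p q : sqn (p * q) = sqn p * sqn q.
Proof.
have -> : p * q = qmul p q by [].
rewrite !sqn4 /qmul !qcoord_mkquat//=; ring.
Qed.

Lemma sqn_unit (I : quat R) : unit_sphere I -> sqn I = 1.
Proof. by move=> /unit_sphereP[_ I1]; rewrite -sqr_qnorm I1 expr1n. Qed.

(** Linearity of left multiplication over the reals carries measurability,
    integrability and differentiability over to the coordinates of p q. *)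
Lemma coord_mul_linear p k : exists a : 'I_4 -> R,
  forall q, (p * q) 0 k = \sum_(i < 4) a i * q 0 i.
Proof.
exists (fun i => (p * (delta_mx 0 i : quat R)) 0 k) => q.
rewrite {1}(_ : q = \sum_i q 0 i *: (delta_mx 0 i : quat R)); last first.
  exact: row_sum_delta.
rewrite mulr_sumr summxE; apply: eq_bigr => i _.
by rewrite -scalerAr coordZ mulrC.
Qed.

Definition mquat F := forall k, measurable_fun setT (fun x => F x 0 k).

Lemma mquatB F G : mquat F -> mquat G -> mquat (F \- G).
Proof.
move=> mF mG k; under eq_fun do rewrite coordB.
exact: measurable_funB.
Qed.

Lemma mquat_sqn F : mquat F -> measurable_fun setT (fun x => sqn (F x)).
Proof. by move=> mF; apply: measurable_sum => k; exact: measurable_funX. Qed.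

Lemma mquat_qnorm F : mquat F -> measurable_fun setT (fun x => qnorm (F x)).
Proof.
move=> mF.
have -> : (fun x => qnorm (F x)) = Num.sqrt \o (fun x => sqn (F x)) by [].
apply: measurableT_comp; last exact: mquat_sqn.
by apply: continuous_measurable_fun; exact: sqrt_continuous.
Qed.

Lemma mquat_mul p F : mquat F -> mquat (fun x => p * F x).
Proof.
move=> mF k; have [a pa] := coord_mul_linear p k.
under eq_fun do rewrite pa.
by apply: measurable_sum => i; exact: measurable_funM.
Qed.

(** The square of the L^2 norm. Working with it avoids square roots of
    extended reals, at the price of the factors 2 from (a + b)^2 <= 2 a^2 + 2
    b^2 in place of the triangle inequality. *)
Definition energy F : \bar R := (\int[mu]_x (sqn (F x))%:E)%E.

Lemma energy_ge0 F : (0 <= energy F)%E.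
Proof. by apply: integral_ge0 => x _; rewrite lee_fin sqn_ge0. Qed.

Lemma qLnorm2E F : qLnorm 2 F = (energy F `^ 2^-1)%E.
Proof.
rewrite /qLnorm unlock /energy; congr (_ `^ _)%E.
apply: eq_integral => x _; rewrite /= ger0_norm ?qnorm_ge0//.
by rewrite powR_mulrn ?qnorm_ge0// sqr_qnorm.
Qed.

Lemma poweR_half_le (x : \bar R) (e : R) : (0 <= x)%E -> 0 <= e ->
  (x `^ 2^-1 <= e%:E)%E = (x <= (e ^+ 2)%:E)%E.
Proof.
move=> x0 e0; rewrite poweR12_sqrt//; case: x x0 => [x| |]//= x0.
rewrite !lee_fin in x0 *; rewrite -[RHS]ler_sqrt ?exprn_ge0//.
by rewrite sqrtr_sqr ger0_norm.
Qed.

Lemma inLp2P F : inLp 2 F <-> mquat F /\ (energy F < +oo)%E.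
Proof.
rewrite /inLp qLnorm2E; split=> -[mF iF]; split => //.
  by apply: lty_poweRy iF; rewrite invr_eq0.
exact: poweR_lty.
Qed.

Lemma ge0_cvg0P (u : nat -> \bar R) : (forall n, (0 <= u n)%E) ->
  (u n @[n --> \oo] --> 0%E) <->
  (forall e, 0 < e -> \forall n \near \oo, (u n <= e%:E)%E).
Proof.
move=> u0; split.
  move=> /fine_cvgP[fu cu] e e0.
  move/cvgrPdist_le : cu => /(_ _ e0); apply: filterS2 fu => n fn.
  rewrite sub0r normrN ger0_norm ?fine_ge0// => un.
  by rewrite -(fineK fn) lee_fin.
move=> ue; apply/fine_cvgP; split.
  apply: filterS (ue 1 ltr01) => n un.
  by rewrite ge0_fin_numE// (le_lt_trans un)// ltry.
apply/cvgrPdist_le => e e0; apply: filterS (ue e e0) => n un.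
rewrite sub0r normrN ger0_norm ?fine_ge0//.
by rewrite -lee_fin fineK// ge0_fin_numE// (le_lt_trans un)// ltry.
Qed.

Lemma cvg_qLnorm2 (F_ : nat -> R -> quat R) :
  (qLnorm 2 (F_ n) @[n --> \oo] --> 0%E) <->
  (forall e, 0 < e -> \forall n \near \oo, (energy (F_ n) <= e%:E)%E).
Proof.
under eq_fun do rewrite qLnorm2E.
split.
  move=> /(ge0_cvg0P (fun n => poweR_ge0 _ _)) H e e0.
  have e20 : 0 < Num.sqrt e by rewrite sqrtr_gt0.
  apply: filterS (H _ e20) => n.
  by rewrite poweR_half_le ?energy_ge0 ?sqrtr_ge0// sqr_sqrtr// ltW.
move=> H; apply/ge0_cvg0P => [n|e e0]; first exact: poweR_ge0.
have e20 : 0 < e ^+ 2 by rewrite exprn_gt0.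
apply: filterS (H _ e20) => n.
by rewrite poweR_half_le ?energy_ge0// ltW.
Qed.

Lemma energyD F G : mquat F -> mquat G ->
  (energy (F \+ G)%R <= 2%:E * energy F + 2%:E * energy G)%E.
Proof.
move=> mF mG; have mF2 := mquat_sqn mF; have mG2 := mquat_sqn mG.
have mFE : measurable_fun setT (fun x => (sqn (F x))%:E) by exact/measurable_EFinP.
have mGE : measurable_fun setT (fun x => (sqn (G x))%:E) by exact/measurable_EFinP.
rewrite /energy -!ge0_integralZl//; last 2 first.
- by move=> x _; rewrite lee_fin sqn_ge0.
- by move=> x _; rewrite lee_fin sqn_ge0.
rewrite -ge0_integralD//; last 4 first.
- by move=> x _; rewrite -EFinM lee_fin mulr_ge0// sqn_ge0.
- exact: measurable_funeM.
- by move=> x _; rewrite -EFinM lee_fin mulr_ge0// sqn_ge0.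
- exact: measurable_funeM.
apply: ge0_le_integral => //.
- by move=> x _; rewrite lee_fin sqn_ge0.
- apply/measurable_EFinP; apply: mquat_sqn => k.
  by under eq_fun do rewrite coordD; exact: measurable_funD.
- by apply: emeasurable_funD; exact: measurable_funeM.
move=> x _; rewrite -!EFinM -EFinD lee_fin /sqn !mulr_sumr -big_split/=.
apply: ler_sum => k _; rewrite coordD -subr_ge0.
rewrite (_ : _ - _ = (F x 0 k - G x 0 k) ^+ 2); last by ring.
exact: sqr_ge0.
Qed.

Lemma energyN F : energy (\- F) = energy F.
Proof.
apply: eq_integral => x _; congr EFin; apply: eq_bigr => k _.
by rewrite coordN sqrrN.
Qed.

Lemma energyB F G : mquat F -> mquat G ->
  (energy (F \- G)%R <= 2%:E * energy F + 2%:E * energy G)%E.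
Proof.
move=> mF mG; rewrite -(energyN G); apply: energyD => // k.
under eq_fun do rewrite coordN.
exact: measurableT_comp.
Qed.

Lemma energy_triangle F G H : mquat F -> mquat G -> mquat H ->
  (energy (F \- G)%R <=
     2%:E * energy (F \- H)%R + 2%:E * energy (H \- G)%R)%E.
Proof.
move=> mF mG mH; have := energyD (mquatB mF mH) (mquatB mH mG).
rewrite (_ : ((F \- H) \+ (H \- G))%R = (F \- G)%R)//.
by apply/funext => x /=; rewrite addrA subrK.
Qed.

Lemma energy_sum F : mquat F ->
  energy F = (\sum_(k < 4) \int[mu]_x (F x 0 k ^+ 2)%:E)%E.
Proof.
move=> mF; rewrite /energy -ge0_integral_sum//.
- by apply: eq_integral => x _; rewrite /sqn sumEFin.
- by move=> k; apply/measurable_EFinP; apply: measurable_funX; exact: mF.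
- by move=> k x _; rewrite lee_fin sqr_ge0.
Qed.

Lemma energy_coord F k : mquat F ->
  (\int[mu]_x (F x 0 k ^+ 2)%:E <= energy F)%E.
Proof.
move=> mF; apply: ge0_le_integral => //.
- by move=> x _; rewrite lee_fin sqr_ge0.
- by apply/measurable_EFinP; apply: measurable_funX; exact: mF.
- by apply/measurable_EFinP; exact: mquat_sqn.
move=> x _; rewrite lee_fin /sqn (bigD1 k)//= lerDl.
by apply: sumr_ge0 => i _; exact: sqr_ge0.
Qed.

Lemma energy_mul (I : quat R) F : unit_sphere I -> energy (fun x => I * F x) = energy F.
Proof.
by move=> uI; apply: eq_integral => x _; rewrite sqn_mul sqn_unit// mul1r.
Qed.

Lemma inLp1P F : inLp 1 F <->
  mquat F /\ forall k, mu.-integrable setT (EFin \o (fun x => F x 0 k)).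
Proof.
have E : qLnorm 1 F = (\int[mu]_x (qnorm (F x))%:E)%E.
  rewrite /qLnorm Lnorm1; apply: eq_integral => x _.
  by rewrite /= ger0_norm// qnorm_ge0.
rewrite /inLp E; split => -[mF iF]; split => //.
  move=> k; apply/integrableP; split.
    by apply/measurable_EFinP; exact: mF.
  apply: le_lt_trans iF; apply: ge0_le_integral => //.
  - by apply/measurable_EFinP; apply: measurableT_comp => //; exact: mF.
  - by apply/measurable_EFinP; exact: mquat_qnorm.
  - by move=> x _; rewrite lee_fin coord_le_qnorm.
apply: (@le_lt_trans _ _ (\int[mu]_x (\sum_(k < 4) (`|F x 0 k|)%:E))%E).
  apply: ge0_le_integral => //.
  - by move=> x _; rewrite lee_fin qnorm_ge0.
  - by apply/measurable_EFinP; exact: mquat_qnorm.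
  - apply: emeasurable_sum => k; apply/measurable_EFinP.
    by apply: measurableT_comp => //; exact: mF.
  - by move=> x _; rewrite sumEFin lee_fin qnorm_le_sum.
rewrite ge0_integral_sum//; last first.
  by move=> k; apply/measurable_EFinP; apply: measurableT_comp => //; exact: mF.
by apply: lte_sum_pinfty => k _; case/integrableP : (iF k).
Qed.

End energy.

(** * The Fourier transform on integrable functions *)

Section fourier_energy.
Variable R : realType.
Local Notation mu := (@lebesgue_measure R).
Implicit Types (F G H : R -> quat R) (I q : quat R) (x t : R) (k : 'I_4).

Local Notation kappa := ((Num.sqrt (2 * pi))^-1 : R).

Lemma kappa_sqr : kappa ^+ 2 = (2 * pi)^-1.
Proof. by rewrite exprVn sqr_sqrtr// mulr_ge0// pi_ge0. Qed.

Lemma qexp_phase I s : unit_sphere I ->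
  qexp (- (I * s%:A)) = (cos s)%:A - sin s *: I.
Proof.
move=> uI; have -> : - (I * s%:A) = slice I 0 (- s).
  by rewrite /slice scale0r add0r scaleNr mulrN.
by rewrite qexp_slice// expR0 scale1r cosN sinN scaleNr.
Qed.

Lemma phase_mul_coord I s q k : unit_sphere I ->
  (qexp (- (I * s%:A)) * q) 0 k = cos s * q 0 k - sin s * (I * q) 0 k.
Proof.
move=> uI; rewrite qexp_phase// mulrBl coordB -!scalerAl mul1r.
by rewrite !coordZ.
Qed.

Lemma fourier1_coord I F t k : unit_sphere I -> inLp 1 F ->
  fourier1 I F t 0 k = kappa *
    (trig_transform cos (fun x => F x 0 k) t -
     trig_transform sin (fun x => (I * F x) 0 k) t).
Proof.
move=> uI /inLp1P[mF iF]; rewrite /fourier1 coordZ; congr (_ * _).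
have iIF j : mu.-integrable setT (EFin \o (fun x => (I * F x) 0 j)).
  have [a Ia] := coord_mul_linear I j.
  under eq_fun do rewrite Ia.
  rewrite (_ : _ \o _ = (fun x => \sum_(i < 4) (a i * F x 0 i)%:E)%E); last first.
    by apply/funext => x /=; rewrite sumEFin.
  by apply: integrable_sum => // i _; exact: integrable_scale.
rewrite /trig_transform -RintegralB//; last 2 first.
- exact: (integrable_trig (trig_cos R)).
- exact: (integrable_trig (trig_sin R)).
rewrite /qintegral mxE; apply: eq_Rintegral => x _.
by rewrite phase_mul_coord// mulrC (mulrC (sin _)).
Qed.

Lemma inLp1_mul I F : inLp 1 F -> inLp 1 (fun x => I * F x).
Proof.
move=> /inLp1P[mF iF]; apply/inLp1P; split => [|j]; first exact: mquat_mul.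
have [a Ia] := coord_mul_linear I j.
under eq_fun do rewrite Ia.
rewrite (_ : _ \o _ = (fun x => \sum_(i < 4) (a i * F x 0 i)%:E)%E); last first.
  by apply/funext => x /=; rewrite sumEFin.
by apply: integrable_sum => // i _; exact: integrable_scale.
Qed.

Lemma inLp2_mul I F : unit_sphere I -> inLp 2 F -> inLp 2 (fun x => I * F x).
Proof.
move=> uI /inLp2P[mF eF]; apply/inLp2P; split; first exact: mquat_mul.
by rewrite energy_mul.
Qed.

Lemma mquat_fourier1 I F : unit_sphere I -> inLp 1 F -> mquat (fourier1 I F).
Proof.
move=> uI F1 k; under eq_fun do rewrite fourier1_coord//.
have /inLp1P[_ iF] := F1; have /inLp1P[_ iIF] := inLp1_mul I F1.
apply: measurable_funM => //; apply: measurable_funB;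
  apply: continuous_measurable_fun.
- exact: (trig_transform_continuous (trig_cos R)).
- exact: (trig_transform_continuous (trig_sin R)).
Qed.

(** Each coordinate is the difference of a cosine and a sine transform,
    divided by the square root of 2 pi. The factor 2 pi of their energy
    inequality cancels; one factor 2 comes from (c - s)^2 <= 2 c^2 + 2 s^2 and
    another from the two terms, F and I F, which have the same energy. *)
Lemma fourier1_energy I F : unit_sphere I -> inLp 1 F -> mquat F ->
  (energy (fourier1 I F) <= 4%:E * energy F)%E.
Proof.
move=> uI F1 mF.
have /inLp1P[_ iF] := F1; have /inLp1P[mIF iIF] := inLp1_mul I F1.
pose C k := trig_transform cos (fun x => F x 0 k).
pose S k := trig_transform sin (fun x => (I * F x) 0 k).
have mC k : measurable_fun setT (C k).
  apply: continuous_measurable_fun.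
  exact: (trig_transform_continuous (trig_cos R)).
have mS k : measurable_fun setT (S k).
  apply: continuous_measurable_fun.
  exact: (trig_transform_continuous (trig_sin R)).
have mC2 k : measurable_fun setT (fun t => (C k t ^+ 2)%:E).
  by apply/measurable_EFinP; exact: measurable_funX.
have mS2 k : measurable_fun setT (fun t => (S k t ^+ 2)%:E).
  by apply/measurable_EFinP; exact: measurable_funX.
have sq0 (r : R) : (0 <= (r ^+ 2)%:E)%E by rewrite lee_fin sqr_ge0.
have coord k : (\int[mu]_t (fourier1 I F t 0 k ^+ 2)%:E <=
    2%:E * \int[mu]_x (F x 0 k ^+ 2)%:E +
    2%:E * \int[mu]_x ((I * F x)%R 0%R k ^+ 2)%:E)%E.
  have h1 := trig_transform_energy (trig_cos R) (iF k).
  have h2 := trig_transform_energy (trig_sin R) (iIF k).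
  have pi0 : (0 <= (pi^-1)%:E :> \bar R)%E by rewrite lee_fin invr_ge0 pi_ge0.
  apply: (@le_trans _ _ ((pi^-1)%:E * (\int[mu]_t (C k t ^+ 2)%:E) +
      (pi^-1)%:E * (\int[mu]_t (S k t ^+ 2)%:E))%E).
    have pV0 : 0 <= pi^-1 :> R by rewrite invr_ge0 pi_ge0.
    rewrite -(ge0_integral_scale pV0)//; last 2 first.
    - exact: measurable_funX.
    - by move=> t; exact: sqr_ge0.
    rewrite -(ge0_integral_scale pV0)//; last 2 first.
    - exact: measurable_funX.
    - by move=> t; exact: sqr_ge0.
    rewrite -ge0_integral_add; last 4 first.
    - by apply: measurable_funM => //; exact: measurable_funX.
    - by apply: measurable_funM => //; exact: measurable_funX.
    - by move=> t; rewrite mulr_ge0// sqr_ge0.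
    - by move=> t; rewrite mulr_ge0// sqr_ge0.
    apply: ge0_integral_le => [|||t].
    - by apply: measurable_funX; exact: mquat_fourier1.
    - by apply: measurable_funD; apply: measurable_funM => //;
        exact: measurable_funX.
    - by move=> t; exact: sqr_ge0.
    rewrite fourier1_coord// -/(C k t) -/(S k t) exprMn kappa_sqr.
    have p0 := pi_gt0 R.
    have aux (p c s : R) : 0 < p ->
        p^-1 * c ^+ 2 + p^-1 * s ^+ 2 = (2 * p)^-1 * (2 * c ^+ 2 + 2 * s ^+ 2).
      by move=> p1; field; rewrite gt_eqF.
    rewrite aux//.
    rewrite ler_pM2l ?invr_gt0 ?mulr_gt0// -subr_ge0.
    rewrite (_ : _ - _ = (C k t + S k t) ^+ 2); last by ring.
    exact: sqr_ge0.
  apply: (le_trans (leeD (lee_wpmul2l pi0 h1) (lee_wpmul2l pi0 h2))).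
  rewrite !muleA -!EFinM (_ : pi^-1 * (2 * pi) = 2)//.
  by rewrite mulrCA mulVf ?mulr1// gt_eqF// pi_gt0.
rewrite !energy_sum//; last exact: mquat_fourier1.
apply: (@le_trans _ _ (\sum_(k < 4) (2%:E * \int[mu]_x (F x 0 k ^+ 2)%:E +
    2%:E * \int[mu]_x ((I * F x)%R 0%R k ^+ 2)%:E))%E).
  by apply: lee_sum => k _; exact: coord.
rewrite big_split/= -!ge0_sume_distrr; last 2 first.
- by move=> k _; apply: integral_ge0 => x _; exact: sq0.
- by move=> k _; apply: integral_ge0 => x _; exact: sq0.
rewrite -energy_sum// -(energy_sum mIF) energy_mul//.
rewrite -ge0_muleDl ?lee_fin// -EFinD.
by apply: eq_ler; congr (_%:E * _)%E; ring.
Qed.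

Lemma fourier1B I F G : unit_sphere I -> inLp 1 F -> inLp 1 G ->
  fourier1 I (F \- G) = fourier1 I F \- fourier1 I G.
Proof.
move=> uI F1 G1; have /inLp1P[mF iF] := F1; have /inLp1P[mG iG] := G1.
have /inLp1P[_ iIF] := inLp1_mul I F1; have /inLp1P[_ iIG] := inLp1_mul I G1.
have FG1 : inLp 1 (F \- G).
  apply/inLp1P; split => [|k]; first exact: mquatB.
  under eq_fun do rewrite coordB.
  exact: integrable_sub.
apply/funext => t; apply: quat_ext => k.
rewrite coordB !fourier1_coord// -mulrBr; congr (_ * _).
have tB c e (ce : trig_kernel c e) (a b : R -> R) :
    mu.-integrable setT (EFin \o a) -> mu.-integrable setT (EFin \o b) ->
    trig_transform c (fun x => a x - b x) t =
    trig_transform c a t - trig_transform c b t.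
  move=> ia ib; rewrite /trig_transform -RintegralB//; last 2 first.
  - exact: (integrable_trig ce).
  - exact: (integrable_trig ce).
  by apply: eq_Rintegral => x _; rewrite mulrBl.
under [X in trig_transform cos X]eq_fun do rewrite coordB.
under [X in trig_transform sin X]eq_fun do rewrite mulrBr coordB.
rewrite (tB _ _ (trig_cos R))// (tB _ _ (trig_sin R))//; ring.
Qed.

End fourier_energy.

(** * Limits of rapidly convergent sequences in quadratic mean *)

Section riesz_fischer.
Variable R : realType.
Local Notation mu := (@lebesgue_measure R).
Implicit Types (x : R).

(** Iterated use of (a + b)^2 <= 2 a^2 + 2 b^2. *)
Lemma sqr_increment_le (g : nat -> R) m j :
  (g (m + j)%N - g m) ^+ 2 <=
  \sum_(0 <= i < j) 2 ^+ i.+1 * (g (m + i).+1 - g (m + i)%N) ^+ 2.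
Proof.
elim: j m => [|j IH] m.
  by rewrite addn0 subrr expr0n big_geq.
rewrite big_nat_recl// addn0 expr1.
have -> : \sum_(0 <= i < j) 2 ^+ i.+2 * (g (m + i.+1).+1 - g (m + i.+1)%N) ^+ 2 =
    2 * \sum_(0 <= i < j) 2 ^+ i.+1 * (g (m.+1 + i).+1 - g (m.+1 + i)%N) ^+ 2.
  rewrite mulr_sumr; apply: eq_bigr => i _; rewrite addSnnS exprS; ring.
have := IH m.+1; rewrite addSnnS.
set S := \sum_(_ <= _ < _) _; set a := g (m + j.+1)%N => h.
set b := g m.+1 in h *; set c := g m.
have := sqr_ge0 ((a - b) - (b - c)); rewrite !expr2 in h *; nra.
Qed.

Variables (g : nat -> R -> R) (M : R).
Hypotheses (mg : forall j, measurable_fun setT (g j)) (M0 : 0 <= M)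
  (gM : forall j, (\int[mu]_x ((g j.+1 x - g j x) ^+ 2)%:E
     <= (M / 4 ^+ j)%:E)%E).

Let s x : \bar R :=
  (\sum_(0 <= i <oo) (2 ^+ i * (g i.+1 x - g i x) ^+ 2)%:E)%E.

Let term_ge0 i x : 0 <= 2 ^+ i * (g i.+1 x - g i x) ^+ 2.
Proof. by apply: mulr_ge0; [exact: exprn_ge0|exact: sqr_ge0]. Qed.

Let mterm i : measurable_fun setT (fun x => 2 ^+ i * (g i.+1 x - g i x) ^+ 2).
Proof.
apply: measurable_funM => //; apply: measurable_funX.
exact: measurable_funB.
Qed.

Let s_ge0 x : (0 <= s x)%E.
Proof. by apply: nneseries_ge0 => i _ _; rewrite lee_fin. Qed.

Let ms : measurable_fun setT s.
Proof.
apply: ge0_emeasurable_sum => [i x _ _|i _]; first by rewrite lee_fin.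
exact/measurable_EFinP.
Qed.

Let int_s : (\int[mu]_x s x <= (2 * M)%:E)%E.
Proof.
rewrite /s integral_nneseries//; last 2 first.
- by move=> i; apply/measurable_EFinP; exact: mterm.
- by move=> i x _; rewrite lee_fin.
apply: (@le_trans _ _ (\sum_(0 <= i <oo) (M / 2 ^+ i)%:E)%E).
  apply: lee_nneseries => [i _ _|i _].
    by apply: integral_ge0 => x _; rewrite lee_fin.
  rewrite ge0_integral_scale//; last 2 first.
  - by apply: measurable_funX; exact: measurable_funB.
  - by move=> x; exact: sqr_ge0.
  apply: le_trans (lee_wpmul2l _ (gM i)) _; first by rewrite lee_fin exprn_ge0.
  rewrite -EFinM lee_fin; apply: eq_ler.
  have -> : (4 : R) ^+ i = 2 ^+ i * 2 ^+ i.
    by rewrite -exprMn; congr (_ ^+ i); ring.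
  by field; rewrite expf_neq0.
have := @cvg_geometric_series R M 2^-1.
rewrite ger0_norm// invf_lt1// ltr1n => /(_ isT) cM.
have {}cM : (fun n => (\sum_(0 <= i < n) (M / 2 ^+ i)%:E)%E) n @[n --> \oo]
    --> (2 * M)%:E.
  rewrite (_ : 2 * M = M / (1 - 2^-1)); last by field.
  under eq_fun do rewrite sumEFin.
  apply: cvg_EFin; first exact: nearW.
  by under eq_fun do under eq_bigr do rewrite -exprVn.
by rewrite (cvg_lim _ cM).
Qed.

Let increment_le m j x :
  (((g (m + j)%N x - g m x) ^+ 2)%:E <= (2 / 2 ^+ m)%:E * s x)%E.
Proof.
apply: (@le_trans _ _ ((2 / 2 ^+ m)%:E * (\sum_(0 <= i < m + j)
  (2 ^+ i * (g i.+1 x - g i x) ^+ 2)%:E))%E); last first.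
  apply: lee_wpmul2l; first by rewrite lee_fin divr_ge0// exprn_ge0.
  by apply: nneseries_lim_ge => i _ _; rewrite lee_fin.
rewrite sumEFin -EFinM lee_fin.
apply: le_trans (sqr_increment_le (fun i => g i x) m j) _.
rewrite [X in _ <= _ * X](@big_cat_nat _ _ _ m)//= ?leq_addr// mulrDr.
apply: (@le_trans _ _ (2 / 2 ^+ m * (\sum_(m <= i < m + j)
    2 ^+ i * (g i.+1 x - g i x) ^+ 2))); last first.
  by rewrite lerDr mulr_ge0 ?divr_ge0 ?exprn_ge0// sumr_ge0.
rewrite -{4}(add0n m) (addnC m j) big_addn addnK mulr_sumr.
apply: eq_ler; apply: eq_bigr => i _.
rewrite (addnC i m) exprD exprS; field.
by rewrite expf_neq0.
Qed.

Let L x : R := if (s x < +oo)%E then limn (g ^~ x) else 0.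

Let cvg_g x : (s x < +oo)%E -> g n x @[n --> \oo] --> L x.
Proof.
move=> sx; rewrite /L sx; apply/cauchy_cvgP; apply: cauchy_exP => e e0.
have sfin : s x \is a fin_num by rewrite ge0_fin_numE.
have half1 : `|2^-1| < 1 :> R by rewrite ger0_norm// invf_lt1// ltr1n.
have := @cvg_geometric R (2 * fine (s x)) 2^-1 half1.
have e20 : 0 < e ^+ 2 by rewrite exprn_gt0.
move=> /cvgrPdist_lt /(_ _ e20)[m _ /(_ m (leqnn m))] /=.
rewrite sub0r normrN ger0_norm; last first.
  by rewrite mulr_ge0 ?mulr_ge0 ?fine_ge0// exprn_ge0.
move=> me; exists (g m x); exists m => // n /= mn.
rewrite /ball/= distrC -(subnKC mn).
rewrite -ltr_sqr ?nnegrE// ?(ltW e0)// (real_normK (num_real _)).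
apply: le_lt_trans me; rewrite -lee_fin.
apply: le_trans (increment_le m (n - m) x) _.
rewrite -(fineK sfin) -EFinM lee_fin exprVn.
by apply: eq_ler; ring.
Qed.

Let mL : measurable_fun setT L.
Proof.
pose h n x := if (s x < +oo)%E then g n x else 0.
apply: (@measurable_fun_cvg _ _ _ _ h).
  move=> n; apply: measurable_fun_ifT => //.
  exact: measurable_fun_lte.
move=> x _; rewrite /h /L; case: ifPn => sx; last exact: cvg_cst.
by have := cvg_g sx; rewrite /L sx.
Qed.

Let L_le m x : (((L x - g m x) ^+ 2)%:E <= (2 / 2 ^+ m)%:E * s x)%E.
Proof.
have [sx|] := ltP (s x) +oo%E; last first.
  by rewrite leye_eq => /eqP ->; rewrite gt0_muley ?leey// lte_fin divr_gt0// exprn_gt0.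
have sfin : s x \is a fin_num by rewrite ge0_fin_numE.
rewrite -(fineK sfin) -EFinM lee_fin.
have c1 : (g (m + j)%N x - g m x) ^+ 2 @[j --> \oo] --> (L x - g m x) ^+ 2.
  have c0 : g (m + j)%N x @[j --> \oo] --> L x.
    exact: (cvg_comp (addn m) (g ^~ x) (cvg_addnl m) (cvg_g sx)).
  by rewrite expr2; under eq_fun do rewrite expr2; apply: cvgM;
    (apply: cvgB; [exact: c0|exact: cvg_cst]).
apply: (cvgr_to_le c1); apply: nearW => j.
by rewrite -lee_fin (EFinM _ (fine _)) (fineK sfin); exact: increment_le.
Qed.

(** The series s of the 2^i (g (i + 1) - g i)^2 has a finite integral, hence
    is finite almost everywhere, and dominates: (g (m + j) - g m)^2 <= 2^(1 -
    m) s. Where s is finite the sequence converges; where it is infinite any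
    value of the limit satisfies the estimate, and 0 is taken. *)
Lemma riesz_fischer : exists L : R -> R, measurable_fun setT L /\
  forall m, (\int[mu]_x ((L x - g m x) ^+ 2)%:E <= (4 * M / 2 ^+ m)%:E)%E.
Proof.
exists L; split => [//|m].
have c0 : (0 <= (2 / 2 ^+ m)%:E :> \bar R)%E.
  by rewrite lee_fin divr_ge0// exprn_ge0.
apply: (@le_trans _ _ ((2 / 2 ^+ m)%:E * \int[mu]_x s x)%E).
  rewrite -ge0_integralZl//; apply: ge0_le_integral => //.
  - by move=> x _; rewrite lee_fin sqr_ge0.
  - apply/measurable_EFinP; apply: measurable_funX.
    by apply: measurable_funB => //; exact: mg.
  - exact: measurable_funeM.
apply: le_trans (lee_wpmul2l c0 int_s) _.
rewrite -EFinM lee_fin; apply: eq_ler; ring.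
Qed.

End riesz_fischer.

(** * The Fourier transform on square-integrable functions *)

Section fourier_L2.
Variable R : realType.
Local Notation mu := (@lebesgue_measure R).
Implicit Types (F G H : R -> quat R) (I q : quat R) (x t : R) (k : 'I_4).

Definition gauss_weight n x : R := expR (- x ^+ 2 / (2 * n.+1%:R)).

(** Gaussian damping makes a square-integrable function integrable, and
    extends to an entire factor, which the contour shift requires. The width n
    + 1 avoids a division by 0. *)
Definition damp n F x : quat R := gauss_weight n x *: F x.

Lemma gauss_weight_ge0 n x : 0 <= gauss_weight n x.
Proof. exact: expR_ge0. Qed.

Lemma gauss_weight_le1 n x : gauss_weight n x <= 1.
Proof.
rewrite /gauss_weight -expR0 ler_expR mulNr oppr_le0.
by apply: divr_ge0; [exact: sqr_ge0|exact: mulr_ge0].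
Qed.

Lemma gauss_weight_le n x :
  gauss_weight n x <= expR (n.+1%:R / 2) * expR (- `|x|).
Proof.
have n0 : 0 < 2 * n.+1%:R :> R by rewrite mulr_gt0// ltr0n.
rewrite /gauss_weight -expRD ler_expR -subr_ge0.
rewrite -(real_normK (num_real x)).
rewrite (_ : _ - _ = (`|x| - n.+1%:R) ^+ 2 / (2 * n.+1%:R)).
  by apply: divr_ge0; [exact: sqr_ge0|exact: ltW].
by field; rewrite gt_eqF// ltr0n.
Qed.

Lemma continuous_gauss_weight n : continuous (gauss_weight n).
Proof.
move=> x; apply: continuous_comp; last exact: continuous_expR.
apply: cvgM; last exact: cvg_cst.
apply: cvgN; exact: exprn_continuous.
Qed.

Let mw n : measurable_fun setT (gauss_weight n).
Proof. by apply: continuous_measurable_fun; exact: continuous_gauss_weight. Qed.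

Lemma integrable_exp_norm :
  mu.-integrable setT (EFin \o (fun x : R => expR (- `|x|))).
Proof.
have := @integrable_exp_abs R 1 ltr01.
by under eq_fun do rewrite mul1r.
Qed.

Lemma integrable_gauss_weight n : mu.-integrable setT (EFin \o gauss_weight n).
Proof.
apply: (@integrable_dominated _ _ _ (fun x => expR (n.+1%:R / 2) * expR (- `|x|))) => //.
- by apply: integrable_scale => //; exact: integrable_exp_norm.
- by move=> x _; rewrite ger0_norm ?gauss_weight_ge0// gauss_weight_le.
Qed.

Lemma gauss_weight_cvg x : gauss_weight n x @[n --> \oo] --> (1 : R).
Proof.
rewrite /gauss_weight -[X in _ --> X]expR0; apply: continuous_cvg.
  exact: continuous_expR.
rewrite (_ : (fun n : nat => - x ^+ 2 / (2 * n.+1%:R)) =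
  (fun n => - x ^+ 2 / 2 * harmonic n)); last first.
  by apply/funext => n; rewrite /= invfM mulrA.
rewrite -[X in _ --> X](mulr0 (- x ^+ 2 / 2)); apply: cvgM; first exact: cvg_cst.
exact: cvg_harmonic.
Qed.

Lemma integrable_sqr_coord F k : inLp 2 F ->
  mu.-integrable setT (EFin \o (fun x => F x 0 k ^+ 2)).
Proof.
move=> /inLp2P[mF eF]; apply/integrableP; split.
  by apply/measurable_EFinP; apply: measurable_funX; exact: mF.
apply: le_lt_trans eF; apply: le_trans (energy_coord k mF).
apply: eq_ler; apply: eq_integral => x _.
by rewrite /= ger0_norm// sqr_ge0.
Qed.

Lemma integrable_sqn F : inLp 2 F ->
  mu.-integrable setT (EFin \o (fun x => sqn (F x))).
Proof.
move=> /inLp2P[mF eF]; apply/integrableP; split.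
  by apply/measurable_EFinP; exact: mquat_sqn.
apply: le_lt_trans eF.
apply: eq_ler; apply: eq_integral => x _.
by rewrite /= ger0_norm// sqn_ge0.
Qed.

Lemma mquat_damp n F : mquat F -> mquat (damp n F).
Proof.
move=> mF k; under eq_fun do rewrite /damp coordZ.
by apply: measurable_funM => //; exact: mF.
Qed.

Lemma damp_inLp1 n F : inLp 2 F -> inLp 1 (damp n F).
Proof.
move=> F2; have /inLp2P[mF eF] := F2.
apply/inLp1P; split => [|k]; first exact: mquat_damp.
apply: (@integrable_dominated _ _ _ (fun x => gauss_weight n x + F x 0 k ^+ 2)) => //.
- exact: mquat_damp.
- apply: integrable_add => //; first exact: integrable_gauss_weight.
  exact: integrable_sqr_coord.
move=> x _; rewrite /damp coordZ normrM (ger0_norm (gauss_weight_ge0 _ _)).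
have := gauss_weight_le1 n x; have := gauss_weight_ge0 n x.
rewrite -(real_normK (num_real (F x 0 k))).
move: (gauss_weight n x) `|F x 0 k| (normr_ge0 (F x 0 k)) => w a *; nra.
Qed.

Lemma damp_inLp2 n F : inLp 2 F -> inLp 2 (damp n F).
Proof.
move=> /inLp2P[mF eF]; apply/inLp2P; split; first exact: mquat_damp.
apply: le_lt_trans eF; apply: ge0_integral_le.
- by apply: mquat_sqn; exact: mquat_damp.
- exact: mquat_sqn.
- by move=> x; exact: sqn_ge0.
move=> x; apply: ler_sum => k _; rewrite /damp coordZ exprMn.
rewrite ler_piMl ?sqr_ge0// expr_le1 ?gauss_weight_ge0//.
exact: gauss_weight_le1.
Qed.

Lemma damp_cvg F : inLp 2 F -> forall e, 0 < e ->
  \forall n \near \oo, (energy (damp n F \- F)%R <= e%:E)%E.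
Proof.
move=> F2 e e0; have /inLp2P[mF eF] := F2.
have E n x : sqn ((damp n F \- F) x) = (gauss_weight n x - 1) ^+ 2 * sqn (F x).
  rewrite /sqn mulr_sumr; apply: eq_bigr => k _.
  by rewrite coordB /damp coordZ -exprMn mulrBl mul1r.
have w1 n x : (gauss_weight n x - 1) ^+ 2 <= 1.
  have := gauss_weight_le1 n x; have := gauss_weight_ge0 n x; nra.
have c0 : \int[mu]_x sqn ((damp n F \- F) x) @[n --> \oo] --> \int[mu]_x (cst 0 x : R).
  apply: (@Rintegral_dominated_cvg _ _ _ _ (fun x => sqn (F x))) => //.
  - by move=> n; apply: mquat_sqn; apply: mquatB => //; exact: mquat_damp.
  - apply: aeW => x _.
    rewrite (_ : (fun n => sqn ((damp n F \- F) x)) =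
      (fun n => (gauss_weight n x - 1) ^+ 2 * sqn (F x))); last first.
      by apply/funext => n; exact: E.
    rewrite /cst -[X in _ --> X](mul0r (sqn (F x))).
    apply: cvgM; last exact: cvg_cst.
    rewrite -[X in _ --> X](expr0n R 2) -(subrr 1) expr2.
    rewrite (_ : (fun n => (gauss_weight n x - 1) ^+ 2) =
      (fun n => (gauss_weight n x - 1) * (gauss_weight n x - 1))); last first.
      by apply/funext => n; rewrite expr2.
    by apply: cvgM; (apply: cvgB; [exact: gauss_weight_cvg|exact: cvg_cst]).
  - exact: integrable_sqn.
  - move=> n x _; rewrite ger0_norm ?sqn_ge0// E.
    by rewrite ler_piMl// sqn_ge0.
rewrite Rintegral_cst//= mul0r in c0.
move/cvgrPdist_le : c0 => /(_ _ e0); apply: filterS => n.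
have i0 : (0 <= energy (damp n F \- F)%R)%E by exact: energy_ge0.
have ifin : energy (damp n F \- F)%R \is a fin_num.
  rewrite ge0_fin_numE//; apply: le_lt_trans eF; apply: ge0_integral_le.
  - by apply: mquat_sqn; apply: mquatB => //; exact: mquat_damp.
  - exact: mquat_sqn.
  - by move=> x; exact: sqn_ge0.
  - by move=> x; rewrite E ler_piMl// sqn_ge0.
rewrite sub0r normrN ger0_norm; last by apply: fine_ge0.
by rewrite -lee_fin /Rintegral fineK.
Qed.

(** The transforms of a sequence of damped functions that converges fast to F
    satisfy the hypotheses of the Riesz-Fischer lemma, by the energy
    inequality. *)
Lemma fourier2_exists I F : unit_sphere I -> inLp 2 F ->
  exists G, is_fourier2 I F G.
Proof.
move=> uI F2; have /inLp2P[mF eF] := F2.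
have e4 j : 0 < (4 ^+ j)^-1 :> R by rewrite invr_gt0 exprn_gt0.
(* The rate 4^(- j) is the one that the Riesz-Fischer lemma asks for. *)
have /choice[phi phiP] : forall j, exists n,
    (energy (damp n F \- F)%R <= ((4 ^+ j)^-1)%:E)%E.
  by move=> j; have [n _ /(_ n (leqnn n))] := damp_cvg F2 (e4 j); exists n.
pose f j := damp (phi j) F; pose g j := fourier1 I (f j).
have mf j : mquat (f j) by exact: mquat_damp.
have f1 j : inLp 1 (f j) by exact: damp_inLp1.
have mg j : mquat (g j) by exact: mquat_fourier1.
have gg j : (energy (g j.+1 \- g j)%R <= (16 / 4 ^+ j)%:E)%E.
  have f1B : inLp 1 (f j.+1 \- f j).
    have /inLp1P[m1 i1] := f1 j.+1; have /inLp1P[m0 i0] := f1 j.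
    apply/inLp1P; split => [|k]; first exact: mquatB.
    by under eq_fun do rewrite coordB; exact: integrable_sub.
  rewrite /g -fourier1B//.
  apply: le_trans (fourier1_energy uI f1B (mquatB (mf _) (mf _))) _.
  have h := energy_triangle (mf j.+1) (mf j) mF.
  have h1 := phiP j.+1; have h2 := phiP j.
  rewrite -(energyN (F \- f j)) in h.
  rewrite (_ : (\- (F \- f j))%R = (f j \- F)%R) in h; last first.
    by apply/funext => x /=; rewrite opprB.
  apply: (@le_trans _ _ (4%:E * (2%:E * ((4 ^+ j.+1)^-1)%:E + 2%:E * ((4 ^+ j)^-1)%:E))%E).
    apply: lee_wpmul2l; first by rewrite lee_fin.
    by apply: le_trans h _; apply: leeD; apply: lee_wpmul2l; rewrite ?lee_fin.
  change ((4 * (2 * (4 ^+ j.+1)^-1 + 2 * (4 ^+ j)^-1) : R)%:E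
    <= (16 / 4 ^+ j : R)%:E)%E.
  by rewrite lee_fin exprS invfM; have := e4 j; lra.
have /choice[L LP] : forall k, exists L : R -> R, measurable_fun setT L /\
    forall m, (\int[mu]_x ((L x - g m x 0 k) ^+ 2)%:E <= (4 * 16 / 2 ^+ m)%:E)%E.
  move=> k; apply: riesz_fischer => // [j|j]; first exact: mg.
  apply: le_trans (gg j).
  have -> : (\int[mu]_x ((g j.+1 x 0 k - g j x 0 k) ^+ 2)%:E =
      \int[mu]_x (((g j.+1 \- g j)%R x 0%R k) ^+ 2)%:E)%E.
    by apply: eq_integral => x _; rewrite coordB.
  exact: energy_coord (mquatB (mg _) (mg _)).
pose G t : quat R := \row_k L k t.
have GE t k : G t 0 k = L k t by rewrite mxE.
have mG : mquat G by move=> k; under eq_fun do rewrite GE; exact: (LP k).1.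
have gG m : (energy (g m \- G)%R <= (256 / 2 ^+ m)%:E)%E.
  rewrite energy_sum; last exact: mquatB.
  apply: (@le_trans _ _ (\sum_(k < 4) (64 / 2 ^+ m)%:E)%E).
    apply: lee_sum => k _; have [_ /(_ m)] := LP k.
    rewrite (_ : 4 * 16 = 64); last by ring.
    apply: le_trans; apply: eq_ler.
    by apply: eq_integral => x _; rewrite coordB GE -(opprB (g m x 0 k)) sqrrN.
  rewrite sumEFin lee_fin big_const_ord iter_addr_0 -mulr_natr.
  by apply: eq_ler; ring.
exists G; split.
  apply/inLp2P; split => //.
  have h := energyB (mg 0%N) (mquatB (mg 0%N) mG).
  rewrite (_ : (g 0%N \- (g 0%N \- G))%R = G) in h; last first.
    by apply/funext => x /=; rewrite opprB addrC subrK.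
  apply: le_lt_trans h _.
  have e0 : (energy (g 0%N) < +oo)%E.
    apply: le_lt_trans (fourier1_energy uI (f1 0%N) (mf 0%N)) _.
    by have /inLp2P[_ ?] := damp_inLp2 (phi 0%N) F2; rewrite lte_mul_pinfty.
  apply: lte_add_pinfty; apply: lte_mul_pinfty => //.
  exact: le_lt_trans (gG 0%N) (ltry _).
exists f; split.
- by move=> n; split; [exact: f1|exact: damp_inLp2].
- apply/cvg_qLnorm2 => e e0.
  have c : (4 ^+ j)^-1 @[j --> \oo] --> (0 : R).
    by under eq_fun do rewrite -exprVn; apply: cvg_expr; rewrite ger0_norm// invf_lt1// ltr1n.
  move/cvgrPdist_le : c => /(_ _ e0); apply: filterS => j.
  rewrite sub0r normrN ger0_norm ?(ltW (e4 j))// => h.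
  by apply: le_trans (phiP j) _; rewrite lee_fin.
- apply/cvg_qLnorm2 => e e0.
  have := @cvg_geometric R 256 2^-1; rewrite ger0_norm// invf_lt1// ltr1n.
  move=> /(_ isT)/cvgrPdist_le /(_ _ e0); apply: filterS => j /=.
  rewrite sub0r normrN ger0_norm; last by rewrite mulr_ge0// exprn_ge0.
  by move=> h; apply: le_trans (gG j) _; rewrite lee_fin -exprVn.
Qed.

Lemma fourierP I F : unit_sphere I -> inLp 2 F -> is_fourier2 I F (fourier I F).
Proof. by move=> uI F2; apply: xgetPex; exact: fourier2_exists. Qed.

(** A transform defined by one approximating sequence is approached along any
    other one: H is compared with a term of the sequence of the definition
    that is as close to F as desired. *)
Lemma fourier2_approx I F G H : unit_sphere I -> inLp 2 F ->
  is_fourier2 I F G -> inLp 1 H -> mquat H ->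
  (energy (fourier1 I H \- G)%R <= 16%:E * energy (H \- F)%R)%E.
Proof.
move=> uI F2 [G2 [f [f12 fF fG]]] H1 mH; have /inLp2P[mF _] := F2.
have /inLp2P[mG _] := G2.
apply/lee_addgt0Pr => e e0; have e18 : 0 < e / 18 by rewrite divr_gt0.
move/cvg_qLnorm2 : fF => /(_ _ e18) fF; move/cvg_qLnorm2 : fG => /(_ _ e18) fG.
have [n _ /(_ n (leqnn n)) [nF nG]] := filterI fF fG.
have [n1 n2] := f12 n; have /inLp2P[mn _] := n2.
have Hn1 : inLp 1 (H \- f n).
  have /inLp1P[_ iH] := H1; have /inLp1P[_ i_n] := n1.
  apply/inLp1P; split => [|k]; first exact: mquatB.
  by under eq_fun do rewrite coordB; exact: integrable_sub.
have mH' := mquat_fourier1 uI H1; have mn' := mquat_fourier1 uI n1.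
apply: le_trans (energy_triangle mH' mG mn') _.
rewrite -fourier1B//.
have h1 := fourier1_energy uI Hn1 (mquatB mH mn).
have h2 := energy_triangle mH mn mF.
rewrite -(energyN (F \- f n)) in h2.
rewrite (_ : (\- (F \- f n))%R = (f n \- F)%R) in h2; last first.
  by apply/funext => x /=; rewrite opprB.
have two : (0 <= 2%:E :> \bar R)%E by rewrite lee_fin.
have four : (0 <= 4%:E :> \bar R)%E by rewrite lee_fin.
apply: (@le_trans _ _ (2%:E * (4%:E * (2%:E * energy (H \- F)%R +
    2%:E * (e / 18)%:E)) + 2%:E * (e / 18)%:E)%E).
  apply: leeD; apply: lee_wpmul2l => //.
  apply: le_trans h1 _; apply: lee_wpmul2l => //.
  by apply: le_trans h2 _; apply: leeD => //; apply: lee_wpmul2l.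
have := energy_ge0 (H \- F)%R; case: (energy _) => [r| |] //= _.
- change ((2 * (4 * (2 * r + 2 * (e / 18))) + 2 * (e / 18))%:E
    <= (16 * r + e)%:E)%E.
  by rewrite lee_fin; lra.
- by rewrite !gt0_muley ?lte_fin//= leey.
Qed.

Lemma fourier2_energy I F G : unit_sphere I -> inLp 2 F ->
  is_fourier2 I F G -> (energy G <= 8%:E * energy F)%E.
Proof.
move=> uI F2 FG; have /inLp2P[mF eF] := F2.
have /inLp2P[mG _] := FG.1.
apply/lee_addgt0Pr => e e0; have e8 : 0 < e / 100 by rewrite divr_gt0.
have [n _ /(_ n (leqnn n)) h0] := damp_cvg F2 e8.
have D1 := damp_inLp1 n F2; have mD := mquat_damp n mF.
have mfD := mquat_fourier1 uI D1.
have h1 := fourier2_approx uI F2 FG D1 mD.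
have h2 := fourier1_energy uI D1 mD.
have h3 := energyB mfD (mquatB mfD mG).
rewrite (_ : (fourier1 I (damp n F) \- (fourier1 I (damp n F) \- G))%R = G)
  in h3; last by apply/funext => x /=; rewrite opprB addrC subrK.
have h4 : (energy (damp n F) <= energy F)%E.
  apply: ge0_integral_le.
  - exact: mquat_sqn.
  - exact: mquat_sqn.
  - by move=> x; exact: sqn_ge0.
  move=> x; apply: ler_sum => k _; rewrite /damp coordZ exprMn.
  rewrite ler_piMl ?sqr_ge0// expr_le1 ?gauss_weight_ge0//.
  exact: gauss_weight_le1.
have two : (0 <= 2%:E :> \bar R)%E by rewrite lee_fin.
have four : (0 <= 4%:E :> \bar R)%E by rewrite lee_fin.
have sixteen : (0 <= 16%:E :> \bar R)%E by rewrite lee_fin.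
apply: (@le_trans _ _ (2%:E * (4%:E * energy F) + 2%:E * (16%:E * (e / 100)%:E))%E).
  apply: le_trans h3 _; apply: leeD; apply: lee_wpmul2l => //.
    by apply: le_trans h2 _; exact: lee_wpmul2l.
  by apply: le_trans h1 _; exact: lee_wpmul2l.
have := energy_ge0 F; case: (energy F) => [r| |] //= r0.
- change ((2 * (4 * r) + 2 * (16 * (e / 100)))%:E <= (8 * r + e)%:E)%E.
  by rewrite lee_fin; lra.
- by rewrite !gt0_muley ?lte_fin//= leey.
Qed.

End fourier_L2.

(** * Inversion by Poisson means *)

Section inversion.
Variable R : realType.
Local Notation mu := (@lebesgue_measure R).
Implicit Types (F G H : R -> quat R) (I q : quat R) (x t : R) (k : 'I_4).

Local Notation kappa := ((Num.sqrt (2 * pi))^-1 : R).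

Lemma Rintegral_odd0 (f : R -> R) : continuous f -> (forall x, f (- x) = - f x) ->
  mu.-integrable setT (EFin \o f) -> \int[mu]_x f x = 0.
Proof.
move=> cf fN if_; have c1 := Rintegral_segment_cvg if_.
rewrite -(cvg_lim _ c1)//; apply/cvg_lim => //.
rewrite (_ : (fun n : nat => _) = cst 0); first exact: cvg_cst.
apply/funext => n; have n0 : - n%:R <= n%:R :> R.
  by apply: le_trans (_ : 0 <= _); rewrite ?oppr_le0.
rewrite /cst; set J := Rintegral _ _ _; suff : J = - J by move=> ?; lra.
have -> : - J = \int[mu]_(x in `[- n%:R, n%:R]) (-1 * f x).
  by rewrite RintegralZl ?mulN1r//; exact: continuous_integrable_segment.
rewrite /J /Rintegral; congr fine.
have := @integration_by_substitution_oppr R f (- n%:R) n%:R n0.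
rewrite opprK => -> //; last exact: continuous_subspaceT.
by apply: eq_integral => x _; rewrite /= fN mulN1r.
Qed.

Lemma integrable_mul_bounded (h T : R -> R) M : mu.-integrable setT (EFin \o h) ->
  continuous T -> (forall x, `|T x| <= M) ->
  mu.-integrable setT (EFin \o (fun x => h x * T x)).
Proof.
move=> ih cT TM; have ih' := integrable_scale M measurableT (integrable_norm ih).
apply: (integrable_dominated measurableT _ ih') => [|x _].
  apply: measurable_funM; last exact: continuous_measurable_fun.
  by case/integrableP : ih => /measurable_EFinP.
by rewrite normrM mulrC ler_wpM2r.
Qed.

Lemma integrable_mul2 (phi d : R -> R) :
  measurable_fun setT phi -> measurable_fun setT d ->
  mu.-integrable setT (EFin \o (fun x => phi x ^+ 2)) ->
  mu.-integrable setT (EFin \o (fun x => d x ^+ 2)) ->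
  mu.-integrable setT (EFin \o (fun x => phi x * d x)).
Proof.
move=> mphi md iphi id2.
apply: (@integrable_dominated _ _ _ (fun x => phi x ^+ 2 + d x ^+ 2)) => //.
- exact: measurable_funM.
- exact: integrable_add.
move=> x _; rewrite normrM -(real_normK (num_real (phi x))).
rewrite -(real_normK (num_real (d x))).
by move: `|phi x| `|d x| (normr_ge0 (phi x)) (normr_ge0 (d x)) => p q *; nra.
Qed.

(** The arithmetic-geometric inequality with a weight del, chosen small enough
    for the fixed function phi, stands in for the Cauchy-Schwarz inequality.
    *)
Lemma sqr_pairing_cvg0 (phi : R -> R) (d : nat -> R -> R) :
  measurable_fun setT phi ->
  mu.-integrable setT (EFin \o (fun x => phi x ^+ 2)) ->
  (forall n, measurable_fun setT (d n)) ->
  (forall e, 0 < e ->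
    \forall n \near \oo, (\int[mu]_x (d n x ^+ 2)%:E <= e%:E)%E) ->
  \int[mu]_x (phi x * d n x) @[n --> \oo] --> (0 : R).
Proof.
move=> mphi iphi md d0; apply/cvgrPdist_le => e e0.
set P := \int[mu]_x (phi x ^+ 2).
have P0 : 0 <= P by apply: Rintegral_ge0 => x _; exact: sqr_ge0.
(* With this del each of the two terms of amgm below contributes at most e /
   2. *)
pose del := e / (P + 1).
have P1 : 0 < P + 1 by lra.
have del0 : 0 < del by rewrite divr_gt0.
have ed : 0 < e * del by rewrite mulr_gt0.
apply: filterS (d0 _ ed) => n hn; rewrite sub0r normrN.
have id2 : mu.-integrable setT (EFin \o (fun x => d n x ^+ 2)).
  apply/integrableP; split.
    by apply/measurable_EFinP; apply: measurable_funX; exact: md.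
  apply: le_lt_trans (ltry (e * del)); apply: le_trans hn.
  apply: eq_ler; apply: eq_integral => x _.
  by rewrite /= ger0_norm// sqr_ge0.
have amgm x : `|phi x * d n x| <= del / 2 * phi x ^+ 2 + (2 * del)^-1 * d n x ^+ 2.
  rewrite normrM -(real_normK (num_real (phi x))) -(real_normK (num_real (d n x))).
  rewrite -subr_ge0 (_ : _ - _ = (del * `|phi x| - `|d n x|) ^+ 2 / (2 * del)).
    by apply: divr_ge0; [exact: sqr_ge0|apply: mulr_ge0 => //; exact: ltW].
  by field; rewrite gt_eqF.
have i1 := integrable_scale (del / 2) measurableT iphi.
have i2 := integrable_scale ((2 * del)^-1) measurableT id2.
have i12 := integrable_add measurableT i1 i2.
have ipd : mu.-integrable setT (EFin \o (fun x => phi x * d n x)).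
  apply: (integrable_dominated measurableT _ i12) => //.
  exact: measurable_funM.
apply: le_trans (le_normr_Rintegral measurableT ipd) _.
apply: le_trans (le_Rintegral measurableT (integrable_norm ipd) i12 _) _.
  by move=> x _; exact: amgm.
rewrite RintegralD// !RintegralZl// -/P.
have D1 : \int[mu]_x (d n x ^+ 2) <= e * del.
  rewrite -lee_fin /Rintegral fineK//; exact: (integrable_fin_num _ id2).
have -> : e = del / 2 * (P + 1) + (2 * del)^-1 * (e * del).
  have dP : e = del * (P + 1) by rewrite /del divfK// gt_eqF.
  have dV : (2 * del)^-1 * (e * del) = e / 2 by field; rewrite gt_eqF.
  by rewrite dV mulrAC -dP -mulrDr; field.
apply: lerD; first by apply: ler_wpM2l; [exact: divr_ge0 (ltW _) _|lra].
by apply: ler_wpM2l => //; rewrite invr_ge0 mulr_ge0// ltW.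
Qed.

Lemma sqr_pairing_cvg (phi : R -> R) (d_ : nat -> R -> R) (d : R -> R) :
  measurable_fun setT phi ->
  mu.-integrable setT (EFin \o (fun x => phi x ^+ 2)) ->
  (forall n, measurable_fun setT (d_ n)) -> measurable_fun setT d ->
  (forall n, mu.-integrable setT (EFin \o (fun x => d_ n x ^+ 2))) ->
  mu.-integrable setT (EFin \o (fun x => d x ^+ 2)) ->
  (forall e, 0 < e ->
    \forall n \near \oo, (\int[mu]_x ((d_ n x - d x) ^+ 2)%:E <= e%:E)%E) ->
  \int[mu]_x (phi x * d_ n x) @[n --> \oo] --> \int[mu]_x (phi x * d x).
Proof.
move=> mphi iphi md_ md id_ id2 dd.
have md0 n : measurable_fun setT (fun x => d_ n x - d x) by exact: measurable_funB.
have c0 := sqr_pairing_cvg0 mphi iphi md0 dd.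
rewrite (_ : (fun n => \int[mu]_x (phi x * d_ n x)) =
  (fun n => \int[mu]_x (phi x * (d_ n x - d x)) + \int[mu]_x (phi x * d x))).
  by rewrite -[X in _ --> X]add0r; apply: cvgD; [exact: c0|exact: cvg_cst].
apply/funext => n.
under [X in _ = X + _]eq_Rintegral do rewrite mulrBr.
rewrite RintegralB ?subrK//; exact: integrable_mul2.
Qed.

Lemma integrable_poisson (eta : R) x : 0 < eta ->
  mu.-integrable setT (EFin \o (fun u => poisson eta (x - u))).
Proof.
move=> eta0; apply/integrableP; split.
  by apply/measurable_EFinP; apply: continuous_measurable_fun; exact: continuous_poisson.
under eq_integral do rewrite /= ger0_norm ?poisson_ge0//.
by rewrite poisson_integral// ltry.
Qed.

Lemma Rintegral_poisson (eta : R) x : 0 < eta ->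
  \int[mu]_u poisson eta (x - u) = 2 * pi.
Proof. by move=> eta0; rewrite /Rintegral poisson_integral. Qed.

Lemma poisson_le (eta s : R) : 0 < eta -> poisson eta s <= 2 / eta.
Proof.
move=> eta0; rewrite /poisson ler_pdivrMr ?poisson_denom_gt0//.
rewrite (_ : 2 / eta * _ = 2 * eta + 2 / eta * s ^+ 2); last first.
  by field; rewrite gt_eqF.
by rewrite lerDl mulr_ge0 ?sqr_ge0// divr_ge0// ltW.
Qed.

Section approximation.
Variables (f : R -> R) (x : R).
Hypotheses (cf : continuous f)
  (if2 : mu.-integrable setT (EFin \o (fun u => f u ^+ 2))).

Let mf : measurable_fun setT f. Proof. exact: continuous_measurable_fun. Qed.

Lemma integrable_poisson_mul (eta : R) : 0 < eta ->
  mu.-integrable setT (EFin \o (fun u => poisson eta (x - u) * f u)).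
Proof.
move=> eta0.
apply: (@integrable_dominated _ _ _
  (fun u => poisson eta (x - u) + 2 / eta * f u ^+ 2)) => //.
- apply: measurable_funM => //.
  by apply: continuous_measurable_fun; exact: continuous_poisson.
- by apply: integrable_add => //; [exact: integrable_poisson|exact: integrable_scale].
move=> u _; rewrite normrM (ger0_norm (poisson_ge0 _ eta0)).
have p0 := poisson_ge0 (x - u) eta0; have p1 := poisson_le (x - u) eta0.
apply: le_trans (ler_wpM2l p0 (norm_le_1Dsqr (f u))) _; rewrite mulrDr mulr1 lerD2l.
by rewrite ler_wpM2r ?sqr_ge0.
Qed.

(** Near x, f is within del of f x. Away from x the kernel is at most a
    multiple of eta times the kernel of height 1, against which f and the
    constant f x are integrable. *)
Lemma poisson_approx_bound del : 0 < del -> exists C, forall eta, 0 < eta ->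
  `|\int[mu]_u (poisson eta (x - u) * f u) - 2 * pi * f x| <=
  2 * pi * del + eta * C.
Proof.
move=> del0.
have /cvgrPdist_le /(_ _ del0) /nbhs_ballP[r /= r0 fr] := @cf x.
(* At distance at least r from x the kernel of height eta is at most eta * c
   times the kernel Q of height 1. *)
pose c := 1 + r ^- 2.
have c0 : 0 <= c by rewrite addr_ge0// invr_ge0 exprn_ge0// ltW.
pose Q u := poisson 1 (x - u).
have Q0 u : 0 <= Q u by rewrite poisson_ge0.
have Q2 u : Q u <= 2 by have := @poisson_le 1 (x - u) ltr01; rewrite divr1.
pose B u := 2 * f u ^+ 2 + (1 + `|f x|) * Q u.
have iB : mu.-integrable setT (EFin \o B).
  apply: integrable_add => //; first exact: integrable_scale.
  by apply: integrable_scale => //; exact: integrable_poisson.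
have B0 u : 0 <= B u.
  by rewrite addr_ge0// mulr_ge0 ?sqr_ge0// addr_ge0.
exists (c * \int[mu]_u B u) => eta eta0.
have iP := integrable_poisson x eta0; have iPf := integrable_poisson_mul eta0.
have pt u : `|poisson eta (x - u) * f u - f x * poisson eta (x - u)| <=
    del * poisson eta (x - u) + eta * c * B u.
  have p0 := poisson_ge0 (x - u) eta0.
  rewrite (mulrC (f x)) -mulrBr normrM (ger0_norm p0) mulrC.
  have [ur|ur] := ltP `|x - u| r.
    apply: le_trans (_ : del * poisson eta (x - u) <= _).
      apply: ler_wpM2r => //; rewrite distrC; exact: fr.
    by rewrite lerDl !mulr_ge0// ltW.
  apply: le_trans (_ : eta * c * B u <= _); last by rewrite lerDr mulr_ge0// ltW.
  have s0 : 0 < (x - u) ^+ 2.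
    by rewrite -(real_normK (num_real _)) exprn_gt0// (lt_le_trans r0).
  have sr : r ^+ 2 <= (x - u) ^+ 2.
    by rewrite -(real_normK (num_real (x - u))) ler_sqr ?nnegrE// ltW.
  have pQ : poisson eta (x - u) <= eta * c * Q u.
    rewrite /Q /poisson expr1n mulr1; set s := (x - u) ^+ 2 in s0 sr *.
    have h1 : 0 < eta ^+ 2 + s by rewrite ltr_wpDl// sqr_ge0.
    have h2 : 0 < 1 + s by rewrite ltr_wpDl.
    rewrite mulrA ler_pdivlMr// mulrAC ler_pdivrMr//.
    have r20 : 0 < r ^+ 2 by rewrite exprn_gt0.
    have h3 : 1 <= s / r ^+ 2 by rewrite ler_pdivlMr// mul1r.
    have h4 : 1 + s <= c * (eta ^+ 2 + s).
      apply: le_trans (_ : c * s <= _); last first.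
        by rewrite ler_wpM2l// lerDr sqr_ge0.
      by rewrite /c mulrDl mul1r addrC lerD2l mulrC.
    rewrite (_ : eta * c * 2 * _ = 2 * eta * (c * (eta ^+ 2 + s))); last by ring.
    by rewrite ler_wpM2l// mulr_ge0// ltW.
  apply: le_trans (ler_wpM2l (normr_ge0 _) pQ) _.
  rewrite mulrCA; apply: ler_wpM2l; first by rewrite mulr_ge0// ltW.
  have h : `|f u - f x| <= f u ^+ 2 + (1 + `|f x|).
    apply: le_trans (ler_normB _ _) _; rewrite addrA lerD2r.
    rewrite -(real_normK (num_real (f u))); have := normr_ge0 (f u); nra.
  apply: le_trans (ler_wpM2r (Q0 u) h) _.
  rewrite /B mulrDl lerD2r mulrC; apply: ler_wpM2r => //; exact: sqr_ge0.
have -> : 2 * pi * f x = \int[mu]_u (f x * poisson eta (x - u)).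
  by rewrite RintegralZl// Rintegral_poisson// mulrC.
have ifP : mu.-integrable setT (EFin \o (fun u => f x * poisson eta (x - u))).
  exact: integrable_scale.
rewrite -RintegralB//.
have iD := integrable_sub measurableT iPf ifP.
apply: le_trans (le_normr_Rintegral measurableT iD) _.
have iR : mu.-integrable setT (EFin \o (fun u =>
    del * poisson eta (x - u) + eta * c * B u)).
  by apply: integrable_add => //; exact: integrable_scale.
apply: le_trans (le_Rintegral measurableT (integrable_norm iD) iR _) _.
  by move=> u _; exact: pt.
rewrite RintegralD//; last 2 first.
- exact: integrable_scale.
- exact: integrable_scale.
rewrite (RintegralZl del measurableT iP) (RintegralZl (eta * c) measurableT iB).
rewrite Rintegral_poisson//.
by apply: eq_ler; ring.
Qed.

Lemma poisson_approx : \int[mu]_u (poisson (harmonic n) (x - u) * f u)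
  @[n --> \oo] --> 2 * pi * f x.
Proof.
apply/cvgrPdist_le => e e0.
have p0 := pi_gt0 R.
have d0 : 0 < e / (4 * pi) by rewrite divr_gt0// mulr_gt0.
have [C HC] := poisson_approx_bound d0.
have e2 : 0 < e / 2 by rewrite divr_gt0.
have C0 : (fun n => harmonic n * C) n @[n --> \oo] --> (0 : R).
  by rewrite -[X in _ --> X](mul0r C); apply: cvgM; [exact: cvg_harmonic|exact: cvg_cst].
move/cvgrPdist_le : C0 => /(_ _ e2); apply: filterS => n.
rewrite sub0r normrN => /(le_trans (ler_norm _)) h.
rewrite distrC; apply: le_trans (HC _ _) _; first by rewrite /harmonic/= invr_gt0.
have -> : 2 * pi * (e / (4 * pi)) = e / 2.
  by move: (pi : R) p0 => p p0; field; rewrite gt_eqF.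
lra.
Qed.

End approximation.

(** Used for the coordinates of I q, which are combinations of those of q. *)
Lemma Rintegral_lincomb (D : set R) (J : Type) (r : seq J) (a : J -> R)
    (h : J -> R -> R) : measurable (D : set (measurableTypeR R)) ->
  (forall i, mu.-integrable D (EFin \o h i)) ->
  mu.-integrable D (EFin \o (fun x => \sum_(i <- r) a i * h i x)) /\
  \int[mu]_(x in D) (\sum_(i <- r) a i * h i x) =
  \sum_(i <- r) a i * \int[mu]_(x in D) h i x.
Proof.
move=> mD ih; elim: r => [|i r [IH1 IH2]].
  rewrite big_nil (_ : (fun x => _) = cst 0); last first.
    by apply/funext => x; rewrite big_nil.
  by split; [exact: integrable0|rewrite Rintegral_cst// mul0r].
rewrite big_cons (_ : (fun x => \sum_(j <- _) _) =
  (fun x => a i * h i x + \sum_(j <- r) a j * h j x)); last first.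
  by apply/funext => x; rewrite big_cons.
have ia := integrable_scale (a i) mD (ih i).
split; first exact: integrable_add.
by rewrite (RintegralD mD ia IH1) (RintegralZl _ mD (ih i)) IH2.
Qed.

Lemma I_fourier1 I F t k : unit_sphere I -> inLp 1 F ->
  (I * fourier1 I F t) 0 k = kappa *
    (trig_transform cos (fun x => (I * F x) 0 k) t +
     trig_transform sin (fun x => F x 0 k) t).
Proof.
move=> uI F1; have /inLp1P[mF iF] := F1; have /inLp1P[mIF iIF] := inLp1_mul I F1.
have [a Ia] := coord_mul_linear I k.
have lin c e (ce : trig_kernel c e) (H : R -> quat R) :
    (forall i, mu.-integrable setT (EFin \o (fun x => H x 0 i))) ->
    trig_transform c (fun x => (I * H x) 0 k) t =
    \sum_(i < 4) a i * trig_transform c (fun x => H x 0 i) t.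
  move=> iH; rewrite /trig_transform.
  have [_ <-] := @Rintegral_lincomb setT _ (index_enum 'I_4) a
    (fun i x => H x 0 i * c (x * t)) measurableT (fun i => integrable_trig ce t (iH i)).
  apply: eq_Rintegral => x _; rewrite Ia mulr_suml.
  by apply: eq_bigr => i _; rewrite mulrA.
have II q : I * (I * q) = - q.
  by rewrite mulrA -expr2 uI mulN1r.
have -> : trig_transform sin (fun x => F x 0 k) t =
    - trig_transform sin (fun x => (I * (I * F x)) 0 k) t.
  rewrite /trig_transform -mulN1r -RintegralZl//; last first.
    apply: (integrable_trig (trig_sin R)); under eq_fun do rewrite II coordN.
    by under eq_fun do rewrite -mulN1r; exact: integrable_scale.
  by apply: eq_Rintegral => x _; rewrite II coordN; ring.
rewrite (lin _ _ (trig_cos R))// (lin _ _ (trig_sin R))//.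
rewrite Ia -sumrB mulr_sumr; apply: eq_bigr => i _.
by rewrite fourier1_coord//; ring.
Qed.

(** By Fubini both sides are integrals of H against a kernel. The products cos
    cos and sin sin give two combinations of Poisson kernels in x - u and x +
    u whose sum is the kernel in x - u; the mixed products are odd in t and
    contribute 0. *)
Lemma fourier1_poisson I H eta x k : unit_sphere I -> inLp 1 H -> 0 < eta ->
  \int[mu]_t (expR (- (eta * `|t|)) * (cos (x * t) * fourier1 I H t 0 k +
    sin (x * t) * (I * fourier1 I H t) 0 k)) =
  kappa * \int[mu]_u (poisson eta (x - u) * H u 0 k).
Proof.
move=> uI H1 eta0; have /inLp1P[mH iH] := H1.
have /inLp1P[mIH iIH] := inLp1_mul I H1.
pose w t := expR (- (eta * `|t|)).
have cw : continuous w by exact: continuous_exp_abs.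
have iw : mu.-integrable setT (EFin \o w) by exact: integrable_exp_abs.
have ctrig c e (ce : trig_kernel c e) y : continuous (fun t => c (y * t)).
  move=> t; have [cc _ _ _] := ce; apply: continuous_comp; last exact: cc.
  by apply: cvgM; [exact: cvg_cst|exact: cvg_id].
have iwc c e (ce : trig_kernel c e) y :
    mu.-integrable setT (EFin \o (fun t => w t * c (y * t))).
  under eq_fun do rewrite (mulrC y).
  exact: (integrable_trig ce).
have swap c e (ce : trig_kernel c e) c' e' (ce' : trig_kernel c' e') (h : R -> R) :
    mu.-integrable setT (EFin \o h) ->
    mu.-integrable setT (EFin \o (fun t => w t * c (x * t) * trig_transform c' h t)) /\
    \int[mu]_t (w t * c (x * t) * trig_transform c' h t) =
    \int[mu]_u (h u * \int[mu]_t (w t * c (x * t) * c' (u * t))).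
  move=> ih; split.
    have := integrable_mul_bounded (iwc _ _ ce x) (trig_transform_continuous ce' ih).
    by apply => t; exact: (trig_transform_bound ce' t ih).
  have [cc' c1' _ _] := ce'.
  rewrite /trig_transform (@Rintegral_swap _ (fun t => w t * c (x * t)) h
    (fun z => c' (z.2 * z.1)))//.
  - exact: iwc ce x.
  - apply: measurableT_comp; first exact: continuous_measurable_fun.
    exact: measurable_funM.
have [i1 e1] := swap _ _ (trig_cos R) _ _ (trig_cos R) _ (iH k).
have [i2 e2] := swap _ _ (trig_cos R) _ _ (trig_sin R) _ (iIH k).
have [i3 e3] := swap _ _ (trig_sin R) _ _ (trig_cos R) _ (iIH k).
have [i4 e4] := swap _ _ (trig_sin R) _ _ (trig_sin R) _ (iH k).
set C1 := trig_transform cos _ in i1 e1; set S2 := trig_transform sin _ in i2 e2.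
set C3 := trig_transform cos _ in i3 e3; set S4 := trig_transform sin _ in i4 e4.
transitivity (\int[mu]_t (kappa * ((w t * cos (x * t) * C1 t +
    w t * sin (x * t) * S4 t) + (w t * sin (x * t) * C3 t - w t * cos (x * t) * S2 t)))).
  apply: eq_Rintegral => t _.
  have -> : fourier1 I H t 0 k = kappa * (C1 t - S2 t) by exact: fourier1_coord.
  have -> : (I * fourier1 I H t) 0 k = kappa * (C3 t + S4 t) by exact: I_fourier1.
  by rewrite -/(w t); move: (w t) (C1 t) (S2 t) (C3 t) (S4 t) => *; ring.
have i14 := integrable_add measurableT i1 i4.
have i32 := integrable_sub measurableT i3 i2.
rewrite (RintegralZl kappa measurableT (integrable_add measurableT i14 i32)).
congr (_ * _).
rewrite (RintegralD measurableT i14 i32) (RintegralD measurableT i1 i4).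
rewrite (RintegralB measurableT i3 i2) e1 e2 e3 e4.
have odd u : \int[mu]_t (w t * sin (x * t) * cos (u * t)) =
             \int[mu]_t (w t * cos (x * t) * sin (u * t)).
  apply/eqP; rewrite -subr_eq0; apply/eqP.
  have ii c e (ce : trig_kernel c e) c' e' (ce' : trig_kernel c' e') :
      mu.-integrable setT (EFin \o (fun t => w t * c (x * t) * c' (u * t))).
    under eq_fun do rewrite (mulrC u).
    by apply: (integrable_trig ce'); exact: iwc ce x.
  have ia := ii _ _ (trig_sin R) _ _ (trig_cos R).
  have ib := ii _ _ (trig_cos R) _ _ (trig_sin R).
  rewrite -(RintegralB measurableT ia ib); apply: Rintegral_odd0.
  - move=> t; apply: cvgB; (apply: cvgM; [apply: cvgM; [exact: cw|]|]).
    + exact: ctrig (trig_sin R) x t.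
    + exact: ctrig (trig_cos R) u t.
    + exact: ctrig (trig_cos R) x t.
    + exact: ctrig (trig_sin R) u t.
  - by move=> t; rewrite /w normrN !mulrN !cosN !sinN; ring.
  - exact: (integrable_sub measurableT ia ib).
rewrite [X in _ + (_ - X)](_ : _ =
  \int[mu]_u ((I * H u) 0 k * \int[mu]_t (w t * sin (x * t) * cos (u * t)))); last first.
  by apply: eq_Rintegral => u _; rewrite odd.
rewrite (_ : forall p q : R, p + (q - q) = p); last by move=> p q; rewrite subrr addr0.
have kc u := kernel_transform (trig_cos R) x u eta0.
have ks u := kernel_transform (trig_sin R) x u eta0.
have iP c e (ce : trig_kernel c e) (h : R -> R) : mu.-integrable setT (EFin \o h) ->
    mu.-integrable setT (EFin \o
      (fun u => h u * \int[mu]_t (w t * c (x * t) * c (u * t)))).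
  move=> ih; pose W := \int[mu]_t `|w t * c (x * t)|.
  have b u := trig_transform_bound ce u (iwc _ _ ce x).
  have E : (fun u => \int[mu]_t (w t * c (x * t) * c (u * t))) =
      trig_transform c (fun t => w t * c (x * t)).
    by apply/funext => u; apply: eq_Rintegral => t _; rewrite (mulrC u).
  have := integrable_mul_bounded ih (trig_transform_continuous ce (iwc _ _ ce x)) b.
  by rewrite -E.
rewrite -(RintegralD measurableT (iP _ _ (trig_cos R) _ (iH k))
  (iP _ _ (trig_sin R) _ (iH k))).
by apply: eq_Rintegral => u _; rewrite kc ks; field.
Qed.

End inversion.

Section inversion_formula.
Variable R : realType.
Local Notation mu := (@lebesgue_measure R).
Local Notation kappa := ((Num.sqrt (2 * pi))^-1 : R).
Variables (I : quat R) (F G : R -> quat R) (k : 'I_4).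
Hypotheses (uI : unit_sphere I) (F2 : inLp 2 F) (FG : is_fourier2 I F G).

(** Both sides are continuous in quadratic mean, so the identity passes from
    the damped functions to F. *)
Lemma fourier2_poisson eta x : 0 < eta ->
  \int[mu]_t (expR (- (eta * `|t|)) * (cos (x * t) * G t 0 k +
    sin (x * t) * (I * G t) 0 k)) =
  kappa * \int[mu]_u (poisson eta (x - u) * F u 0 k).
Proof.
move=> eta0; have /inLp2P[mF eF] := F2; have G2 := FG.1.
have /inLp2P[mG eG] := G2.
pose w (t : R) : R := expR (- (eta * `|t|)).
have cw : continuous w by exact: continuous_exp_abs.
have iw : mu.-integrable setT (EFin \o w) by exact: integrable_exp_abs.
have sq_w (c : R -> R) : continuous c -> (forall s, `|c s| <= 1) ->
    measurable_fun setT (fun t => w t * c (x * t)) /\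
    mu.-integrable setT (EFin \o (fun t => (w t * c (x * t)) ^+ 2)).
  move=> cc c1.
  have m : measurable_fun setT (fun t => w t * c (x * t)).
    apply: measurable_funM; apply: continuous_measurable_fun => // t.
    apply: continuous_comp; last exact: cc.
    by apply: cvgM; [exact: cvg_cst|exact: cvg_id].
  split => //; apply: (integrable_dominated measurableT _ iw) => [|t _].
    exact: measurable_funX.
  have w0 : 0 <= w t by exact: expR_ge0.
  have w1 : w t <= 1 by rewrite /w -expR0 ler_expR oppr_le0 mulr_ge0// ltW.
  rewrite ger0_norm ?sqr_ge0// exprMn -(real_normK (num_real (c _))).
  move: (w t) w0 w1 `|c (x * t)| (c1 (x * t)) (normr_ge0 (c (x * t))).
  move=> p p0 p1 q q1 q0; apply: le_trans (_ : p ^+ 2 * 1 <= _).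
    by rewrite ler_wpM2l ?sqr_ge0// exprn_ile1.
  by rewrite mulr1 expr2 ler_piMl.
have [mc ic] := sq_w _ (@continuous_cos R) (let: And4 _ h _ _ := trig_cos R in h).
have [ms is_] := sq_w _ (@continuous_sin R) (let: And4 _ h _ _ := trig_sin R in h).
have D1 n := damp_inLp1 n F2; have D2 n := damp_inLp2 n F2.
have mD n := mquat_damp n mF.
have f2 n : inLp 2 (fourier1 I (damp n F)).
  apply/inLp2P; split; first exact: mquat_fourier1.
  apply: le_lt_trans (fourier1_energy uI (D1 n) (mD n)) _.
  by have /inLp2P[_ ?] := D2 n; rewrite lte_mul_pinfty.
have mf n : mquat (fourier1 I (damp n F)) by exact: mquat_fourier1.
have energy_small n e : (energy (damp n F \- F)%R <= (e / 16)%:E)%E ->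
    (energy (fourier1 I (damp n F) \- G)%R <= e%:E)%E.
  move=> h; apply: le_trans (fourier2_approx uI F2 FG (D1 n) (mD n)) _.
  apply: le_trans (lee_wpmul2l _ h) _; first by rewrite lee_fin.
  by rewrite -EFinM lee_fin mulrC divfK.
have cG : \int[mu]_t (w t * cos (x * t) * fourier1 I (damp n F) t 0 k)
    @[n --> \oo] --> \int[mu]_t (w t * cos (x * t) * G t 0 k).
  apply: sqr_pairing_cvg => // [n|n||e e0].
  - exact: mf.
  - exact: integrable_sqr_coord.
  - exact: integrable_sqr_coord.
  have e16 : 0 < e / 16 by rewrite divr_gt0.
  apply: filterS (damp_cvg F2 e16) => n /energy_small; apply: le_trans.
  under eq_integral do rewrite -coordB.
  exact: (@energy_coord _ (fourier1 I (damp n F) \- G) k (mquatB (mf n) mG)).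
have cIG : \int[mu]_t (w t * sin (x * t) * (I * fourier1 I (damp n F) t) 0 k)
    @[n --> \oo] --> \int[mu]_t (w t * sin (x * t) * (I * G t) 0 k).
  apply: sqr_pairing_cvg => // [n||n||e e0].
  - exact: mquat_mul (mf n) k.
  - exact: mquat_mul mG k.
  - exact: integrable_sqr_coord (inLp2_mul uI (f2 n)).
  - exact: integrable_sqr_coord (inLp2_mul uI G2).
  have e16 : 0 < e / 16 by rewrite divr_gt0.
  apply: filterS (damp_cvg F2 e16) => n /energy_small; apply: le_trans.
  under eq_integral do rewrite -coordB -mulrBr.
  rewrite -(energy_mul _ uI).
  apply: (@energy_coord _ (fun t => I * (fourier1 I (damp n F) \- G) t) k).
  exact: mquat_mul (mquatB (mf n) mG).
have cF : \int[mu]_u (poisson eta (x - u) * damp n F u 0 k)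
    @[n --> \oo] --> \int[mu]_u (poisson eta (x - u) * F u 0 k).
  have mP : measurable_fun setT (fun u : R => poisson eta (x - u)).
    by apply: continuous_measurable_fun; exact: continuous_poisson.
  apply: sqr_pairing_cvg => // [|n|n||e e0].
  - have i1 := integrable_scale (2 / eta) measurableT (integrable_poisson x eta0).
    apply: (integrable_dominated measurableT _ i1) => [|u _].
      exact: measurable_funX.
    rewrite ger0_norm ?sqr_ge0// expr2 ler_wpM2r ?poisson_ge0//.
    exact: poisson_le.
  - exact: mD.
  - exact: integrable_sqr_coord.
  - exact: integrable_sqr_coord.
  apply: filterS (damp_cvg F2 e0) => n; apply: le_trans.
  under eq_integral do rewrite -coordB.
  exact: (@energy_coord _ (damp n F \- F) k (mquatB (mD n) mF)).
have split_int (H : R -> quat R) : inLp 2 H ->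
    \int[mu]_t (w t * (cos (x * t) * H t 0 k + sin (x * t) * (I * H t) 0 k)) =
    \int[mu]_t (w t * cos (x * t) * H t 0 k) +
    \int[mu]_t (w t * sin (x * t) * (I * H t) 0 k).
  move=> H2; have /inLp2P[mH _] := H2.
  rewrite -RintegralD//; last 2 first.
  - by apply: integrable_mul2 => //; exact: integrable_sqr_coord.
  - apply: integrable_mul2 => //; first exact: mquat_mul mH k.
    exact: integrable_sqr_coord (inLp2_mul uI H2).
  by apply: eq_Rintegral => t _; rewrite mulrDr !mulrA.
rewrite -/w split_int//.
apply: (@cvg_unique _ _ _ _ _ _ (cvgD cG cIG)) => //.
rewrite (_ : _ + _ = fun n => kappa * \int[mu]_u (poisson eta (x - u) * damp n F u 0 k)).
  by apply: cvgM; [exact: cvg_cst|exact: cF].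
apply/funext => n; rewrite fctE -split_int//.
exact: fourier1_poisson uI (D1 n) eta0.
Qed.

(** The height eta tends to 0 in the preceding identity: dominated convergence
    applies to the left-hand side, G being integrable on a bounded interval,
    and continuity of F to the right-hand side. The factor 2 pi is absorbed by
    the two normalisations of the transform. *)
Lemma inversion_formula a x : 0 <= a ->
  continuous (fun u => F u 0 k) ->
  {ae mu, forall t, t \notin `[- a, a] -> G t = 0} ->
  F x 0 k = kappa * \int[mu]_(t in `[- a, a])
    (cos (x * t) * G t 0 k + sin (x * t) * (I * G t) 0 k).
Proof.
move=> a0 cF G0; have /inLp2P[mF eF] := F2; have G2 := FG.1.
have /inLp2P[mG eG] := G2.
pose h t := cos (x * t) * G t 0 k + sin (x * t) * (I * G t) 0 k.
have mcos : measurable_fun setT (fun t : R => cos (x * t)).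
  by apply: continuous_measurable_fun; exact: continuous_cos_mulr.
have msin : measurable_fun setT (fun t : R => sin (x * t)).
  by apply: continuous_measurable_fun; exact: continuous_sin_mulr.
have mIG := mquat_mul I mG.
have mh : measurable_fun setT h.
  apply: measurable_funD; apply: measurable_funM; [exact: mcos|exact: mG| |].
    exact: msin.
  exact: mIG.
have iIG2 : mu.-integrable setT (EFin \o (fun t => (I * G t) 0 k ^+ 2)).
  exact: integrable_sqr_coord (inLp2_mul uI G2).
pose b t := 2 + (G t 0 k ^+ 2 + (I * G t) 0 k ^+ 2).
have b0 t : 0 <= b t by rewrite !addr_ge0// sqr_ge0.
have hb t : `|h t| <= b t.
  rewrite /h mulrC (mulrC (sin _)); apply: le_trans (norm_cos_sin_le _ _ _) _.
  have := norm_le_1Dsqr (G t 0 k); have := norm_le_1Dsqr ((I * G t) 0 k).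
  by rewrite /b; lra.
have mI : measurable (`[- a, a] : set R) by [].
have ib : mu.-integrable `[- a, a] (EFin \o b).
  have i2 : mu.-integrable `[- a, a] (EFin \o (fun=> 2 : R)).
    exact: continuous_integrable_segment (fun t => cvg_cst _).
  apply: integrable_add => //; apply: integrable_add => //.
    by apply: integrableS (integrable_sqr_coord k G2) => //.
  by apply: integrableS iIG2 => //.
pose w (n : nat) (t : R) : R := expR (- (harmonic n * `|t|)).
have w01 n t : 0 <= w n t <= 1.
  rewrite expR_ge0/= -expR0 ler_expR oppr_le0 mulr_ge0// /harmonic/=.
  by rewrite invr_ge0.
have mw n : measurable_fun setT (w n).
  by apply: continuous_measurable_fun; exact: continuous_exp_abs.
have L : \int[mu]_(t in `[- a, a]) (w n t * h t) @[n --> \oo] -->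
    \int[mu]_(t in `[- a, a]) h t.
  apply: (@Rintegral_dominated_cvg _ _ _ _ b) => //.
  - by move=> n; apply: measurable_funTS; exact: measurable_funM.
  - exact: measurable_funTS.
  - apply: aeW => t _; rewrite -[X in _ --> X]mul1r.
    apply: cvgM; last exact: cvg_cst.
    rewrite /w -[X in _ --> X]expR0; apply: continuous_cvg.
      exact: continuous_expR.
    rewrite -[X in _ --> X]oppr0 -(mul0r `|t|).
    by apply: cvgN; apply: cvgM; [exact: cvg_harmonic|exact: cvg_cst].
  - move=> n t _; rewrite normrM; have /andP[w0 w1] := w01 n t.
    by rewrite ger0_norm//; apply: le_trans (hb t); rewrite ler_piMl.
have E n : \int[mu]_(t in `[- a, a]) (w n t * h t) = \int[mu]_t (w n t * h t).
  rewrite Rintegral_mkcond /Rintegral; congr fine.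
  apply: ae_eq_integral => //.
  - apply/measurable_EFinP; apply/(measurable_restrictT _ mI).
    by apply: measurable_funTS; exact: measurable_funM.
  - by apply/measurable_EFinP; apply: measurable_funM => //; exact: mw.
  apply: aeS G0 => t Gt _; rewrite patchE; case: ifPn => // tI; congr EFin.
  rewrite /h Gt ?mulr0; last by apply: contraNN tI; rewrite inE.
  by rewrite /GRing.zero/= ?mxE !(mulr0, addr0).
have Rr := @poisson_approx R (fun u => F u 0 k) x cF (integrable_sqr_coord k F2).
have LR : \int[mu]_(t in `[- a, a]) h t = kappa * (2 * pi * F x 0 k).
  apply: (@cvg_unique _ _ _ _ _ _ L) => //.
  rewrite (_ : (fun n => _) = fun n => kappa *
    \int[mu]_u (poisson (harmonic n) (x - u) * F u 0 k)).
    by apply: cvgM; [exact: cvg_cst|exact: Rr].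
  apply/funext => n; rewrite E; apply: fourier2_poisson.
  by rewrite /harmonic/= invr_gt0.
rewrite LR mulrA -expr2 kappa_sqr mulrA mulVf ?mul1r//.
by rewrite mulf_neq0// gt_eqF// pi_gt0.
Qed.

End inversion_formula.

(** * Holomorphy of band-limited integrals *)

Section band_integral.
Variable R : realType.
Local Notation mu := (@lebesgue_measure R).
Variable a : R.
Hypothesis a0 : 0 <= a.
Implicit Types (p q : R -> R) (x y t : R).

Local Notation D := `[- a, a]%classic.
Local Notation integrable f := (mu.-integrable D (EFin \o f)).

(** The real part of the integral of (p - i q) exp (i z t); its imaginary part
    has the same form, with - q and p in place of p and q. *)
Definition band_integral p q x y : R :=
  \int[mu]_(t in D) (expR (- (y * t)) * (p t * cos (x * t) + q t * sin (x * t))).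

Let mD : measurable (D : set (measurableTypeR R)). Proof. by []. Qed.

Let bandD t : D t -> `|t| <= a.
Proof. by rewrite /= in_itv/= ler_norml. Qed.

Let integrable_opp p : integrable p -> integrable (fun t => - p t).
Proof.
move=> ip; have := integrable_scale (-1) mD ip.
by rewrite (_ : (fun x => -1 * p x) = (fun t => - p t))//;
  apply/funext => t; rewrite mulN1r.
Qed.

Lemma integrable_band p (h : R -> R) : integrable p -> continuous h ->
  integrable (fun t => h t * p t).
Proof.
move=> ip ch; have [M M0 hM] := @continuous_bounded_segment R h (- a) a ch.
have i1 := integrable_scale M mD (integrable_norm ip).
apply: (integrable_dominated mD _ i1) => [|t Dt].
  apply: measurable_funM; last by case/integrableP : ip => /measurable_EFinP.
  by apply: measurable_funTS; exact: continuous_measurable_fun.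
by rewrite normrM ler_wpM2r// hM// -in_itv.
Qed.

Let cE (y : R) : continuous (fun t : R => expR (- (y * t))).
Proof. by under eq_fun do rewrite -mulNr; exact: continuous_expR_mulr. Qed.

Lemma integrable_band_integrand p q x y : integrable p -> integrable q ->
  integrable (fun t => expR (- (y * t)) * (p t * cos (x * t) + q t * sin (x * t))).
Proof.
move=> ip iq; apply: integrable_band => //; apply: integrable_add => //.
  rewrite (_ : (fun t => p t * _) = (fun t => cos (x * t) * p t)).
    by apply: integrable_band ip _; exact: continuous_cos_mulr.
  by apply/funext => t; rewrite mulrC.
rewrite (_ : (fun t => q t * _) = (fun t => sin (x * t) * q t)).
  by apply: integrable_band iq _; exact: continuous_sin_mulr.
by apply/funext => t; rewrite mulrC.
Qed.

Lemma band_integralN p q x y : integrable p -> integrable q ->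
  band_integral (fun t => - p t) (fun t => - q t) x y = - band_integral p q x y.
Proof.
move=> ip iq; rewrite -mulN1r /band_integral.
rewrite -(RintegralZl _ mD (integrable_band_integrand x y ip iq)).
by apply: eq_Rintegral => t _; ring.
Qed.

(** The first order expansion of exp (b + i c) at 0. *)
Lemma exp_cos_near e : 0 < e -> exists2 d, 0 < d & forall b c : R,
  `|b| < d -> `|c| < d ->
  `|expR b * cos c - 1 - b| <= e * (`|b| + `|c|) /\
  `|expR b * sin c - c| <= e * (`|b| + `|c|).
Proof.
move=> e0.
have dE := diff2_comp (is_derive_expR (0 : R)) (diff2_fst (0 : R) 0).
have dC := diff2_comp (is_derive_cos (0 : R)) (diff2_snd (0 : R) 0).
have dS := diff2_comp (is_derive_sin (0 : R)) (diff2_snd (0 : R) 0).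
have [d1 d10 h1] := diff2M dE dC e0; have [d2 d20 h2] := diff2M dE dS e0.
exists (Num.min d1 d2); first by rewrite lt_min d10.
move=> b c; rewrite !lt_min => /andP[b1 b2] /andP[c1 c2].
have := h1 b c; have := h2 b c; rewrite !subr0 => /(_ b2 c2) H2 /(_ b1 c1) H1.
move: H1 H2; rewrite expR0 cos0 sin0 => H1 H2; split.
  apply: le_trans H1; apply: eq_ler.
  by congr (`|_|); ring.
apply: le_trans H2; apply: eq_ler.
by congr (`|_|); ring.
Qed.

(** Passing from z to z' multiplies exp (i z t) by exp (i (z' - z) t), whose
    first order remainder is small uniformly in t, as t ranges over a bounded
    interval. *)
Lemma band_integral_diff2 p q x y : integrable p -> integrable q ->
  diff2 (band_integral p q) x y
    (band_integral (fun t => t * q t) (fun t => - (t * p t)) x y)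
    (- band_integral (fun t => t * p t) (fun t => t * q t) x y).
Proof.
move=> ip iq.
have cid : continuous (fun t : R => t) by move=> t; exact: cvg_id.
have itp := integrable_band ip cid; have itq := integrable_band iq cid.
have itp' : integrable (fun t => - (t * p t)).
  exact: integrable_opp.
have [M M0 yM] := @continuous_bounded_segment R _ (- a) a (@cE y).
pose B := \int[mu]_(t in D) (`|p t| + `|q t|).
have B0 : 0 <= B by apply: Rintegral_ge0 => t _; rewrite addr_ge0.
have K0 : 0 < 2 * (M + 1) * (a + 1) * (B + 1) by rewrite !mulr_gt0// ltr_wpDl.
move=> e e0; pose e' := e / (2 * (M + 1) * (a + 1) * (B + 1)).
have e'0 : 0 < e' by rewrite divr_gt0.
have [d d0 near] := exp_cos_near e'0.
have a1 : 0 < a + 1 by rewrite ltr_wpDl.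
exists (d / (a + 1)); first by rewrite divr_gt0.
move=> x' y' x1 y1; set S := `|x' - x| + `|y' - y|.
have S0 : 0 <= S by rewrite addr_ge0.
pose E t := expR (- ((y' - y) * t)) * cos ((x' - x) * t) - 1 + (y' - y) * t.
pose F t := expR (- ((y' - y) * t)) * sin ((x' - x) * t) - (x' - x) * t.
have EF t : D t -> `|E t| <= e' * ((a + 1) * S) /\ `|F t| <= e' * ((a + 1) * S).
  move=> Dt; have ta := bandD Dt.
  have h (r : R) : `|r| < d / (a + 1) -> `|r * t| < d.
    rewrite ltr_pdivlMr// normrM; apply: le_lt_trans.
    by apply: ler_wpM2l => //; lra.
  have := near (- ((y' - y) * t)) ((x' - x) * t); rewrite normrN.
  move=> /(_ (h _ y1) (h _ x1)); rewrite opprK.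
  have Sb : `|(y' - y) * t| + `|(x' - x) * t| <= (a + 1) * S.
    rewrite !normrM -mulrDl mulrC /S (addrC `|x' - x|).
    by apply: ler_wpM2r; [rewrite addr_ge0|lra].
  move=> [h1 h2]; split; [apply: le_trans h1 _|apply: le_trans h2 _];
    by apply: ler_wpM2l; rewrite ?(ltW e'0).
have pt t : expR (- (y' * t)) * (p t * cos (x' * t) + q t * sin (x' * t)) -
    expR (- (y * t)) * (p t * cos (x * t) + q t * sin (x * t)) -
    (x' - x) * (expR (- (y * t)) *
      (t * q t * cos (x * t) + (- (t * p t)) * sin (x * t))) +
    (y' - y) * (expR (- (y * t)) *
      (t * p t * cos (x * t) + t * q t * sin (x * t))) =
    expR (- (y * t)) * ((p t * cos (x * t) + q t * sin (x * t)) * E t +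
      (q t * cos (x * t) - p t * sin (x * t)) * F t).
  rewrite (_ : y' * t = (y' - y) * t + y * t); last by ring.
  rewrite (_ : x' * t = (x' - x) * t + x * t); last by ring.
  rewrite opprD expRD cosD sinD /E /F.
  by ring.
have i1 := integrable_band_integrand x' y' ip iq.
have i2 := integrable_band_integrand x y ip iq.
have i3 := integrable_scale (x' - x) mD (integrable_band_integrand x y itq itp').
have i4 := integrable_scale (y' - y) mD (integrable_band_integrand x y itp itq).
have i12 := integrable_sub mD i1 i2; have i123 := integrable_sub mD i12 i3.
have i1234 := integrable_add mD i123 i4.
rewrite /band_integral mulNr opprK.
rewrite mulrC (mulrC _ (y' - y)).
rewrite -(RintegralZl (x' - x) mD (integrable_band_integrand x y itq itp')).
rewrite -(RintegralZl (y' - y) mD (integrable_band_integrand x y itp itq)).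
rewrite -(RintegralB mD i1 i2) -(RintegralB mD i12 i3) -(RintegralD mD i123 i4).
apply: le_trans (le_normr_Rintegral mD i1234) _.
have ipq := integrable_add mD (integrable_norm ip) (integrable_norm iq).
have iR := integrable_scale (2 * M * (e' * ((a + 1) * S))) mD ipq.
apply: le_trans (le_Rintegral mD (integrable_norm i1234) iR _) _.
  move=> t Dt /=; rewrite pt normrM.
  have [hE hF] := EF t Dt.
  have y0 : `|expR (- (y * t))| <= M by apply: yM; move: Dt; rewrite /= in_itv.
  rewrite [leRHS](_ : _ = M * (2 * ((e' * ((a + 1) * S)) * (`|p t| + `|q t|))));
    last by ring.
  apply: ler_pM => //.
  apply: le_trans (ler_normD _ _) _; rewrite !normrM.
  have h1 := norm_cos_sin_le (p t) (q t) (x * t).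
  have h2 : `|q t * cos (x * t) - p t * sin (x * t)| <= `|p t| + `|q t|.
    by have := norm_cos_sin_le (q t) (- p t) (x * t); rewrite normrN mulNr (addrC `|q t|).
  rewrite [leRHS](_ : _ = (`|p t| + `|q t|) * (e' * ((a + 1) * S)) +
    (`|p t| + `|q t|) * (e' * ((a + 1) * S))); last by ring.
  by apply: lerD; exact: ler_pM.
rewrite (RintegralZl _ mD ipq) -/B.
rewrite (_ : _ * B = (2 * M * (a + 1) * B) * (e' * S)); last by ring.
apply: le_trans (_ : 2 * (M + 1) * (a + 1) * (B + 1) * (e' * S) <= _).
  apply: ler_wpM2r; first by rewrite mulr_ge0// ltW.
  apply: ler_pM => //; [by rewrite !mulr_ge0// ltW| |by rewrite lerDl].
  by apply: ler_wpM2r; [exact: ltW|apply: ler_wpM2l => //; rewrite lerDl].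
by rewrite mulrA /e' (mulrC _ (e / _)) divfK// gt_eqF.
Qed.

Lemma band_integral_hol p q : integrable p -> integrable q ->
  hol (band_integral p q) (band_integral (fun t => - q t) p).
Proof.
move=> ip iq x y.
have iq' : integrable (fun t => - q t).
  exact: integrable_opp.
exists (band_integral (fun t => t * q t) (fun t => - (t * p t)) x y).
exists (band_integral (fun t => t * p t) (fun t => t * q t) x y).
split; first exact: band_integral_diff2.
have h := band_integral_diff2 x y iq' ip.
apply: diff2_eq h _ _.
  by congr (band_integral _ _ x y); apply/funext => t; rewrite mulrN opprK.
rewrite -band_integralN.
- by congr (band_integral _ _ x y); apply/funext => t; rewrite mulrN opprK.
- by apply: integrable_band iq' _ => t; exact: cvg_id.
- by apply: integrable_band ip _ => t; exact: cvg_id.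
Qed.

End band_integral.

(** * Slice regularity and holomorphic pairs *)

Section slices.
Variable R : realType.
Implicit Types (I q : quat R) (f : quat R -> quat R) (x y : R) (k : 'I_4).

Lemma coord_le_norm q k : `|q 0 k| <= `|q|.
Proof.
rewrite [leRHS]mx_normrE.
exact: (le_bigmax 0 (fun ij : 'I_1 * 'I_4 => `|q ij.1 ij.2|) (0, k)).
Qed.

Lemma slice_increment I x y x' y' :
  slice I x' y' - slice I x y = (x' - x) *: 1 + (y' - y) *: I.
Proof.
rewrite /slice -!scalerAr !mulr1 !scalerBl opprD addrACA.
by rewrite -!scaleNr.
Qed.

(** The sup norm of row vectors is the one that defines differentiability; it
    bounds each coordinate. *)
Lemma differentiable_slice f I x y : differentiable f (slice I x y) ->
  exists fx fy : quat R, forall e, 0 < e -> exists2 d, 0 < d &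
    forall x' y', `|x' - x| < d -> `|y' - y| < d ->
    `|f (slice I x' y') - f (slice I x y) - (x' - x) *: fx - (y' - y) *: fy|
      <= e * (`|x' - x| + `|y' - y|).
Proof.
move=> df; pose L := 'd f (slice I x y); exists (L 1), (L I) => e e0.
pose M := `|1 : quat R| + `|I| + 1.
have M0 : 0 < M by rewrite ltr_wpDl.
have eM : 0 < e / M by rewrite divr_gt0.
have /eqaddoP /(_ _ eM) /nbhs_ballP[d /= d0 Hd] := diff_locally df.
exists (d / M); first by rewrite divr_gt0.
move=> x' y' x1 y1; pose h := (x' - x) *: (1 : quat R) + (y' - y) *: I.
have hn : `|h| <= M * (`|x' - x| + `|y' - y|).
  apply: le_trans (ler_normD _ _) _; rewrite !normrZ /M.
  have := normr_ge0 (1 : quat R); have := normr_ge0 I.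
  have := normr_ge0 (x' - x); have := normr_ge0 (y' - y).
  move: `|x' - x| `|y' - y| `|I| `|1 : quat R| => *; nra.
have hM : `|h| < d.
  apply: le_lt_trans (ler_normD _ _) _; rewrite !normrZ.
  move: x1 y1; rewrite !ltr_pdivlMr// /M.
  have := normr_ge0 (1 : quat R); have := normr_ge0 I.
  have := normr_ge0 (x' - x); have := normr_ge0 (y' - y).
  move: `|x' - x| `|y' - y| `|I| `|1 : quat R| => *; nra.
have hb : ball (0 : quat R) d h by rewrite -ball_normE /= sub0r normrN.
have := Hd _ hb.
rewrite !fctE /= {1}/h -slice_increment subrK => Hh.
have -> : f (slice I x' y') - f (slice I x y) - (x' - x) *: L 1 - (y' - y) *: L I =
    f (slice I x' y') - (f (slice I x y) + L h).
  have -> : L h = (x' - x) *: L 1 + (y' - y) *: L I by rewrite /h linearD !linearZ.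
  have regroup (p q r s : quat R) : p - q - r - s = p - (q + (r + s)).
    by rewrite !opprD !addrA.
  exact: regroup.
apply: le_trans Hh _.
by apply: le_trans (ler_wpM2l (ltW eM) hn) _; rewrite mulrA divfK// gt_eqF.
Qed.

Lemma diff2_sum (J : Type) (r : seq J) (P : J -> R -> R -> R) (p q : J -> R) x y :
  (forall i, diff2 (P i) x y (p i) (q i)) ->
  diff2 (fun x y => \sum_(i <- r) P i x y) x y (\sum_(i <- r) p i) (\sum_(i <- r) q i).
Proof.
move=> dP; elim: r => [|i r IH].
  rewrite !big_nil.
  rewrite (_ : (fun x y => _) = (fun _ _ => 0)); first exact: diff2_cst.
  by apply/funext => ?; apply/funext => ?; rewrite big_nil.
rewrite !big_cons.
rewrite (_ : (fun x y => \sum_(j <- _) _) =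
  (fun x y => P i x y + \sum_(j <- r) P j x y)); first exact: diff2D.
by apply/funext => ?; apply/funext => ?; rewrite big_cons.
Qed.

(** The equation of regularity reads f_y = I f_x, so the k-th coordinate of f
    has the derivatives (f_x)_k and (I f_x)_k in x and y, and that of - I f
    the derivatives - (I f_x)_k and (f_x)_k. *)
Lemma slice_regular_hol f I k : left_slice_regular setT f -> unit_sphere I ->
  hol (fun x y => f (slice I x y) 0 k) (fun x y => - (I * f (slice I x y)) 0 k).
Proof.
move=> [_ df dbar0] uI x y.
have [fx [fy H]] := differentiable_slice (df (slice I x y) Logic.I).
have d2 i : diff2 (fun x y => f (slice I x y) 0 i) x y (fx 0 i) (fy 0 i).
  move=> e e0; have [d d0 Hd] := H e e0; exists d => // x' y' x1 y1.
  apply: le_trans (Hd _ _ x1 y1); apply: le_trans (coord_le_norm _ i).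
  by rewrite !coordB !coordZ (mulrC (fx 0 i)) (mulrC (fy 0 i)).
have derX : derive1 (fun s => f (slice I s y)) x = fx.
  apply: cvg_lim => //; apply/cvgrPdist_le => e e0.
  have [d d0 Hd] := H e e0; near=> h.
  have h0 : h != 0 by near: h; exact: nbhs_dnbhs_neq.
  have := Hd (h + x) y; rewrite addrK subrr normr0 scale0r addr0 subr0.
  have hd : `|h| < d by near: h; apply: dnbhs0_lt.
  move=> /(_ hd d0) hh; rewrite distrC.
  rewrite (_ : _ - fx = h^-1 *: (f (slice I (h + x) y) - f (slice I x y) - h *: fx)).
    by rewrite normrZ normfV mulrC ler_pdivrMr ?normr_gt0.
  by rewrite [RHS]scalerBr scalerA mulVf// scale1r.
have derY : derive1 (fun s => f (slice I x s)) y = fy.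
  apply: cvg_lim => //; apply/cvgrPdist_le => e e0.
  have [d d0 Hd] := H e e0; near=> h.
  have h0 : h != 0 by near: h; exact: nbhs_dnbhs_neq.
  have := Hd x (h + y); rewrite addrK subrr normr0 scale0r add0r subr0.
  have hd : `|h| < d by near: h; apply: dnbhs0_lt.
  move=> /(_ d0 hd) hh; rewrite distrC.
  rewrite (_ : _ - fy = h^-1 *: (f (slice I x (h + y)) - f (slice I x y) - h *: fy)).
    by rewrite normrZ normfV mulrC ler_pdivrMr ?normr_gt0.
  by rewrite [RHS]scalerBr scalerA mulVf// scale1r.
have CR : fy = I * fx.
  have := dbar0 I x y uI Logic.I; rewrite /dbar derX derY => /eqP.
  rewrite scaler_eq0 invr_eq0 pnatr_eq0/= => /eqP h.
  have := congr1 (fun z => I * z) h; rewrite mulrDr mulr0 mulrA -expr2 uI mulN1r.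
  by move/eqP; rewrite subr_eq0 => /eqP.
have [a Ia] := coord_mul_linear I k.
have dv : diff2 (fun x y => - (I * f (slice I x y)) 0 k) x y
    (- (I * fx) 0 k) (- (I * fy) 0 k).
  rewrite (_ : (fun x y => _) =
    (fun x y => \sum_(i < 4) - a i * f (slice I x y) 0 i)); last first.
    apply/funext => ?; apply/funext => ?; rewrite Ia -sumrN.
    by apply: eq_bigr => i _; rewrite mulNr.
  rewrite !Ia -!sumrN.
  apply: diff2_eq (diff2_sum (index_enum 'I_4) (fun i => diff2Z (- a i) (d2 i))) _ _.
    by apply: eq_bigr => i _; rewrite mulNr.
  by apply: eq_bigr => i _; rewrite mulNr.
exists (fx 0 k), (- (I * fx) 0 k); split.
  by apply: diff2_eq (d2 k) _ _; rewrite // CR opprK.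
apply: diff2_eq dv _ _ => //.
by rewrite CR mulrA -expr2 uI mulN1r coordN opprK.
Unshelve. all: by end_near. Qed.

End slices.

(** * Reconstruction from a compactly supported transform *)

Section reconstruction.
Variable R : realType.
Local Notation mu := (@lebesgue_measure R).
Local Notation kappa := ((Num.sqrt (2 * pi))^-1 : R).
Implicit Types (f : quat R -> quat R) (F G : R -> quat R) (I q : quat R).
Implicit Types (a x y t : R) (k : 'I_4).

Lemma kappa_gt0 : 0 < kappa.
Proof. by rewrite invr_gt0 sqrtr_gt0 mulr_gt0// pi_gt0. Qed.

Lemma slice_real I x : slice I x 0 = x%:A.
Proof. by rewrite /slice scale0r mulr0 addr0. Qed.

Lemma unit_mulK I q : unit_sphere I -> I * (I * q) = - q.
Proof. by move=> uI; rewrite mulrA -expr2 uI mulN1r. Qed.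

Lemma integrable_coord_segment a G k : inLp 2 G ->
  mu.-integrable `[- a, a] (EFin \o (fun t => G t 0 k)).
Proof.
move=> G2; have /inLp2P[mG _] := G2.
have i1 : mu.-integrable `[- a, a] (EFin \o (fun=> 1 : R)).
  exact: continuous_integrable_segment (fun t => cvg_cst _).
have i2 : mu.-integrable `[- a, a] (EFin \o (fun t => G t 0 k ^+ 2)).
  by apply: integrableS (integrable_sqr_coord k G2) => //.
have mD : measurable (`[- a, a]%classic : set (measurableTypeR R)) by [].
apply: (integrable_dominated mD _ (integrable_add mD i1 i2)) => [|t _].
  by apply: measurable_funTS; exact: mG.
exact: norm_le_1Dsqr.
Qed.

Lemma holZ (u v : R -> R -> R) c : hol u v ->
  hol (fun x y => c * u x y) (fun x y => c * v x y).
Proof.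
move=> uv x y; have [p [q [du dv]]] := uv x y; exists (c * p), (c * q); split.
  by apply: diff2_eq (diff2Z c du) _ _; rewrite ?mulrN.
exact: diff2Z.
Qed.

(** Both sides are first components of holomorphic pairs, the second ones
    being the opposite of the coordinate of I f and the conjugate integral.
    The inversion formula makes the pairs agree on the real axis, for both
    components since it holds for all coordinates of f. *)
Lemma slice_formula f I G a x y k :
  left_slice_regular setT f -> inLp 2 (fun u : R => f u%:A) -> unit_sphere I ->
  is_fourier2 I (fun u : R => f u%:A) G -> 0 <= a ->
  {ae mu, forall t, t \notin `[- a, a] -> G t = 0} ->
  f (slice I x y) 0 k =
    kappa * band_integral a (fun t => G t 0 k) (fun t => (I * G t) 0 k) x y.
Proof.
move=> rf F2 uI FG a0 G0; have G2 := FG.1.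
have mD : measurable (`[- a, a]%classic : set (measurableTypeR R)) by [].
have ip i := integrable_coord_segment a i G2.
have iq i := integrable_coord_segment a i (inLp2_mul uI G2).
have hf i := slice_regular_hol i rf uI.
have real_axis i u : f u%:A 0 i =
    kappa * band_integral a (fun t => G t 0 i) (fun t => (I * G t) 0 i) u 0.
  rewrite (inversion_formula uI F2 FG u a0 _ G0); last first.
    have [_ + _ _] := hol_continuous (hf i) => /(_ 0).
    by under eq_fun do rewrite slice_real.
  congr (_ * _); apply: eq_Rintegral => t _.
  by rewrite mul0r oppr0 expR0 mul1r mulrC (mulrC (sin _)).
have hg := holZ kappa (band_integral_hol a0 (ip k) (iq k)).
have [] := hol_identity (holB (hf k) hg) _ _ x y.
- by move=> u; rewrite slice_real real_axis subrr.
- move=> u; rewrite slice_real.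
  have [b Ib] := coord_mul_linear I k.
  rewrite Ib (eq_bigr (fun i => kappa * (b i *
      band_integral a (fun t => G t 0 i) (fun t => (I * G t) 0 i) u 0))); last first.
    by move=> i _; rewrite real_axis mulrCA.
  rewrite -mulr_sumr -mulrN -mulrBr.
  have hi i := integrable_band_integrand u 0 (ip i) (iq i).
  have [_ <-] := Rintegral_lincomb (index_enum 'I_4) b mD hi.
  rewrite (_ : \int[mu]_(t in _) _ =
      - band_integral a (fun t => - (I * G t) 0 k) (fun t => G t 0 k) u 0).
    by rewrite opprK subrr mulr0.
  rewrite -band_integralN; last 2 first.
  - have := integrable_scale (-1) mD (iq k).
    rewrite (_ : (fun t => -1 * _) = (fun t => - (I * G t) 0 k))//.
    by apply/funext => t; rewrite mulN1r.
  - exact: ip.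
  apply: eq_Rintegral => t _.
  rewrite (eq_bigr (fun i => expR (- (0 * t)) *
    (cos (u * t) * (b i * G t 0 i) + sin (u * t) * (b i * (I * G t) 0 i)))); last first.
    by move=> i _; ring.
  rewrite -mulr_sumr big_split/= -!mulr_sumr -!Ib unit_mulK// coordN.
  by ring.
by move/eqP; rewrite subr_eq0 => /eqP.
Qed.

Lemma slice_formula_qintegral f I G a x y :
  left_slice_regular setT f -> inLp 2 (fun u : R => f u%:A) -> unit_sphere I ->
  is_fourier2 I (fun u : R => f u%:A) G -> 0 <= a ->
  {ae mu, forall t, t \notin `[- a, a] -> G t = 0} ->
  f (slice I x y) = kappa *:
    qintegral `[- a, a] (fun t : R => qexp (I * slice I x y * t%:A) * G t).
Proof.
move=> rf F2 uI FG a0 G0; apply: quat_ext => k.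
rewrite (slice_formula x y k rf F2 uI FG a0 G0) coordZ /qintegral mxE.
congr (_ * _); apply: eq_Rintegral => t _.
have -> : I * slice I x y * t%:A = slice I (- (y * t)) (x * t).
  rewrite /slice mulrDr mulrDl -!scalerAr !mulr1 -expr2 uI.
  rewrite !scalerA addrC scalerN scaleNr.
  by rewrite (mulrC t y) (mulrC t x).
rewrite qexp_slice// -scalerAl coordZ mulrDl coordD -!scalerAl mul1r !coordZ.
by ring.
Qed.

End reconstruction.

(** * Growth confines the transform to a bounded band *)

Section far_spectrum.
Variable R : realType.
Local Notation mu := (@lebesgue_measure R).
Local Notation kappa := ((Num.sqrt (2 * pi))^-1 : R).
Implicit Types (f : quat R -> quat R) (F G : R -> quat R) (I q : quat R).
Implicit Types (x y t : R) (k : 'I_4).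

Lemma sqn_slice I x y : unit_sphere I -> sqn (slice I x y) = x ^+ 2 + y ^+ 2.
Proof.
move=> uI; have [re _] := unit_sphereP uI; have := sqn_unit uI.
rewrite /slice -scalerAr mulr1 !sqn4 -/(qcoord _ _).
rewrite !(qcoordD, qcoordZ) /qone !qcoord_mkquat//=.
move: re; rewrite /qRe => ->.
move: (qcoord 1 I) (qcoord 2 I) (qcoord 3 I) => b c d h.
transitivity (x ^+ 2 + y ^+ 2 * (0 ^+ 2 + b ^+ 2 + c ^+ 2 + d ^+ 2)); first by ring.
by rewrite h mulr1.
Qed.

Lemma qnorm_slice_le I x y : unit_sphere I -> qnorm (slice I x y) <= `|x| + `|y|.
Proof.
move=> uI; rewrite -[leRHS]ger0_norm ?addr_ge0// -sqrtr_sqr.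
rewrite (_ : qnorm _ = Num.sqrt (sqn (slice I x y)))// sqn_slice//.
rewrite ler_wsqrtr// -(real_normK (num_real x)) -(real_normK (num_real y)).
by rewrite sqrrD addrAC lerDl mulrn_wge0// mulr_ge0.
Qed.

Lemma qnorm_unit_mul I q : unit_sphere I -> qnorm (I * q) = qnorm q.
Proof.
move=> uI; rewrite (_ : qnorm (I * q) = Num.sqrt (sqn (I * q)))//.
by rewrite sqn_mul sqn_unit// mul1r.
Qed.

Section growth.
Variables (f : quat R -> quat R) (A C : R) (I : quat R).
Hypotheses (rf : left_slice_regular setT f) (A_ge0 : 0 <= A) (uI : unit_sphere I)
  (F2 : inLp 2 (fun x : R => f x%:A))
  (fC : forall q, qnorm (f q) <= C * expR (A * qnorm q)).

Local Notation F := (fun x : R => f x%:A).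
Local Notation far_edge := (A + 1 + (A + 1) ^+ 2 / 2).

Let C0 : 0 <= C.
Proof.
by have := le_trans (qnorm_ge0 _) (fC 0); rewrite pmulr_lge0// expR_gt0.
Qed.

Let slice_bound x y : qnorm (f (slice I x y)) <= C * expR (A * (`|x| + `|y|)).
Proof.
apply: le_trans (fC _) _; apply: ler_wpM2l => //.
by rewrite ler_expR ler_wpM2l// qnorm_slice_le.
Qed.

(** For t < 0 the contour is shifted upwards instead: this is the case of - t
    for the reflected pair. *)
Lemma fourier1_damp_far n t k : far_edge <= `|t| ->
  `|fourier1 I (damp n F) t 0 k| <=
  kappa * (2 * C * expR (- n.+1%:R / 2) * \int[mu]_x expR (- `|x|)).
Proof.
move=> tA; have hf := slice_regular_hol k rf uI.
have b1 x y : `|f (slice I x y) 0 k| <= C * expR (A * (`|x| + `|y|)).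
  exact: le_trans (coord_le_qnorm _ _) (slice_bound x y).
have b2 x y : `|- (I * f (slice I x y)) 0 k| <= C * expR (A * (`|x| + `|y|)).
  rewrite normrN; apply: le_trans (coord_le_qnorm _ _) _.
  by rewrite qnorm_unit_mul// slice_bound.
have D1 := damp_inLp1 n F2; have /inLp1P[_ iD] := D1.
have /inLp1P[_ iID] := inLp1_mul I D1.
rewrite fourier1_coord// normrM (gtr0_norm (kappa_gt0 R)).
apply: ler_wpM2l; first exact: ltW (kappa_gt0 R).
rewrite /trig_transform -(RintegralB measurableT
  (integrable_trig (trig_cos R) t (iD k)) (integrable_trig (trig_sin R) t (iID k))).
have E x : damp n F x 0 k * cos (x * t) - (I * damp n F x) 0 k * sin (x * t) =
    expR (- x ^+ 2 / (2 * n.+1%:R)) * (f (slice I x 0) 0 k * cos (x * t) +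
      - (I * f (slice I x 0)) 0 k * sin (x * t)).
  by rewrite slice_real /damp /gauss_weight -scalerAr !coordZ; ring.
have [t0|t0] := leP 0 t.
  under eq_Rintegral do rewrite E.
  apply: gauss_shift hf A_ge0 C0 _ b1 b2 _ (@integrable_exp_norm R) => //.
  by rewrite -(ger0_norm t0).
have E' x : damp n F x 0 k * cos (x * t) - (I * damp n F x) 0 k * sin (x * t) =
    expR (- x ^+ 2 / (2 * n.+1%:R)) * (f (slice I x (- 0)) 0 k * cos (x * - t) +
      - - (I * f (slice I x (- 0))) 0 k * sin (x * - t)).
  by rewrite E oppr0 mulrN cosN sinN; ring.
under eq_Rintegral do rewrite E'.
apply: gauss_shift (hol_conj hf) A_ge0 C0 _ _ _ _ (@integrable_exp_norm R) => //.
- by move=> x y; rewrite -(normrN y).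
- by move=> x y; rewrite normrN -(normrN y).
- by rewrite -(ltr0_norm t0).
Qed.

(** The transforms of the damped functions tend to 0 uniformly beyond
    far_edge, and to G in quadratic mean. The weight exp (- |t|) makes the
    uniform estimate integrable. *)
Lemma growth_far G : is_fourier2 I F G ->
  {ae mu, forall t, t \notin `[- far_edge, far_edge] -> G t = 0}.
Proof.
move=> FG; have G2 := FG.1; have /inLp2P[mG eG] := G2.
have /inLp2P[mF eF] := F2.
pose far t : R := (far_edge < `|t|)%R%:R.
have far01 t : 0 <= far t <= 1 by rewrite /far; case: (_ < _); rewrite ?lexx ?ler01.
have mfar : measurable_fun setT far.
  by apply: measurable_ltr_nat => //; exact: measurableT_comp.
pose w t : R := far t * expR (- `|t|).
have w0 t : 0 <= w t by rewrite mulr_ge0// ?expR_ge0//; case/andP : (far01 t).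
have w1 t : w t <= 1.
  have /andP[f0 f1] := far01 t.
  by rewrite /w mulr_ile1// ?expR_ge0// -expR0 ler_expR oppr_le0.
have mw : measurable_fun setT w.
  apply: measurable_funM => //.
  by have /integrableP[/measurable_EFinP] := @integrable_exp_norm R.
pose K := kappa * (2 * C * \int[mu]_x expR (- `|x|)).
pose J := \int[mu]_x expR (- `|x|).
have J0 : 0 <= J by apply: Rintegral_ge0 => x _; exact: expR_ge0.
have JE : (\int[mu]_x (expR (- `|x|))%:E = J%:E)%E.
  by rewrite /J /Rintegral fineK//; exact: integrable_fin_num _ (@integrable_exp_norm R).
have small n t : w t * sqn (fourier1 I (damp n F) t) <=
    4 * K ^+ 2 * expR (- n.+1%:R) * expR (- `|t|).
  rewrite /w /far; have [tA|_] := ltP; last first.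
    by rewrite !mul0r !mulr_ge0// ?expR_ge0// sqr_ge0.
  rewrite mul1r mulrC; apply: ler_wpM2r; first exact: expR_ge0.
  have b k := fourier1_damp_far n k (ltW tA).
  have E : kappa * (2 * C * expR (- n.+1%:R / 2) * J) = K * expR (- n.+1%:R / 2).
    by rewrite /K -/J; ring.
  have E2 : expR (- n.+1%:R) = expR (- n.+1%:R / 2) ^+ 2 :> R.
    by rewrite expr2 -expRD; congr expR; field.
  rewrite E2 -mulrA -exprMn /sqn.
  apply: le_trans (_ : \sum_(k < 4) (K * expR (- n.+1%:R / 2)) ^+ 2 <= _); last first.
    by rewrite big_const_ord iter_addr_0 -[leLHS]mulr_natl.
  apply: ler_sum => k _; rewrite -(real_normK (num_real (fourier1 _ _ _ _ _))).
  rewrite -E; apply: lerXn2r; [by rewrite nnegrE| |exact: b].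
  by rewrite nnegrE; exact: le_trans (normr_ge0 _) (b k).
have bound n : (\int[mu]_t (w t * sqn (G t))%:E <=
    (2 * (4 * K ^+ 2 * expR (- n.+1%:R)) * J)%:E +
    32%:E * energy (damp n F \- F)%R)%E.
  have D1 := damp_inLp1 n F2; have mD := mquat_damp n mF.
  have mf := mquat_fourier1 uI D1.
  have h := fourier2_approx uI F2 FG D1 mD.
  have c0 : 0 <= 2 * (4 * K ^+ 2 * expR (- n.+1%:R)).
    by rewrite !mulr_ge0// ?expR_ge0// sqr_ge0.
  apply: (@le_trans _ _ ((2 * (4 * K ^+ 2 * expR (- n.+1%:R)))%:E *
      (\int[mu]_t (expR (- `|t|))%:E) +
      2%:E * energy (fourier1 I (damp n F) \- G)%R)%E); last first.
    rewrite JE -EFinM; apply: leeD => //.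
    apply: le_trans (lee_wpmul2l _ h) _; first by rewrite lee_fin.
    by rewrite muleA -EFinM -natrM.
  have me : measurable_fun setT (fun t : R => expR (- `|t|)).
    by have /integrableP[/measurable_EFinP] := @integrable_exp_norm R.
  have mB := mquat_sqn (mquatB mf mG).
  rewrite /energy -(ge0_integral_scale c0 me (fun t => expR_ge0 _)).
  rewrite -(ge0_integral_scale (ler0n R 2) mB (fun t => sqn_ge0 _)).
  rewrite -ge0_integral_add; last 4 first.
  - exact: measurable_funM.
  - exact: measurable_funM.
  - by move=> t; rewrite mulr_ge0// expR_ge0.
  - by move=> t; rewrite mulr_ge0// sqn_ge0.
  apply: ge0_integral_le.
  - by apply: measurable_funM => //; exact: mquat_sqn.
  - by apply: measurable_funD; exact: measurable_funM.
  - by move=> t; rewrite mulr_ge0// sqn_ge0.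
  move=> t; apply: le_trans (_ : w t * (2 * sqn (fourier1 I (damp n F) t) +
      2 * sqn ((fourier1 I (damp n F) \- G) t)) <= _).
    apply: ler_wpM2l => //; rewrite /sqn !mulr_sumr -big_split/=.
    apply: ler_sum => k _; rewrite coordB -subr_ge0.
    set p := fourier1 _ _ _ _ _; set q := G _ _ _.
    rewrite (_ : _ - _ = (2 * p - q) ^+ 2); last by ring.
    exact: sqr_ge0.
  rewrite mulrDr; apply: lerD; last first.
    by rewrite ler_piMl// mulr_ge0// sqn_ge0.
  by rewrite mulrCA -mulrA; apply: ler_wpM2l => //; exact: small.
have int0 : (\int[mu]_t (w t * sqn (G t))%:E = 0)%E.
  apply/eqP; rewrite eq_le; apply/andP; split; last first.
    by apply: integral_ge0 => t _; rewrite lee_fin mulr_ge0// sqn_ge0.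
  apply/lee_addgt0Pr => e e0; rewrite add0e.
  have e64 : 0 < e / 64 by rewrite divr_gt0.
  have ce : 2 * (4 * K ^+ 2 * expR (- n.+1%:R)) * J @[n --> \oo] --> (0 : R).
    rewrite (_ : (fun n => _) = fun n => 8 * K ^+ 2 * J * expR (- 1) ^+ n.+1).
      rewrite -[X in _ --> X](mulr0 (8 * K ^+ 2 * J)).
      apply: cvgM; first exact: cvg_cst.
      rewrite (cvg_shiftS (fun n => expR (- 1) ^+ n : R)).
      by apply: cvg_expr; rewrite ger0_norm ?expR_ge0// expR_lt1 oppr_lt0.
    by apply/funext => n; rewrite -expRM_natl mulrN1; ring.
  have e2 : 0 < e / 2 by rewrite divr_gt0.
  move/cvgrPdist_le : ce => /(_ _ e2) ce.
  have [n _ /(_ n (leqnn n)) [h1 h2]] := filterI (damp_cvg F2 e64) ce.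
  apply: le_trans (bound n) _.
  rewrite sub0r normrN in h2; have {}h2 := le_trans (ler_norm _) h2.
  apply: (@le_trans _ _ ((e / 2)%:E + 32%:E * (e / 64)%:E)%E).
    by apply: leeD; [rewrite lee_fin|apply: lee_wpmul2l => //; rewrite lee_fin].
  change ((e / 2 + 32 * (e / 64))%:E <= e%:E)%E.
  by rewrite lee_fin; lra.
have mwG : measurable_fun setT (fun t => w t * sqn (G t)).
  by apply: measurable_funM => //; exact: mquat_sqn.
have : ae_eq mu setT (fun t => (w t * sqn (G t))%:E) (cst 0%E).
  apply/(ae_eq_integral_abs mu measurableT); first exact/measurable_EFinP.
  rewrite -[RHS]int0; apply: eq_integral => t _.
  by rewrite /= ger0_norm// mulr_ge0// sqn_ge0.
apply: aeS => t /(_ Logic.I) [] wG tA.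
have tA' : far_edge < `|t|.
  move: tA; rewrite in_itv/= -ler_norml; by rewrite -ltNge.
move: wG; rewrite /w /far tA' mul1r => /eqP.
rewrite mulf_eq0 gt_eqF ?expR_gt0//= => /eqP sG.
apply: quat_ext => k; rewrite mxE.
have /psumr_eq0P : \sum_(i < 4) G t 0 i ^+ 2 = 0 by exact: sG.
move=> /(_ (fun i _ => sqr_ge0 _)) /(_ k isT) /eqP.
by rewrite sqrf_eq0 => /eqP.
Qed.

End growth.
End far_spectrum.

(** * The sharp band *)

Section sharp_spectrum.
Variable R : realType.
Local Notation mu := (@lebesgue_measure R).
Local Notation kappa := ((Num.sqrt (2 * pi))^-1 : R).
Implicit Types (f : quat R -> quat R) (F G : R -> quat R) (I q : quat R).
Implicit Types (a A x y t tau : R) (k : 'I_4).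

Lemma ae_neq tau : {ae mu, forall t, t != tau}.
Proof.
exists [set tau]; split => [||t /=]; [exact: measurable_set1| |].
  exact: lebesgue_measure_set1.
by move/negP; rewrite negbK => /eqP.
Qed.

Lemma aeS2 (P Q S : R -> Prop) : (forall t, P t -> Q t -> S t) ->
  {ae mu, forall t, P t} -> {ae mu, forall t, Q t} -> {ae mu, forall t, S t}.
Proof.
move=> PQS aP aQ; apply: negligibleS (negligibleU aP aQ) => t nS.
have [Pt|nPt] := pselect (P t); last by left.
by right => Qt; apply: nS; exact: PQS.
Qed.

(** The primitive of g is locally constant off [- A, A], where Lebesgue's
    differentiation theorem identifies its derivative with g. *)
Lemma ae_eq0_of_tails (g : R -> R) a A : mu.-integrable `[- a, a] (EFin \o g) ->
  (forall tau, A < tau ->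
    \int[mu]_(t in `[- a, a]) (g t * (tau < t)%R%:R) = 0) ->
  (forall tau, A < tau ->
    \int[mu]_(t in `[- a, a]) (g t * (tau < - t)%R%:R) = 0) ->
  {ae mu, forall t, A < `|t| -> t \in `[- a, a] -> g t = 0}.
Proof.
move=> ig right left; pose D := `[- a, a]%classic : set R.
pose h := g \_ D.
have mD : measurable (D : set (measurableTypeR R)) by exact: measurable_itv.
have ih : mu.-integrable setT (EFin \o h).
  by move: ig; rewrite -/D (integrable_mkcond _ mD) restrict_EFin.
have ihx x : mu.-integrable `]-oo, x] (EFin \o h) by exact: integrableS ih.
have lh : locally_integrable setT h.
  split => [||K _ cK]; [|exact: openT|].
    by case/integrableP : ih => /measurable_EFinP.
  have mK : measurable (K : set (measurableTypeR R)) by exact: compact_measurable.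
  by have /integrableP[_] := integrableS measurableT mK (@subsetT _ K) ih.
pose T := \int[mu]_t h t.
pose F x := \int[mu]_(t in `]-oo, x]) h t.
have Fl x : x < - A -> F x = 0.
  move=> xA; rewrite /F -Rintegral_itv_bndo_bndc//; last exact: integrableS ih.
  rewrite -(left (- x)); last by rewrite ltrNr.
  rewrite Rintegral_mkcond [RHS]Rintegral_mkcond; apply: eq_Rintegral => t _.
  rewrite !patchE -/D ltrN2 /h patchE.
  rewrite (_ : (t \in `]-oo, x[%classic) = (t < x)); last first.
    by apply/idP/idP; rewrite inE/= in_itv.
  by case: (t < x); case: (t \in D); rewrite /= ?mulr1 ?mulr0.
have Fr x : A < x -> F x = T.
  move=> Ax; rewrite -[RHS]subr0 -(right x Ax) /F /T.
  rewrite Rintegral_mkcond [X in _ - X]Rintegral_mkcond.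
  have i1 : mu.-integrable setT
      (EFin \o ((fun t => g t * (x < t)%R%:R) \_ D)).
    rewrite -restrict_EFin -(integrable_mkcond _ mD).
    apply: (integrable_dominated mD _ (integrable_norm ig)) => [|t _].
      apply: measurable_funM; first by case/integrableP : ig => /measurable_EFinP.
      by apply: measurable_funTS; exact: measurable_ltr_nat.
    by rewrite normrM ler_piMr// ger0_norm// lern1 leq_b1.
  rewrite -(RintegralB measurableT ih i1); apply: eq_Rintegral => t _.
  rewrite !patchE -/D /h patchE.
  rewrite (_ : (t \in `]-oo, x]%classic) = (t <= x)); last first.
    by apply/idP/idP; rewrite inE/= in_itv.
  rewrite leNgt; case: (x < t); case: (t \in D); rewrite /= ?mulr1 ?mulr0 ?subr0//.
  by rewrite subrr.
have dF x : A < `|x| -> derive1 F x = 0.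
  move=> Ax; apply: cvg_lim => //; apply: cvg_near_cst.
  have d0 : 0 < `|x| - A by rewrite subr_gt0.
  have hd : \forall h \near (0 : R)^', `|h| < `|x| - A by exact: dnbhs0_lt.
  apply: filterS hd => s sA; suff -> : F (s + x) = F x by rewrite subrr scaler0.
  have [x0|x0] := leP 0 x.
    rewrite ger0_norm// in Ax sA.
    rewrite !Fr//; have := ler_norm (- s); rewrite normrN; lra.
  rewrite ltr0_norm// in Ax sA.
  by rewrite !Fl//; have := ler_norm s; lra.
apply: aeS (FTC1Ny ihx lh) => x [_ hx] Ax xD.
by rewrite -/F dF// /h patchE in hx; rewrite hx mem_setE xD.
Qed.

(** Since G lives on a bounded interval, the reconstruction formula on the
    imaginary axis reads f (I y) = integral of exp (- y t) G t, up to a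
    constant. The growth of f bounds these integrals by exp (A |y|), and
    Mikusinski's lemma with s t = t and s t = - t confines G to [- A, A]. *)
Lemma growth_spectrum f A C I G : left_slice_regular setT f -> 0 <= A ->
  unit_sphere I -> inLp 2 (fun x : R => f x%:A) ->
  (forall q, qnorm (f q) <= C * expR (A * qnorm q)) ->
  is_fourier2 I (fun x : R => f x%:A) G ->
  {ae mu, forall t, t \notin `[- A, A] -> G t = 0}.
Proof.
move=> rf A0 uI F2 fC FG.
pose a := A + 1 + (A + 1) ^+ 2 / 2.
have a0 : 0 <= a by rewrite !addr_ge0// divr_ge0// sqr_ge0.
have far := growth_far rf A0 uI F2 fC FG; rewrite -/a in far.
pose g k t := G t 0 k.
have ig k : mu.-integrable `[- a, a] (EFin \o g k) by exact: integrable_coord_segment FG.1.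
have mD : measurable (`[- a, a]%classic : set (measurableTypeR R)) by [].
have k0 := kappa_gt0 R.
have imaginary k y : `|\int[mu]_(t in `[- a, a]) (g k t * expR (- (y * t)))| <=
    C / kappa * expR (`|y| * A).
  rewrite mulrAC ler_pdivlMr// mulrC -(gtr0_norm k0) -normrM.
  have := slice_formula 0 y k rf F2 uI FG a0 far.
  rewrite (_ : band_integral _ _ _ _ _ =
      \int[mu]_(t in `[- a, a]) (g k t * expR (- (y * t)))) => [<-|].
    apply: le_trans (coord_le_qnorm _ _) _; apply: le_trans (fC _) _.
    have C0 : 0 <= C.
      by have := le_trans (qnorm_ge0 _) (fC 0); rewrite pmulr_lge0// expR_gt0.
    apply: ler_wpM2l => //; rewrite ler_expR mulrC; apply: ler_wpM2r => //.
    by have := qnorm_slice_le 0 y uI; rewrite normr0 add0r.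
  by apply: eq_Rintegral => t _; rewrite mul0r cos0 sin0 mulr1 mulr0 addr0 mulrC.
have bounded (s : R -> R) : (forall t, `|s t| = `|t|) ->
    forall t, (`[- a, a]%classic : set R) t -> `|s t| <= a.
  by move=> sE t; rewrite sE /= in_itv/= -ler_norml.
have aek k : {ae mu, forall t, A < `|t| -> t \in `[- a, a] -> g k t = 0}.
  apply: ae_eq0_of_tails => // tau Atau.
    apply: (@mikusinski R _ (g k) id a (C / kappa) A) => //.
    - by move=> t; exact: cvg_id.
    - exact: bounded.
    - move=> n; have := imaginary k (- n%:R); rewrite normrN [in expR (`|_| * _)]ger0_norm//.
      by under eq_Rintegral do rewrite mulNr opprK.
    - by apply: aeS (ae_neq tau) => t + _.
  apply: (@mikusinski R _ (g k) -%R a (C / kappa) A) => //.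
  - by move=> t; apply: cvgN; exact: cvg_id.
  - by apply: bounded => t; rewrite normrN.
  - move=> n; have := imaginary k n%:R; rewrite [in expR (`|_| * _)]ger0_norm//.
    by under eq_Rintegral do rewrite -mulrN.
  - by apply: aeS (ae_neq (- tau)) => t + _; apply: contraNneq => <-; rewrite opprK.
(* The exceptional sets of the four coordinates are united as a sequence of
   null sets. *)
have aeall : {ae mu, forall t, forall n, (forall k : 'I_4, k = n :> nat ->
    A < `|t| -> t \in `[- a, a] -> g k t = 0)}.
  apply: ae_foralln => n; have [n4|n4] := ltnP n 4; last first.
    by apply: aeW => t k kn; move: n4; rewrite -kn leqNgt ltn_ord.
  apply: aeS (aek (Ordinal n4)) => t h k kn.
  by rewrite (_ : k = Ordinal n4)//; apply/val_inj.
apply: (aeS2 _ far aeall) => t tfar tnear tA.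
have [ta|ta] := boolP (t \in `[- a, a]); last exact: tfar.
apply: quat_ext => k; rewrite mxE; apply: (tnear k k) => //.
by move: tA; rewrite in_itv/= -ler_norml -ltNge.
Qed.

End sharp_spectrum.

(** * Support, growth and the Paley-Wiener theorem *)

Section support_and_growth.
Variable R : realType.
Local Notation mu := (@lebesgue_measure R).
Local Notation kappa := ((Num.sqrt (2 * pi))^-1 : R).
Implicit Types (f : quat R -> quat R) (F G : R -> quat R) (I q : quat R).
Implicit Types (a A x y t tau : R) (k : 'I_4).

(** Every point off [- A, A] lies in an interval with rational end points on
    which G vanishes almost everywhere, and there are countably many such
    intervals. *)
Lemma ess_support_segment G A :
  ess_support G `<=` `[- A, A] <->
  {ae mu, forall t, t \notin `[- A, A] -> G t = 0}.
Proof.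
split=> [GA|G0]; last first.
  move=> x Gx; apply: contrapT => xA; apply: Gx; exists (~` `[- A, A]%classic) => //.
  split; first by apply: closed_openC; exact: interval_closed.
  by apply: aeS G0 => t Gt tA; apply: Gt; apply/negP.
pose P (z : rat * rat) := {ae mu, forall t, ratr z.1 < t < ratr z.2 -> G t = 0}.
have all_rational : {ae mu, forall t, forall n, forall z : rat * rat,
    unpickle n = Some z -> P z -> ratr z.1 < t < ratr z.2 -> G t = 0}.
  apply: ae_foralln => n; case E : (unpickle n) => [z|]; last by apply: aeW.
  have [Pz|nPz] := pselect (P z).
    by apply: aeS Pz => t Gt z' [<-] _; exact: Gt.
  by apply: aeW => t z' [<-].
apply: aeS all_rational => t H tA.
have [U [oU GU] Ut] : (\bigcup_(U in [set U | open U /\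
    {ae mu, forall t, U t -> G t = 0}]) U) t.
  by apply: contrapT => nU; move/negP : tA; apply; exact: GA.
have /nbhs_ballP[d /= d0 dU] : nbhs t U by exact: open_nbhs_nbhs.
have [q1 /andP[q1l q1r]] : exists q : rat, t - d < ratr q < t.
  have h : t - d < t by lra.
  by have [q] := rat_in_itvoo h; rewrite in_itv; exists q.
have [q2 /andP[q2l q2r]] : exists q : rat, t < ratr q < t + d.
  have h : t < t + d by lra.
  by have [q] := rat_in_itvoo h; rewrite in_itv; exists q.
apply: (H (pickle (q1, q2)) (q1, q2)); first by rewrite pickleK.
  apply: aeS GU => s Gs /andP[s1 s2]; apply: Gs; apply: dU.
  by rewrite -ball_normE /= ltr_norml; move: s1 s2 => /= s1 s2; lra.
by rewrite /= q1r q2l.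
Qed.

(** The vector part of q, divided by its norm r, is a square root of - 1; when
    r = 0 any I will do. *)
Lemma slice_exists q : exists I x y, unit_sphere I /\ q = slice I x y.
Proof.
have sliceE I x y : slice I x y = x *: 1 + y *: I.
  by rewrite /slice -scalerAr mulr1.
pose a := qcoord 0 q; pose b := qcoord 1 q; pose c := qcoord 2 q; pose d := qcoord 3 q.
pose r := Num.sqrt (b ^+ 2 + c ^+ 2 + d ^+ 2).
have s0 : 0 <= b ^+ 2 + c ^+ 2 + d ^+ 2 by rewrite !addr_ge0// sqr_ge0.
have rr : r ^+ 2 = b ^+ 2 + c ^+ 2 + d ^+ 2 by rewrite sqr_sqrtr.
have unit_of (u v w : R) : u ^+ 2 + v ^+ 2 + w ^+ 2 = 1 -> unit_sphere (mkquat 0 u v w).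
  move=> h; rewrite /unit_sphere /= expr2.
  have -> : mkquat 0 u v w * mkquat 0 u v w = qmul (mkquat 0 u v w) (mkquat 0 u v w) by [].
  have -> : (-1 : quat R) = - qone R by [].
  apply: quatP => -[|[|[|[|i]]]] //= _;
    rewrite /qmul /qone ?(qcoordN, qcoord_mkquat)//= ?(qcoord_mkquat)//=; lra.
have [r0|r0] := eqVneq r 0.
  exists (mkquat 0 1 0 0), a, 0; split; first by apply: unit_of; ring.
  move: rr; rewrite r0 expr0n/= => /esym/eqP.
  rewrite paddr_eq0 ?addr_ge0 ?sqr_ge0// paddr_eq0 ?sqr_ge0// !sqrf_eq0.
  move=> /andP[/andP[/eqP b0 /eqP c0] /eqP d0].
  rewrite sliceE scale0r addr0; have -> : (1 : quat R) = qone R by [].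
  apply: quatP => -[|[|[|[|i]]]] //= _;
    rewrite qcoordZ /qone qcoord_mkquat//= ?mulr1 ?mulr0//.
exists (mkquat 0 (b / r) (c / r) (d / r)), a, r; split.
  by apply: unit_of; rewrite !expr_div_n -!mulrDl -rr divff// expf_neq0.
rewrite sliceE; have -> : (1 : quat R) = qone R by [].
apply: quatP => -[|[|[|[|i]]]] //= _;
  rewrite qcoordD !qcoordZ /qone !qcoord_mkquat//= ?mulr1 ?mulr0 ?addr0 ?add0r//.
- by rewrite mulrC divfK.
- by rewrite mulrC divfK.
- by rewrite mulrC divfK.
Qed.

Lemma band_integral_bound a G I x y k : 0 <= a -> unit_sphere I -> inLp 2 G ->
  `|band_integral a (fun t => G t 0 k) (fun t => (I * G t) 0 k) x y| <=
  expR (a * `|y|) * (4 * a + 2 * \int[mu]_t sqn (G t)).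
Proof.
move=> a0 uI G2; have IG2 := inLp2_mul uI G2.
have /inLp2P[mG eG] := G2; have /inLp2P[mIG eIG] := IG2.
have mD : measurable (`[- a, a]%classic : set (measurableTypeR R)) by [].
have i1 : mu.-integrable `[- a, a] (EFin \o (fun=> 2 : R)).
  exact: continuous_integrable_segment (fun t => cvg_cst _).
have iS := integrable_sqn G2.
have iSD : mu.-integrable `[- a, a] (EFin \o (fun t => sqn (G t))).
  by apply: integrableS iS => //.
have iB := integrable_scale (expR (a * `|y|)) mD
  (integrable_add mD i1 (integrable_scale 2 mD iSD)).
have ih := integrable_band_integrand x y (integrable_coord_segment a k G2)
  (integrable_coord_segment a k IG2).
apply: le_trans (le_normr_Rintegral mD ih) _.
apply: le_trans (le_Rintegral mD (integrable_norm ih) iB _) _.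
  move=> t /= tD; rewrite normrM ger0_norm ?expR_ge0//.
  have ta : `|t| <= a by move: tD; rewrite in_itv/= -ler_norml.
  apply: ler_pM; [exact: expR_ge0|exact: normr_ge0| |].
    rewrite ler_expR; apply: le_trans (ler_norm _) _.
    by rewrite normrN normrM mulrC ler_wpM2r.
  have sq (H : R -> quat R) : `|H t 0 k| <= 1 + sqn (H t).
    have h : H t 0 k ^+ 2 <= sqn (H t).
      by rewrite /sqn (bigD1 k)//= lerDl sumr_ge0// => i _; exact: sqr_ge0.
    apply: le_trans (_ : 1 + H t 0 k ^+ 2 <= _); last by rewrite lerD2l.
    exact: norm_le_1Dsqr.
  apply: le_trans (norm_cos_sin_le _ _ _) _.
  have := sq G; have := sq (fun t => I * G t); rewrite sqn_mul sqn_unit// mul1r.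
  by move=> h1 h2; lra.
rewrite (RintegralZl _ mD (integrable_add mD i1 (integrable_scale 2 mD iSD))).
apply: ler_wpM2l; first exact: expR_ge0.
rewrite (RintegralD mD i1 (integrable_scale 2 mD iSD)) (RintegralZl _ mD iSD).
apply: lerD.
  rewrite Rintegral_segment_cst; last by lra.
  by apply: eq_ler; ring.
apply: ler_wpM2l => //; rewrite Rintegral_mkcond.
have iSD' : mu.-integrable setT (EFin \o ((fun t => sqn (G t)) \_ `[- a, a]%classic)).
  by rewrite -restrict_EFin -(integrable_mkcond _ mD).
apply: (le_Rintegral measurableT iSD' iS) => t _.
by rewrite patchE; case: ifPn => // _; exact: sqn_ge0.
Qed.

(** On the band exp (- y t) is at most exp (A |y|) and |y| <= |x + I y|; the
    remaining factor is bounded through the energy of the transform, which is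
    controlled by that of f on the real line and so does not depend on I. *)
Lemma growth_of_spectrum f A : 0 <= A ->
  left_slice_regular setT f -> inLp 2 (fun x : R => f x%:A) ->
  (forall I, unit_sphere I ->
    {ae mu, forall t, t \notin `[- A, A] -> fourier I (fun x : R => f x%:A) t = 0}) ->
  exists C : R, forall q, qnorm (f q) <= C * expR (A * qnorm q).
Proof.
move=> A0 rf F2 G0; have /inLp2P[mF eF] := F2.
pose E := fine (energy (fun x : R => f x%:A)).
have EE : (energy (fun x : R => f x%:A) = E%:E)%E.
  by rewrite fineK// ge0_fin_numE// energy_ge0.
pose B := kappa * (4 * A + 2 * (8 * E)).
exists (4 * B) => q; have [I [x [y [uI ->]]]] := slice_exists q.
have FG := fourierP uI F2; set G := fourier _ _ in FG.
have G2 := FG.1; have k0 := kappa_gt0 R.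
have GE : \int[mu]_t sqn (G t) <= 8 * E.
  rewrite -lee_fin /Rintegral fineK; last exact: integrable_fin_num _ (integrable_sqn G2).
  by have := fourier2_energy uI F2 FG; rewrite EE -EFinM.
have E0 : 0 <= E by rewrite -lee_fin -EE energy_ge0.
have yq : `|y| <= qnorm (slice I x y).
  rewrite (_ : qnorm _ = Num.sqrt (sqn (slice I x y)))// sqn_slice//.
  by rewrite -sqrtr_sqr ler_wsqrtr// lerDr sqr_ge0.
apply: le_trans (qnorm_le_sum _) _.
apply: (@le_trans _ _ (\sum_(k < 4) B * expR (A * qnorm (slice I x y)))); last first.
  by rewrite big_const_ord iter_addr_0 -[leLHS]mulr_natl mulrA.
apply: ler_sum => k _.
rewrite (slice_formula x y k rf F2 uI FG A0 (G0 I uI)) normrM gtr0_norm//.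
rewrite /B -mulrA; apply: ler_wpM2l; first exact: ltW.
apply: le_trans (band_integral_bound x y k A0 uI G2) _.
rewrite mulrC; apply: ler_pM.
- by rewrite addr_ge0 ?mulr_ge0// Rintegral_ge0// => t _; exact: sqn_ge0.
- exact: expR_ge0.
- by rewrite lerD2l ler_wpM2l.
- by rewrite ler_expR ler_wpM2l.
Qed.

End support_and_growth.

Theorem mainTheorem1 (R : realType) (f : quat R -> quat R) (A : R)
    (f_regular : left_slice_regular setT f)
    (f_L2 : inLp 2 (fun x : R => f x%:A))
    (A_gt0 : 0 < A) :
  let growth := exists C : R, forall q : quat R,
    qnorm (f q) <= C * expR (A * qnorm q) in
  let band_limited := forall I : quat R, unit_sphere I ->
    ess_support (fourier I (fun x : R => f x%:A)) `<=` `[- A, A] in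
  (growth <-> band_limited) /\
  (growth \/ band_limited ->
   forall (I : quat R) (x y : R), unit_sphere I ->
     f (slice I x y) =
     (Num.sqrt (2 * pi))^-1 *:
       qintegral `[- A, A] (fun t : R =>
         qexp (I * slice I x y * t%:A) *
         fourier I (fun u : R => f u%:A) t)).
Proof.
move=> growth band_limited; have A_ge0 := ltW A_gt0.
have gb : growth -> band_limited.
  move=> [C fC] I uI; apply/ess_support_segment.
  exact: growth_spectrum f_regular A_ge0 uI f_L2 fC (fourierP uI f_L2).
have bg : band_limited -> growth.
  move=> b; apply: growth_of_spectrum => // I uI.
  by apply/ess_support_segment; exact: b.
split; first by split.
move=> gOb I x y uI.
have b : band_limited by case: gOb => [/gb|].
apply: (slice_formula_qintegral _ _ f_regular f_L2 uI (fourierP uI f_L2) A_ge0).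
by apply/ess_support_segment; exact: b.
Qed.
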